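(* Let $d\ge 2$ and $p\in[1,\infty]$. Let $C_0>0$, let $W:\mathbb{R}^d\to\mathbb{C}^d$ and $V:\mathbb{R}^d\to\mathbb{C}$ satisfy $$\sup_{x\in\mathbb{R}^d}|\partial_x^\alpha W(x)|\le C_0^{|\alpha|},\qquad \sup_{x\in\mathbb{R}^d}|\partial_x^\alpha V(x)|\le C_0^{|\alpha|},\qquad\forall\alpha\in\mathbb{N}_0^d,$$ and let $u\in L^p(\mathbb{R}^d)$ be a solution of $$\Delta u=W(x)\cdot\nabla u+V(x)u,\qquad x\in\mathbb{R}^d,$$ with $\|u\|_{L^p(\mathbb{R}^d)}=1$. (i) If $p=1$, then there exists a constant $K=K(d)>0$, depending only on $d$ (in particular not on $C_0,W,V,u,\kappa$), such that for any $\kappa>1$, $$\|\partial_x^\alpha u\|_{L^1(\mathbb{R}^d)}\le K\left(\kappa C_0+K\left(\frac{1}{\log\kappa}+1\right)\right)^{|\alpha|}\frac{|\alpha|!}{\log^{|\alpha|}(|\alpha|+e)},\qquad\forall\alpha\in\mathbb{N}_0^d .$$ (ii) If $1<p\le\infty$, then there exists a constant $K=K(d,p)>0$, depending only on $d$ and $p$ (in particular not on $C_0,W,V,u,\kappa$), such that for any $\kappa>1$, $$\|\partial_x^\alpha u\|_{L^p(\mathbb{R}^d)}\le\left(\kappa C_0+K\left(\frac{1}{\log\kappa}+1\right)\right)^{|\alpha|}\frac{|\alpha|!}{\log^{|\alpha|}(|\alpha|+e)},\qquad\forall\alpha\in\mathbb{N}_0^d .$$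
   Context: $\mathbb{N}_0=\{0,1,2,\dots\}$; for $\alpha=(\alpha_1,\dots,\alpha_d)\in\mathbb{N}_0^d$, $|\alpha|=\alpha_1+\cdots+\alpha_d$. $\log$ is the natural logarithm and $\log^n(y)=(\log y)^n$. $W,V$ are smooth; functions are complex-valued. The equation is understood in the sense of distributions. *)

(* Defs.v *)
From HB Require Import structures.
From mathcomp Require Import all_boot all_order all_algebra.
From mathcomp Require Import all_classical all_reals all_analysis.
From mathcomp Require Import complex.

Set Implicit Arguments.
Unset Strict Implicit.
Unset Printing Implicit Defensive.

Import Order.TTheory GRing.Theory Num.Theory.
Import numFieldNormedType.Exports ComplexField.Normc.

Local Open Scope classical_set_scope.
Local Open Scope ring_scope.

Definition rV_display : measure_display.
Proof. exact: default_measure_display. Qed.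

(* The product sigma-algebra on R^n; it coincides with the Borel one. *)
Section measurable_rV.
Context {R : realType} (n : nat).

Let coors : 'I_n -> 'rV[R]_n -> R := fun i x => x 0 i.

Let rV_set0 : g_sigma_preimage coors set0.
Proof. exact: sigma_algebra0. Qed.

Let rV_setC A : g_sigma_preimage coors A -> g_sigma_preimage coors (~` A).
Proof. exact: sigma_algebraC. Qed.

Let rV_bigcup (F : (set 'rV[R]_n)^nat) :
  (forall i, g_sigma_preimage coors (F i)) ->
  g_sigma_preimage coors (\bigcup_i (F i)).
Proof. exact: sigma_algebra_bigcup. Qed.

HB.instance Definition _ := @isMeasurable.Build rV_display
  'rV[R]_n (g_sigma_preimage coors) rV_set0 rV_setC rV_bigcup.

End measurable_rV.

Lemma measurable_coord (R : realType) n (i : 'I_n) :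
  measurable_fun [set: 'rV[R]_n] (fun x : 'rV[R]_n => x 0 i).
Proof.
move=> _ Y mY; rewrite setTI; apply: sub_sigma_algebra => /=.
rewrite -bigcup_seq/=; exists i => /=; first by rewrite mem_index_enum.
by exists Y => //; rewrite setTI.
Qed.

Lemma measurable_fun_rV d (T : measurableType d) (R : realType) n
    (f : T -> 'rV[R]_n) :
  (forall i, measurable_fun [set: T] (fun t => f t 0 i)) ->
  measurable_fun [set: T] f.
Proof.
move=> mf _ A mA; rewrite setTI.
suff: g_sigma_preimage (fun i (x : 'rV[R]_n) => x 0 i) `<=`
    [set B | measurable (f @^-1` B)] by exact.
apply: smallest_sub.
  split => /=.
  - by rewrite preimage_set0.
  - by move=> B mB; rewrite setTD preimage_setC; exact: measurableC.
  - by move=> F mF; rewrite preimage_bigcup; exact: bigcup_measurable.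
rewrite -bigcup_seq => B [i _ [C mC <-]] /=.
by rewrite setTI -comp_preimage -[X in measurable X]setTI; exact: mf.
Qed.

Section sigma_finite_copy.
Context d (T : measurableType d) (R : realType).
Variables (m : {measure set T -> \bar R}) (sf : sigma_finite setT m).

Definition sigma_finite_copy of sigma_finite setT m : set T -> \bar R := m.

HB.instance Definition _ := Measure.copy (sigma_finite_copy sf) m.
HB.instance Definition _ :=
  Measure_isSigmaFinite.Build _ _ _ (sigma_finite_copy sf) sf.

End sigma_finite_copy.

Section lebesgue_rV.
Context {R : realType}.

Definition rV_cons n (p : measurableTypeR R * 'rV[R]_n) : 'rV[R]_n.+1 :=
  \row_i (if unlift ord0 i is Some j then p.2 0 j else p.1).

Definition rV_uncons n (x : 'rV[R]_n.+1) : measurableTypeR R * 'rV[R]_n :=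
  (x 0 ord0, \row_i x 0 (lift ord0 i)).

Lemma rV_consK n : cancel (@rV_cons n) (@rV_uncons n).
Proof.
move=> [a x]; rewrite /rV_uncons mxE unlift_none; congr pair.
by apply/rowP => i; rewrite !mxE liftK.
Qed.

Lemma measurable_rV_cons n : measurable_fun setT (@rV_cons n).
Proof.
apply: measurable_fun_rV => i; under eq_fun do rewrite mxE.
case: unliftP => [j _|_]; last exact: measurable_fst.
exact: (measurableT_comp (measurable_coord j) measurable_snd).
Qed.

Lemma measurable_rV_uncons n : measurable_fun setT (@rV_uncons n).
Proof.
apply/measurable_fun_pairP; split; first exact: measurable_coord.
apply: measurable_fun_rV => i.
by under eq_fun do rewrite mxE; exact: measurable_coord.
Qed.

(* Lebesgue measure on R^n: the n-fold product of the one-dimensional one. *)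
Fixpoint lebesgue_rV n : set 'rV[R]_n -> \bar R :=
  match n with
  | 0 => \d_(0 : 'rV[R]_0)
  | m.+1 => pushforward (product_measure1 (@lebesgue_measure R) (@lebesgue_rV m))
              (@rV_cons m)
  end.


(* [rV_uncons] being a measurable inverse, a sigma-finite cover of the product
   is transported to one of R^n. *)
Let lebesgue_rV_structure n :
  {m : {sigma_finite_measure set 'rV[R]_n -> \bar R} |
    m = @lebesgue_rV n :> (set 'rV[R]_n -> \bar R)}.
Proof.
elim: n => [|n [m mE]].
  by exists [the {sigma_finite_measure set 'rV[R]_0 -> \bar R}
    of \d_(0 : 'rV[R]_0)].
rewrite /= -mE.
pose L : {sigma_finite_measure set (measurableTypeR R) -> \bar R} :=
  @lebesgue_measure R.
pose P := product_measure1 L m.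
have sP : sigma_finite setT P.
  have /sigma_finiteP[F [TF ndF Foo]] := sigma_finiteT L.
  have /sigma_finiteP[G [TG ndG Goo]] := sigma_finiteT m.
  exists (fun k => F k `*` G k).
    rewrite -setXTT TF TG predeqE => -[x y]; split=> [|[k _ []]/=]; last first.
      by move=> ? ?; split; exists k.
    move=> [/= [k _ Fx] [l _ Gy]]; exists (maxn k l) => //; split.
    - by move: x Fx; exact/subsetPset/ndF/leq_maxl.
    - by move: y Gy; exact/subsetPset/ndG/leq_maxr.
  move=> k; have [mF Fk] := Foo k; have [mG Gk] := Goo k.
  split; first exact: measurableX.
  by rewrite /P product_measure1E// lte_mul_pinfty// ge0_fin_numE.
have [M ME] : {M : {measure set 'rV[R]_n.+1 -> \bar R} |
    M = pushforward P (@rV_cons n) :> (set _ -> \bar R)}.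
  unshelve eexists (pushforward P (@rV_cons n) : {measure set _ -> \bar R}).
    exact: measurable_rV_cons.
  by [].
have sf : sigma_finite setT M.
  have [F TF Foo] := sP.
  exists (fun k => @rV_uncons n @^-1` F k).
    by rewrite -preimage_bigcup -TF preimage_setT.
  move=> k; have [mF Fk] := Foo k; split.
    by rewrite -[X in measurable X]setTI; exact: measurable_rV_uncons.
  rewrite ME /pushforward -comp_preimage (_ : _ \o _ = id) ?preimage_id//.
  by apply/funext => p /=; exact: rV_consK.
by exists [the {sigma_finite_measure set 'rV[R]_n.+1 -> \bar R} of
  sigma_finite_copy sf].
Qed.

Section instances.
Context (n : nat).
Local Open Scope ereal_scope.

Let lebesgue_rV0 : @lebesgue_rV n set0 = 0.
Proof. by have [m <-] := lebesgue_rV_structure n. Qed.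

Let lebesgue_rV_ge0 A : 0 <= @lebesgue_rV n A.
Proof. by have [m <-] := lebesgue_rV_structure n. Qed.

Let lebesgue_rV_sigma_additive : semi_sigma_additive (@lebesgue_rV n).
Proof.
have [m <-] := lebesgue_rV_structure n.
exact: measure_semi_sigma_additive.
Qed.

HB.instance Definition _ := isMeasure.Build _ _ _ (@lebesgue_rV n)
  lebesgue_rV0 lebesgue_rV_ge0 lebesgue_rV_sigma_additive.

Let lebesgue_rV_sigma_finite : sigma_finite setT (@lebesgue_rV n).
Proof. by have [m <-] := lebesgue_rV_structure n; exact: sigma_finiteT. Qed.

HB.instance Definition _ :=
  Measure_isSigmaFinite.Build _ _ _ (@lebesgue_rV n) lebesgue_rV_sigma_finite.

End instances.

Lemma lebesgue_rV_box n (A : 'I_n -> set (measurableTypeR R)) :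
  (forall i, measurable (A i)) ->
  lebesgue_rV [set x : 'rV[R]_n | forall i, A i (x 0 i)] =
  (\prod_(i < n) lebesgue_measure (A i))%E.
Proof.
elim: n A => [|n IHn] A mA.
  rewrite big_ord0 /= diracE (_ : _ \in _)//.
  by rewrite inE /= => -[].
rewrite big_ord_recl /= /pushforward -IHn//.
rewrite -product_measure1E//; last first.
  rewrite [X in measurable X](_ : _ =
      \bigcap_(i : 'I_n) ((fun x : 'rV[R]_n => x 0 i) @^-1` A (lift ord0 i))).
    apply: fin_bigcap_measurable => // i _.
    by rewrite -[X in measurable X]setTI; apply: measurable_coord => //; exact: mA.
  by apply/seteqP; split=> x /= xA i => [_|]; exact: xA.
congr product_measure1; apply/seteqP; split => -[a x] /=.
  move=> xA; split=> [|i].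
    by have := xA ord0; rewrite mxE unlift_none.
  by have := xA (lift ord0 i); rewrite mxE liftK.
move=> [Aa Ax] i; rewrite mxE.
by case: unliftP => [j|] ->.
Qed.

End lebesgue_rV.
Arguments lebesgue_rV {R} n.

(* Complex-valued functions are differentiated and integrated through their
   real and imaginary parts. *)
Section distributions.
Context {R : realType} {d : nat}.
Implicit Types (f u phi : 'rV[R]_d -> R[i]) (a : 'I_d -> nat).

Definition Cpartial (i : 'I_d) f : 'rV[R]_d -> R[i] := fun x =>
  Complex ('D_(delta_mx 0 i) (fun y => complex.Re (f y)) x)
          ('D_(delta_mx 0 i) (fun y => complex.Im (f y)) x).

Definition mlen a : nat := (\sum_(i < d) a i)%N.

(* [mpow D a] is D_0^(a_0) ... D_(d-1)^(a_(d-1)). *)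
Definition mpow (X : Type) (D : 'I_d -> X -> X) a (x : X) : X :=
  foldr (fun i => iter (a i) (D i)) x (enum 'I_d).

Definition Cpartials (s : seq 'I_d) f := foldr Cpartial f s.

(* All iterated partial derivatives, in any order, exist and are continuous. *)
Definition smooth f : Prop :=
  forall s : seq 'I_d,
    [/\ continuous (fun x => complex.Re (Cpartials s f x)),
        continuous (fun x => complex.Im (Cpartials s f x)),
        forall (i : 'I_d) x,
          derivable (fun y => complex.Re (Cpartials s f y)) x (delta_mx 0 i) &
        forall (i : 'I_d) x,
          derivable (fun y => complex.Im (Cpartials s f y)) x (delta_mx 0 i)].

Definition test_function phi : Prop :=
  smooth phi /\ compact (closure [set x | phi x != 0]).

Definition Cmeasurable f : Prop :=
  measurable_fun setT (fun x => complex.Re (f x)) /\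
  measurable_fun setT (fun x => complex.Im (f x)).

Definition Cintegral f : R[i] :=
  Complex (\int[lebesgue_rV d]_x complex.Re (f x))
          (\int[lebesgue_rV d]_x complex.Im (f x)).

Definition CLnorm (p : \bar R) f : \bar R :=
  'N[lebesgue_rV d]_p[EFin \o (@normc R \o f)].

(* Functionals on functions; only their values on test functions matter. *)
Definition functional : Type := ('rV[R]_d -> R[i]) -> R[i].
Implicit Types T : functional.

Definition dist_eq T T' : Prop :=
  forall phi, test_function phi -> T phi = T' phi.

Definition dist_of u : functional := fun phi => Cintegral (fun x => u x * phi x).

Definition dist_partial (i : 'I_d) T : functional :=
  fun phi => - T (Cpartial i phi).

Definition dist_mul f T : functional :=
  fun phi => T (fun x => f x * phi x).

Definition laplacian T : functional :=
  fun phi => \sum_(i < d) dist_partial i (dist_partial i T) phi.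

(* Delta u = W . grad u + V u in the sense of distributions: grad u is the
   distributional gradient, on which the smooth W and V act by [dist_mul]. *)
Definition solution (W : 'rV[R]_d -> 'rV[R[i]]_d) (V u : 'rV[R]_d -> R[i]) :=
  dist_eq (laplacian (dist_of u))
    (fun phi =>
       (\sum_(j < d)
          dist_mul (fun x => W x 0 j) (dist_partial j (dist_of u)) phi)
       + dist_mul V (dist_of u) phi).

(* L^p classes are given by Borel representatives. *)
Definition Lp_function (p : \bar R) u : Prop :=
  Cmeasurable u /\ (CLnorm p u < +oo)%E.

(* ||T||_{L^p} <= B for a distribution T; this includes T being an L^p
   function. *)
Definition dist_Lnorm_le (p : \bar R) T (B : R) : Prop :=
  exists v, [/\ Lp_function p v, dist_eq T (dist_of v) &
                (CLnorm p v <= B%:E)%E].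

Definition Cvnorm (z : 'rV[R[i]]_d) : R :=
  Num.sqrt (\sum_(j < d) normc (z 0 j) ^+ 2).

Definition vsmooth (W : 'rV[R]_d -> 'rV[R[i]]_d) : Prop :=
  forall j, smooth (fun x => W x 0 j).

Definition vpartial a (W : 'rV[R]_d -> 'rV[R[i]]_d) : 'rV[R]_d -> 'rV[R[i]]_d :=
  fun x => \row_j mpow Cpartial a (fun y => W y 0 j) x.

End distributions.

(* Main.v *)
From HB Require Import structures.
Require Import Defs.
From mathcomp Require Import all_boot all_order all_algebra.
From mathcomp Require Import all_classical all_reals all_analysis.
From mathcomp Require Import complex.
From mathcomp Require Import measurable_realfun ess_sup_inf ring lra.

Set Implicit Arguments.
Unset Strict Implicit.
Unset Printing Implicit Defensive.

Import Order.TTheory GRing.Theory Num.Theory.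
Import numFieldNormedType.Exports ComplexField.Normc.

Local Open Scope classical_set_scope.
Local Open Scope ring_scope.

(** The argument is uniform in the exponent p in [1, +oo] and yields the bound
    with C0 + K, for some K depending on d only, in place of the larger
    kappa C0 + K (1 / ln kappa + 1).

    Let M_n bound the L^p norms of the derivatives of u of order n, and let
    B_n = A^n n! / ln(n + e)^n with A = C0 + K; the claim is M_n <= B_n.
    Interior regularity of the Laplacian at a scale r <= 1 reads
      || d_j w || <= C (|| w || / r + r || Delta w ||)     (gradient_bound).
    For w = d^s u with |s| = n - 1, the Leibniz rule expands Delta w, which is
    d^s (W . grad u + V u), so that
      M_n <= C (M_(n-1) / r
                + r sum_(k < n) binom(n-1, k) C0^(n-1-k) (d M_(k+1) + M_k)).
    Put t = (ln(n + e) + 3) / A.  Then B_(n-m) <= B_n t^m (n-m)! / n!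
    (log_bound_ratio), so if M_k <= B_k below n, the first term is at most
    C B_n t / (n r), and the sum, up to its term in M_n, is at most a multiple
    of B_n exp(C0 t).  A dyadic r comparable to t / n makes the first term
    small.  It also makes the second one small, because
    C0 t = ln(n + e) + 3 - K t and t exp(- K t) <= 1 / K, whence t exp(C0 t) is
    at most a small multiple of n when K is large (scale_choice): the room K
    between A and C0 pays for the exponential.  What remains is
    M_n <= B_n / 4 + M_n / 2, and the last term is absorbed by iteration
    (derivative_bound).

    Absorption needs M_n to be finite, while u is merely an L^p solution in the
    sense of distributions.  This is drift_gradient: an L^p solution w of
    Delta w = W . grad w + g with g in L^p has its gradient in L^p.  It is
    applied to w = d^s u, whose commutators with W are of lower order
    (commutator_Lp).

    Both regularity statements rest on smooth compactly supported kernels with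
    rho_m - rho_(m+1) = Delta kappa_(m+1), where rho_m is an approximation of
    the identity at scale 2^-m and kappa_m has L^1 norm O(4^-m)
    (kernels_exist).  The difference of consecutive mollified gradients of w is
    then the convolution of Delta w with d_j kappa_(m+1), of size O(2^-m), and
    the sum converges in L^p (Lp_limit).  Only the bound
    || f * k ||_p <= C || f ||_p || k ||_1 enters, so the endpoints p = 1 and
    p = +oo are not exceptional, as they would be for singular integrals.  With
    a drift, Delta w is no longer controlled; but the same expansion without
    d_j gives || w - w * rho_m || = O(2^-m), and splitting
    w = w * rho_m + O(2^-m) in the drift term leads to
    a_(m+1) <= a_m + O(2^-m) (a_m + 1) for the norms a_m of the mollified
    gradients, which therefore stay bounded. *)

(** * Iterated partial derivatives of real functions *)

Section real_calculus.
Context {R : realType} {d : nat}.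
Local Notation E := 'rV[R]_d.
Implicit Types (f g : E -> R) (x v : E).

Definition unitv (i : 'I_d) : E := delta_mx 0 i.
Definition pd (i : 'I_d) f : E -> R := fun x => 'D_(unitv i) f x.
Definition pds (s : seq 'I_d) f := foldr pd f s.

(** Partial derivatives are directional derivatives along the canonical basis,
    as in the definition of smoothness for complex functions. *)
Fixpoint Ck n f : Prop :=
  continuous f /\
  (if n is m.+1 then (forall i x, derivable f x (unitv i)) /\
                      (forall i, Ck m (pd i f)) else True).

Definition rsmooth f := forall n, Ck n f.

Lemma rsmooth_cont f : rsmooth f -> continuous f.
Proof. by move=> /(_ 0%N)[]. Qed.

Lemma rsmooth_derivable f : rsmooth f -> forall i x, derivable f x (unitv i).
Proof. by move=> /(_ 1%N)[_ []]. Qed.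
Arguments rsmooth_derivable [f] _ _ _.

Lemma rsmooth_pd f i : rsmooth f -> rsmooth (pd i f).
Proof. by move=> sf n; have [_ [_]] := sf n.+1; exact. Qed.

Lemma rsmooth_pds f s : rsmooth f -> rsmooth (pds s f).
Proof. by move=> sf; elim: s => //= i s; exact: rsmooth_pd. Qed.

Lemma CkW n f : Ck n.+1 f -> Ck n f.
Proof.
elim: n f => [|n IHn] f; first by case.
move=> [cf [df pf]]; split => //; split => // i.
exact/IHn/pf.
Qed.

(** The coinductive way to establish smoothness. *)
Lemma rsmooth_class (S : set (E -> R)) :
  (forall f, S f -> [/\ continuous f, forall i x, derivable f x (unitv i)
                     & forall i, S (pd i f)]) ->
  forall f, S f -> rsmooth f.
Proof.
move=> HS f Sf n; elim: n f Sf => [|n IHn] f /HS[cf df pf]; first by [].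
by split => //; split => // i; exact/IHn/pf.
Qed.

Lemma pdD f g i : (forall x, derivable f x (unitv i)) ->
  (forall x, derivable g x (unitv i)) -> pd i (f \+ g) = pd i f \+ pd i g.
Proof. by move=> df dg; apply/funext => x; rewrite /pd deriveD. Qed.

Lemma pdB f g i : (forall x, derivable f x (unitv i)) ->
  (forall x, derivable g x (unitv i)) -> pd i (f \- g) = pd i f \- pd i g.
Proof. by move=> df dg; apply/funext => x; rewrite /pd deriveB. Qed.

Lemma pdN f i : (forall x, derivable f x (unitv i)) ->
  pd i (\- f) = \- pd i f.
Proof. by move=> df; apply/funext => x; rewrite /pd deriveN. Qed.

Lemma pdM f g i : (forall x, derivable f x (unitv i)) ->
  (forall x, derivable g x (unitv i)) ->
  pd i (f \* g) = (pd i f \* g) \+ (f \* pd i g).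
Proof.
move=> df dg; apply/funext => x; rewrite /pd.
by rewrite deriveM//= /GRing.scale/= addrC mulrC.
Qed.

Lemma pd_cst (c : R) i : pd i (cst c) = cst 0.
Proof. by apply/funext => x; rewrite /pd derive_cst. Qed.

Lemma Ck_cst n (c : R) : Ck n (cst c).
Proof.
elim: n c => [|n IHn] c; first by split => //; exact: cst_continuous.
split; first exact: cst_continuous.
by split => [i x|i]; [exact: derivable_cst | rewrite pd_cst].
Qed.

Lemma CkD n f g : Ck n f -> Ck n g -> Ck n (f \+ g).
Proof.
elim: n f g => [|n IHn] f g [cf Hf] [cg Hg].
  by split => // x; apply: continuousD; [exact: cf|exact: cg].
case: Hf Hg => df pf [dg pg].
split; first by move=> x; apply: continuousD; [exact: cf|exact: cg].
split => [i x|i]; first exact: derivableD.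
by rewrite pdD//; apply: IHn; [exact: pf|exact: pg].
Qed.

Lemma CkN n f : Ck n f -> Ck n (\- f).
Proof.
elim: n f => [|n IHn] f [cf Hf].
  by split => // x; apply: continuousN; exact: cf.
case: Hf => df pf.
split; first by move=> x; apply: continuousN; exact: cf.
split => [i x|i]; first exact: derivableN.
by rewrite pdN//; apply: IHn; exact: pf.
Qed.

Lemma CkM n f g : Ck n f -> Ck n g -> Ck n (f \* g).
Proof.
elim: n f g => [|n IHn] f g Hf0 Hg0; have [cf Hf] := Hf0; have [cg Hg] := Hg0.
  by split => // x; apply: continuousM; [exact: cf|exact: cg].
case: Hf Hg => df pf [dg pg].
split; first by move=> x; apply: continuousM; [exact: cf|exact: cg].
split => [i x|i]; first exact: derivableM.
rewrite pdM//; apply: CkD; apply: IHn.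
- exact: pf.
- exact: CkW.
- exact: CkW.
- exact: pg.
Qed.

Lemma rsmooth_cst (c : R) : rsmooth (cst c).
Proof. by move=> n; exact: Ck_cst. Qed.
Lemma rsmoothD f g : rsmooth f -> rsmooth g -> rsmooth (f \+ g).
Proof. by move=> sf sg n; exact: CkD. Qed.
Lemma rsmoothM f g : rsmooth f -> rsmooth g -> rsmooth (f \* g).
Proof. by move=> sf sg n; exact: CkM. Qed.
Lemma rsmoothN f : rsmooth f -> rsmooth (\- f).
Proof. by move=> sf n; exact: CkN. Qed.
Lemma rsmoothB f g : rsmooth f -> rsmooth g -> rsmooth (f \- g).
Proof. by move=> sf sg; exact/rsmoothD/rsmoothN. Qed.

Lemma is_derive_line f x v (t : R) : derivable f (x + t *: v) v ->
  is_derive t 1 (fun t => f (x + t *: v)) ('D_v f (x + t *: v)).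
Proof.
move=> dfx.
have eqf : (fun h : R => h^-1 *: ((fun t => f (x + t *: v)) (h *: (1:R) + t)
     - (fun t => f (x + t *: v)) t)) =
   (fun h : R => h^-1 *: (f (h *: v + (x + t *: v)) - f (x + t *: v))).
  by apply/funext => h; rewrite scaler1 scalerDl addrCA addrA.
split; first by rewrite /derivable /= eqf.
by rewrite /derive /= eqf.
Qed.

Lemma derive_line f x v (l : R) : is_derive (0 : R) 1 (fun t => f (x + t *: v)) l ->
  is_derive x v f l.
Proof.
move=> [dl <-].
have eqf : (fun h : R => h^-1 *: ((fun t => f (x + t *: v)) (h *: (1:R) + 0)
     - (fun t => f (x + t *: v)) 0)) =
   (fun h : R => h^-1 *: (f (h *: v + x) - f x)).
  apply/funext => h.
  by rewrite scaler1 addr0 scale0r addr0 [x + _]addrC.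
split; first by move: dl; rewrite /derivable /= eqf.
by rewrite /derive /= eqf.
Qed.

Lemma MVT_line f x v (t : R) : 0 < t ->
  (forall y, derivable f y v) ->
  exists2 c, 0 < c < t & f (x + t *: v) - f x = t * 'D_v f (x + c *: v).
Proof.
move=> t0 df.
have H (s : R) : is_derive s 1 (fun t => f (x + t *: v)) ('D_v f (x + s *: v)).
  exact: is_derive_line.
have [//|c] := @MVT _ (fun t => f (x + t *: v)) (fun t => 'D_v f (x + t *: v)) 0 t t0.
  move=> ?; apply: continuous_subspaceT => s.
  apply/differentiable_continuous/derivable1_diffP; exact: ex_derive.
rewrite in_itv/= => c0t E; exists c => //.
by move: E; rewrite scale0r addr0 subr0 mulrC.
Qed.

Lemma is_derive_affine (a b t : R) :
  is_derive t 1 (fun t : R => t * a + b) a.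
Proof.
have : is_derive t (1 : R) (a \*: (@id R) + cst b) (a *: 1 + 0).
  exact: is_deriveD.
rewrite addr0 [a *: 1]mulr1 => H.
rewrite (_ : (fun t => _) = a \*: (@id R) + cst b)//.
by apply/funext => u; rewrite mulrC.
Qed.

Lemma is_derive_coord i j x :
  is_derive x (unitv j) (fun x : E => x 0 i) (i == j)%:R.
Proof.
apply: derive_line.
rewrite (_ : (fun t => _) = (fun t => t * (i == j)%:R + x 0 i)); last first.
  by apply/funext => t; rewrite !mxE eqxx addrC.
exact: is_derive_affine.
Qed.

Lemma pd_coord i j : pd j (fun x : E => x 0 i) = cst (i == j)%:R.
Proof.
apply/funext => x; rewrite /pd; have H := is_derive_coord i j x.
by rewrite derive_val.
Qed.

Lemma rsmooth_coord i : rsmooth (fun x : E => x 0 i).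
Proof.
case=> [|n]; first by split => // x; exact: coord_continuous.
split; first by move=> x; exact: coord_continuous.
split => [j x|j]; first by have H := is_derive_coord i j x; exact: ex_derive.
by rewrite pd_coord; exact: Ck_cst.
Qed.

(** The mean value theorem, applied first along i to the difference along j
    and then along j.  The left-hand side being symmetric in i and j, the two
    mixed derivatives take equal values at points arbitrarily close to x. *)
Lemma second_difference f i j x (h : R) : 0 < h -> rsmooth f ->
  exists c1 c2, [/\ 0 < c1 < h, 0 < c2 < h &
    f (x + h *: unitv i + h *: unitv j) - f (x + h *: unitv i)
     - (f (x + h *: unitv j) - f x)
    = h ^+ 2 * pd j (pd i f) (x + c1 *: unitv i + c2 *: unitv j)].
Proof.
move=> h0 sf.
pose g y := f (y + h *: unitv j) - f y.
have dT y : derivable (fun y => f (y + h *: unitv j)) y (unitv i) /\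
   'D_(unitv i) (fun y => f (y + h *: unitv j)) y = pd i f (y + h *: unitv j).
  suff H : is_derive y (unitv i) (fun y => f (y + h *: unitv j))
      (pd i f (y + h *: unitv j)).
    by split; [exact: ex_derive|exact: derive_val].
  apply: derive_line.
  have := @is_derive_line f (y + h *: unitv j) (unitv i) 0 (rsmooth_derivable sf _ _).
  rewrite scale0r addr0 /pd.
  rewrite (_ : (fun t => f (y + _ + _)) = (fun t => f (y + t *: unitv i + h *: unitv j)))//.
  by apply/funext => t; rewrite addrAC.
have dg y : derivable g y (unitv i).
  by apply: derivableB; [exact: (dT y).1|exact: rsmooth_derivable].
have [c1 c1h E1] := @MVT_line g x (unitv i) h h0 dg.
have Dg y : 'D_(unitv i) g y = pd i f (y + h *: unitv j) - pd i f y.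
  rewrite /g deriveB; [by rewrite (dT y).2|exact: (dT y).1|exact: rsmooth_derivable].
have [c2 c2h E2] := @MVT_line (pd i f) (x + c1 *: unitv i) (unitv j) h h0
   (rsmooth_derivable (rsmooth_pd i sf) j).
exists c1, c2; split => //.
rewrite (_ : f (x + h *: unitv i + h *: unitv j) - _ - _ = g (x + h *: unitv i) - g x); last first.
  by rewrite /g; ring.
rewrite E1 Dg E2 /pd; ring.
Qed.

Lemma norm_coord_le x i : `|x 0 i| <= `|x|.
Proof.
rewrite [leRHS]/Num.Def.normr /= mx_normrE.
by apply/bigmax_geP; right => /=; exists (ord0, i).
Qed.

Lemma norm_le_coord x (r : R) : 0 <= r -> (forall i, `|x 0 i| <= r) -> `|x| <= r.
Proof.
move=> r0 H; rewrite [leLHS]/Num.Def.normr /= mx_normrE.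
apply/bigmax_leP => /=; split => // -[i j] _ /=; rewrite (ord1 i); exact: H.
Qed.

Lemma norm_unitv_le i : `|unitv i| <= 1.
Proof.
apply: norm_le_coord => // j; rewrite /unitv mxE eqxx /=.
by case: eqP => _ /=; rewrite ?normr1 ?normr0.
Qed.

Lemma eq_of_near_values (F G : E -> R) x i j :
  continuous F -> continuous G ->
  (forall h, 0 < h -> exists a b c e, [/\ 0 < a < h, 0 < b < h, 0 < c < h,
     0 < e < h & F (x + a *: unitv i + b *: unitv j) =
                 G (x + c *: unitv j + e *: unitv i)]) ->
  F x = G x.
Proof.
move=> cF cG FG; apply/eqP; rewrite -subr_eq0 -normr_le0.
apply/ler_addgt0Pl => e e0; rewrite addr0.
have near_cont (g : E -> R) : continuous g -> exists2 r : R, 0 < r &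
    forall y, `|y - x| < r -> `|g x - g y| < e / 2.
  move=> cg; have e20 : 0 < e / 2 by rewrite divr_gt0.
  have /cvgrPdist_lt/(_ _ e20)/nbhs_ballP[r /= r0 Hr] := cg x.
  exists r => // y yr; apply: Hr; rewrite -ball_normE /= distrC//.
have [r1 r10 H1] := near_cont _ cF.
have [r2 r20 H2] := near_cont _ cG.
have m0 : 0 < Num.min r1 r2 by rewrite lt_min r10 r20.
have h0 : 0 < Num.min r1 r2 / 2 by rewrite divr_gt0.
have [a [b [c [q [ha hb hc hq EQ]]]]] := FG _ h0.
have H a' b' (k l : 'I_d) : 0 < a' < Num.min r1 r2 / 2 ->
    0 < b' < Num.min r1 r2 / 2 ->
    `|x + a' *: unitv k + b' *: unitv l - x| < Num.min r1 r2.
  move=> /andP[a0 ah] /andP[b0 bh].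
  rewrite -(addrA x) [x + (_ + _)]addrC addrK (le_lt_trans (ler_normD _ _))//.
  rewrite [X in _ < X](splitr (Num.min r1 r2)) ltrD// normrZ gtr0_norm//.
    by rewrite (le_lt_trans _ ah)// ler_piMr ?norm_unitv_le// ltW.
  by rewrite (le_lt_trans _ bh)// ler_piMr ?norm_unitv_le// ltW.
have comb (A B P Q : R) : P = Q -> A - B = (A - P) - (B - Q) by move=> ->; ring.
rewrite (comb _ _ _ _ EQ) (le_trans (ler_normB _ _))// [leRHS](splitr e) lerD// ltW//.
  by apply: H1; have := H _ _ i j ha hb; rewrite lt_min => /andP[].
by apply: H2; have := H _ _ j i hc hq; rewrite lt_min => /andP[].
Qed.

(** Schwarz's theorem. *)
Lemma pdC f i j : rsmooth f -> pd i (pd j f) = pd j (pd i f).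
Proof.
move=> sf; apply/funext => x; apply: (@eq_of_near_values _ _ x j i).
- exact/rsmooth_cont/rsmooth_pd/rsmooth_pd.
- exact/rsmooth_cont/rsmooth_pd/rsmooth_pd.
move=> h h0.
have [c1 [c2 [c1h c2h E1]]] := second_difference i j x h0 sf.
have [b1 [b2 [b1h b2h E2]]] := second_difference j i x h0 sf.
exists b1, b2, c1, c2.
split; [exact: b1h|exact: b2h|exact: c1h|exact: c2h|].
have h2 : h ^+ 2 != 0 by rewrite expf_neq0// gt_eqF.
have comb (A B C D : R) : A - B - (C - D) = A - C - (B - D) by ring.
rewrite (addrAC x (h *: unitv j)) comb in E2.
exact: (mulfI h2 (etrans (esym E2) E1)).
Qed.

Lemma pds_cat s t f : pds (s ++ t) f = pds s (pds t f).
Proof. by rewrite /pds foldr_cat. Qed.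

Lemma pds_pd s i f : rsmooth f -> pds s (pd i f) = pd i (pds s f).
Proof.
move=> sf; elim: s => //= j s ->.
by rewrite pdC//; exact: rsmooth_pds.
Qed.

Lemma perm_pds s t f : rsmooth f -> perm_eq s t -> pds s f = pds t f.
Proof.
move=> sf; elim: s t => [|i s IHs] t st.
  by have /perm_nilP -> : perm_eq t [::] by rewrite perm_sym.
have it : i \in t by rewrite -(perm_mem st) mem_head.
case/splitPr: it st => t1 t2 st.
have st' : perm_eq s (t1 ++ t2).
  rewrite -(perm_cons i) (perm_trans st)//.
  by rewrite -cat1s perm_catCA.
rewrite /= (IHs _ st') !pds_cat /= pds_pd//.
exact: rsmooth_pds.
Qed.

Lemma is_derive_reflect f c i x : derivable f (c - x) (unitv i) ->
  is_derive x (unitv i) (fun y => f (c - y)) (- pd i f (c - x)).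
Proof.
move=> df; apply: derive_line.
have H : is_derive (- (0 : R)) 1 (fun t => f (c - x + t *: unitv i)) (pd i f (c - x)).
  have := @is_derive_line f (c - x) (unitv i) 0.
  rewrite scale0r addr0 oppr0; exact.
have Hn : is_derive (0 : R) 1 (-%R) (-1 : R) by exact: is_deriveN.
have := is_derive1_comp H Hn.
rewrite mulrN1 (_ : _ \o _ = (fun t => f (c - (x + t *: unitv i))))//.
by apply/funext => t /=; rewrite scaleNr opprD addrA.
Qed.

Lemma pd_reflect f c i : rsmooth f ->
  pd i (fun y => f (c - y)) = (fun y => - pd i f (c - y)).
Proof.
move=> sf; apply/funext => x; rewrite /pd.
have H := is_derive_reflect (rsmooth_derivable sf i (c - x)).
by rewrite derive_val.
Qed.

Lemma Ck_reflect n f c : rsmooth f -> Ck n (fun y => f (c - y)).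
Proof.
elim: n f => [|n IHn] f sf.
  split=> // x; apply: (@continuous_comp _ _ _ (fun y : E => (c : E) - y : E) f x).
    by apply: continuousB; [exact: cst_continuous|exact: cvg_id].
  exact: rsmooth_cont.
split; first by have := IHn _ sf; case: (n) => [|m] [].
split => [i x|i].
  have H := is_derive_reflect (rsmooth_derivable sf i (c - x)).
  exact: ex_derive.
rewrite pd_reflect//; apply: CkN; apply: IHn; exact: rsmooth_pd.
Qed.

Lemma rsmooth_reflect f c : rsmooth f -> rsmooth (fun y => f (c - y)).
Proof. by move=> sf n; exact: Ck_reflect. Qed.

Definition bsupp (T : zmodType) (f : E -> T) :=
  exists r : R, forall x, r < `|x| -> f x = 0.

Lemma pd_bsupp f i : bsupp f -> bsupp (pd i f).
Proof.
move=> [r Hr]; exists r => x rx; rewrite /pd.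
rewrite (@near_eq_derive _ _ _ f (cst 0)); first by rewrite derive_cst.
have H : (fun x : E => `|x|) @ x --> `|x| by exact: norm_continuous.
have K : \forall t \near nbhs x, r < `|t| by exact: (cvgr_gt _ H).
by near=> y; apply: Hr; near: y.
Unshelve. all: by end_near. Qed.

Lemma bsupp_reflect (T : zmodType) (f : E -> T) c :
  bsupp f -> bsupp (fun y => f (c - y)).
Proof.
move=> [r Hr]; exists (r + `|c|) => x rx; apply: Hr.
rewrite -(ltrD2r `|c|) (lt_le_trans rx)//.
rewrite -[in X in X <= _](subrK c x) (le_trans (ler_normD _ _))//.
by rewrite distrC.
Qed.

Lemma bsuppMl (f g : E -> R) : bsupp g -> bsupp (f \* g).
Proof. by move=> [r Hr]; exists r => x rx; rewrite /= Hr// mulr0. Qed.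

Lemma bsuppD (T : zmodType) (f g : E -> T) : bsupp f -> bsupp g -> bsupp (f \+ g).
Proof.
move=> [r Hr] [q Hq]; exists (Num.max r q) => x; rewrite gt_max => /andP[rx qx].
by rewrite /= Hr// Hq// addr0.
Qed.

Lemma bsuppN (T : zmodType) (f : E -> T) : bsupp f -> bsupp (\- f).
Proof. by move=> [r Hr]; exists r => x rx; rewrite /= Hr// oppr0. Qed.

Lemma bsuppP (T : zmodType) (f : E -> T) :
  compact (closure [set x | f x != 0]) <-> bsupp f.
Proof.
split=> [cf|[r Hr]].
  have [r [_ Hr]] := compact_bounded cf.
  exists (r + 1) => x rx; apply/eqP; apply: contraPT rx => fx.
  apply/negP; rewrite -leNgt.
  have /Hr/(_ x) H : r < r + 1 by rewrite ltrDl.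
  by apply: H; exact: subset_closure.
apply: bounded_closed_compact; last exact: closed_closure.
have clB : closed [set x : E | `|x| <= r].
  apply: (@closed_comp _ _ (fun x : E => `|x|) [set t | t <= r]).
    by move=> x _; exact: norm_continuous.
  exact: closed_le.
have sub : closure [set x | f x != 0] `<=` [set x : E | `|x| <= r].
  rewrite closureE; apply: smallest_sub => // x /= fx.
  by rewrite leNgt; apply: contra_neqN fx => /Hr.
exists r; split; first exact: num_real.
by move=> M rM x /sub /= xr; rewrite (le_trans xr)// ltW.
Qed.

Lemma mpow_nseq (X : Type) (D : 'I_d -> X -> X) (a : 'I_d -> nat) (x : X) :
  mpow D a x = foldr D x (flatten [seq nseq (a i) i | i <- enum 'I_d]).
Proof.
rewrite /mpow; elim: (enum 'I_d) => //= i s ->.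
by rewrite foldr_cat; elim: (a i) => //= n ->.
Qed.

Definition mseq (a : 'I_d -> nat) : seq 'I_d :=
  flatten [seq nseq (a i) i | i <- enum 'I_d].

Lemma size_mseq a : size (mseq a) = mlen a.
Proof.
rewrite /mseq /mlen size_flatten /shape -map_comp sumnE big_map.
rewrite big_enum /=; apply: eq_bigr => i _; by rewrite size_nseq.
Qed.

Lemma perm_mseq (s : seq 'I_d) : perm_eq s (mseq (fun i => count_mem i s)).
Proof.
apply/allP => i _ /=; apply/eqP.
rewrite /mseq count_flatten -map_comp sumnE big_map big_enum /=.
rewrite (bigD1 i)//= big1 ?addn0; last first.
  by move=> j ji; rewrite count_nseq /= (negbTE ji).
by rewrite count_nseq /= eqxx mul1n.
Qed.

End real_calculus.

Arguments rsmooth_derivable {R d} [f] _ _ _.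

(** * Smooth complex functions and test functions *)

Section complex_calculus.
Context {R : realType} {d : nat}.
Local Notation E := 'rV[R]_d.
Local Notation Re := (@complex.Re R).
Local Notation Im := (@complex.Im R).
Implicit Types (f g phi : E -> R[i]) (x v : E) (k : E -> R).

Lemma cReD (z w : R[i]) : Re (z + w) = Re z + Re w. Proof. by case: z; case: w. Qed.
Lemma cImD (z w : R[i]) : Im (z + w) = Im z + Im w. Proof. by case: z; case: w. Qed.
Lemma cReN (z : R[i]) : Re (- z) = - Re z. Proof. by case: z. Qed.
Lemma cImN (z : R[i]) : Im (- z) = - Im z. Proof. by case: z. Qed.
Lemma cReM (z w : R[i]) : Re (z * w) = Re z * Re w - Im z * Im w.
Proof. by case: z; case: w. Qed.
Lemma cImM (z w : R[i]) : Im (z * w) = Re z * Im w + Im z * Re w.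
Proof. by case: z; case: w. Qed.
Lemma complexP (z w : R[i]) : Re z = Re w -> Im z = Im w -> z = w.
Proof. by case: z; case: w => /= ? ? ? ? -> ->. Qed.

Lemma CpartialsE s f x :
  Cpartials s f x = Complex (pds s (Re \o f) x) (pds s (Im \o f) x).
Proof.
elim: s x => [|i s IHs] x /=; first by case: (f x).
rewrite /Cpartial; congr Complex; rewrite /pd.
  by congr ('D_ _ _ _); apply/funext => y; rewrite IHs.
by congr ('D_ _ _ _); apply/funext => y; rewrite IHs.
Qed.

Lemma smoothP f : smooth f <-> rsmooth (Re \o f) /\ rsmooth (Im \o f).
Proof.
have EE s : (fun x => Re (Cpartials s f x)) = pds s (Re \o f).
  by apply/funext => x; rewrite CpartialsE.
have EI s : (fun x => Im (Cpartials s f x)) = pds s (Im \o f).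
  by apply/funext => x; rewrite CpartialsE.
split=> [sf|[s1 s2] s]; last first.
  rewrite EE EI; split.
  - exact/rsmooth_cont/rsmooth_pds.
  - exact/rsmooth_cont/rsmooth_pds.
  - by move=> i x; exact/rsmooth_derivable/rsmooth_pds.
  - by move=> i x; exact/rsmooth_derivable/rsmooth_pds.
split.
  apply: (@rsmooth_class _ _ [set g | exists s, g = pds s (Re \o f)]); last first.
    by exists [::].
  move=> g [s ->]; have [c1 _ d1 _] := sf s.
  by split; [rewrite -EE|rewrite -EE|move=> i; exists (i :: s)].
apply: (@rsmooth_class _ _ [set g | exists s, g = pds s (Im \o f)]); last first.
  by exists [::].
move=> g [s ->]; have [_ c1 _ d1] := sf s.
by split; [rewrite -EI|rewrite -EI|move=> i; exists (i :: s)].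
Qed.

Lemma smooth_Cpartial i f : smooth f -> smooth (Cpartial i f).
Proof.
by move=> /smoothP[s1 s2]; apply/smoothP; split; [exact: (rsmooth_pd i s1)|exact: (rsmooth_pd i s2)].
Qed.

Lemma smooth_Cpartials s f : smooth f -> smooth (Cpartials s f).
Proof. by move=> sf; elim: s => [//|i s IHs]; exact: (smooth_Cpartial i IHs). Qed.

Lemma smoothD f g : smooth f -> smooth g -> smooth (f \+ g).
Proof.
move=> /smoothP[f1 f2] /smoothP[g1 g2]; apply/smoothP; split.
  rewrite (_ : _ \o _ = (Re \o f) \+ (Re \o g)); first exact: rsmoothD.
  by apply/funext => x /=; rewrite cReD.
rewrite (_ : _ \o _ = (Im \o f) \+ (Im \o g)); first exact: rsmoothD.
by apply/funext => x /=; rewrite cImD.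
Qed.

Lemma smoothN f : smooth f -> smooth (\- f).
Proof.
move=> /smoothP[f1 f2]; apply/smoothP; split.
  rewrite (_ : _ \o _ = \- (Re \o f)); first exact: rsmoothN.
  by apply/funext => x /=; rewrite cReN.
rewrite (_ : _ \o _ = \- (Im \o f)); first exact: rsmoothN.
by apply/funext => x /=; rewrite cImN.
Qed.

Lemma smoothM f g : smooth f -> smooth g -> smooth (f \* g).
Proof.
move=> /smoothP[f1 f2] /smoothP[g1 g2]; apply/smoothP; split.
  rewrite (_ : _ \o _ = ((Re \o f) \* (Re \o g)) \- ((Im \o f) \* (Im \o g))).
    by apply: rsmoothB; exact: rsmoothM.
  by apply/funext => x /=; rewrite cReM.
rewrite (_ : _ \o _ = ((Re \o f) \* (Im \o g)) \+ ((Im \o f) \* (Re \o g))).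
  by apply: rsmoothD; exact: rsmoothM.
by apply/funext => x /=; rewrite cImM.
Qed.

Lemma CpartialD i f g : smooth f -> smooth g ->
  Cpartial i (f \+ g) = Cpartial i f \+ Cpartial i g.
Proof.
move=> /smoothP[f1 f2] /smoothP[g1 g2]; apply/funext => x.
apply: complexP; rewrite /= ?cReD ?cImD /=.
  rewrite (_ : (fun y => _) = (Re \o f) \+ (Re \o g)); last first.
    by apply/funext => y /=; rewrite cReD.
  rewrite -[LHS]/(pd i _ x) pdD; last 2 first.
  - exact: (rsmooth_derivable f1 i).
  - exact: (rsmooth_derivable g1 i).
  by [].
rewrite (_ : (fun y => _) = (Im \o f) \+ (Im \o g)); last first.
  by apply/funext => y /=; rewrite cImD.
rewrite -[LHS]/(pd i _ x) pdD; last 2 first.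
- exact: (rsmooth_derivable f2 i).
- exact: (rsmooth_derivable g2 i).
by [].
Qed.

Lemma CpartialN i f : smooth f -> Cpartial i (\- f) = \- Cpartial i f.
Proof.
move=> /smoothP[f1 f2]; apply/funext => x.
apply: complexP; rewrite /= ?cReN ?cImN /=.
  rewrite (_ : (fun y => _) = \- (Re \o f)); last first.
    by apply/funext => y /=; rewrite cReN.
  by rewrite -[LHS]/(pd i _ x) pdN//; exact: (rsmooth_derivable f1 i).
rewrite (_ : (fun y => _) = \- (Im \o f)); last first.
  by apply/funext => y /=; rewrite cImN.
by rewrite -[LHS]/(pd i _ x) pdN//; exact: (rsmooth_derivable f2 i).
Qed.

Lemma CpartialM i f g : smooth f -> smooth g ->
  Cpartial i (f \* g) = (Cpartial i f \* g) \+ (f \* Cpartial i g).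
Proof.
move=> /smoothP[f1 f2] /smoothP[g1 g2]; apply/funext => x.
have D1 := rsmooth_derivable f1 i; have D2 := rsmooth_derivable f2 i.
have D3 := rsmooth_derivable g1 i; have D4 := rsmooth_derivable g2 i.
have comb1 (a b c e a' b' c' e' : R) :
  (a' * b + a * b') - (c' * e + c * e') = a' * b - c' * e + (a * b' - c * e').
  by ring.
have comb2 (a b c e a' b' c' e' : R) :
  (a' * e + a * e') + (c' * b + c * b') = a' * e + c' * b + (a * e' + c * b').
  by ring.
apply: complexP => /=; rewrite ?cReD ?cImD ?cReM ?cImM/=.
  rewrite (_ : (fun y => _) = ((Re \o f) \* (Re \o g)) \- ((Im \o f) \* (Im \o g))); last first.
    by apply/funext => y /=; rewrite cReM.
  rewrite -[LHS]/(pd i _ x) pdB; last 2 first.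
  - by move=> y; apply: derivableM; [exact: D1|exact: D3].
  - by move=> y; apply: derivableM; [exact: D2|exact: D4].
  rewrite !pdM//; exact: comb1.
rewrite (_ : (fun y => _) = ((Re \o f) \* (Im \o g)) \+ ((Im \o f) \* (Re \o g))); last first.
  by apply/funext => y /=; rewrite cImM.
rewrite -[LHS]/(pd i _ x) pdD; last 2 first.
- by move=> y; apply: derivableM; [exact: D1|exact: D4].
- by move=> y; apply: derivableM; [exact: D2|exact: D3].
rewrite !pdM//; exact: comb2.
Qed.

Lemma perm_Cpartials s t f : smooth f -> perm_eq s t ->
  Cpartials s f = Cpartials t f.
Proof.
move=> /smoothP[f1 f2] st; apply/funext => x.
by rewrite !CpartialsE (perm_pds f1 st) (perm_pds f2 st).
Qed.

Lemma CpartialC i j f : smooth f ->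
  Cpartial i (Cpartial j f) = Cpartial j (Cpartial i f).
Proof.
move=> sf; rewrite -[LHS]/(Cpartials [:: i; j] f).
by rewrite (@perm_Cpartials _ [:: j; i])// -cat1s perm_catC.
Qed.

Lemma Cpartials_mpow s f : smooth f ->
  Cpartials s f = mpow Cpartial (fun i => count_mem i s) f.
Proof. by move=> sf; rewrite mpow_nseq; exact/perm_Cpartials/perm_mseq. Qed.

Lemma mlen_count (s : seq 'I_d) : mlen (fun i => count_mem i s) = size s.
Proof. by rewrite -size_mseq -(perm_size (perm_mseq s)). Qed.

Lemma Cpartial_bsupp i f : bsupp f -> bsupp (Cpartial i f).
Proof.
move=> [r Hr].
have [|r1 H1] := @pd_bsupp _ _ (Re \o f) i.
  by exists r => x /Hr; rewrite /= => ->.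
have [|r2 H2] := @pd_bsupp _ _ (Im \o f) i.
  by exists r => x /Hr; rewrite /= => ->.
exists (Num.max r1 r2) => x; rewrite gt_max => /andP[/H1 + /H2].
by rewrite /Cpartial /pd => -> ->.
Qed.

Lemma test_functionP phi : test_function phi <-> smooth phi /\ bsupp phi.
Proof. by split=> -[s1 s2]; split => //; apply/bsuppP. Qed.

Lemma test_Cpartial i phi : test_function phi -> test_function (Cpartial i phi).
Proof.
move=> /test_functionP[s b]; apply/test_functionP.
by split; [exact: smooth_Cpartial|exact: Cpartial_bsupp].
Qed.

Lemma test_mul f phi : smooth f -> test_function phi -> test_function (f \* phi).
Proof.
move=> sf /test_functionP[s [r Hr]]; apply/test_functionP.
by split; [exact: smoothM|exists r => x /Hr /= ->; rewrite mulr0].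
Qed.

Lemma test_add f g : test_function f -> test_function g -> test_function (f \+ g).
Proof.
move=> /test_functionP[s b] /test_functionP[s' b']; apply/test_functionP.
by split; [exact: smoothD|exact: bsuppD].
Qed.

Lemma test_opp f : test_function f -> test_function (\- f).
Proof.
move=> /test_functionP[s b]; apply/test_functionP.
by split; [exact: smoothN|exact: bsuppN].
Qed.

Lemma smooth_real k : rsmooth k -> smooth (fun x => (k x)%:C%C).
Proof.
by move=> sk; apply/smoothP; split => //; exact: (@rsmooth_cst _ _ 0).
Qed.

Definition rtest k := rsmooth k /\ bsupp k.

(** Evaluating a distribution T at [at_ k x] gives the value at x of its
    convolution with k. *)
Definition at_ k x : E -> R[i] := fun y => (k (x - y))%:C%C.

Lemma test_at k x : rtest k -> test_function (at_ k x).
Proof.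
move=> [sk bk]; apply/test_functionP; split.
  exact/smooth_real/rsmooth_reflect.
have [r Hr] := bsupp_reflect x bk; exists r => y /Hr.
by rewrite /at_ => ->.
Qed.

Lemma rtest_pd i k : rtest k -> rtest (pd i k).
Proof. by move=> [sk bk]; split; [exact: rsmooth_pd|exact: pd_bsupp]. Qed.

(** The sign is that of the reflection y |-> x - y; it cancels the one in the
    definition of the distributional derivative. *)
Lemma Cpartial_at i k x : rtest k -> Cpartial i (at_ k x) = \- at_ (pd i k) x.
Proof.
move=> [sk _]; apply/funext => y; apply: complexP => /=.
  have := congr1 (fun h => h y) (pd_reflect x i sk); exact.
by rewrite derive_cst oppr0.
Qed.

End complex_calculus.

(** * Lebesgue measure: measurability of continuous functions, invariance *)

Section measure_rV.
Context {R : realType} {d : nat}.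
Local Notation E := 'rV[R]_d.
Local Notation mu := (@lebesgue_rV R d).
Implicit Types (f g k : E -> R) (x y c v : E).

Definition dyadic (k : nat) x : E :=
  \row_i ((Num.floor (x 0 i * 2 ^+ k))%:~R / 2 ^+ k).

Lemma dyadic_cvg x : dyadic k x @[k --> \oo] --> x.
Proof.
apply/cvgrPdist_le => e e0.
have : (fun n : nat => (1 / 2) ^+ n : R) @ \oo --> (0 : R).
  by apply: cvg_expr; rewrite ger0_norm; lra.
move=> /cvgrPdist_le/(_ _ e0); apply: filterS => k; rewrite sub0r normrN => Hk.
apply: norm_le_coord; first exact: ltW.
move=> i; rewrite !mxE; apply: le_trans Hk.
have p2 : 0 < 2 ^+ k :> R by rewrite exprn_gt0.
have /andP[f1 f2] := floor_itv (x 0 i * 2 ^+ k).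
rewrite intrD in f2.
rewrite (@ger0_norm _ ((1 / 2) ^+ k)) ?exprn_ge0// div1r exprVn.
rewrite ger0_norm; last by rewrite subr_ge0 ler_pdivrMr.
by rewrite lerBlDr -[X in X + _]mul1r -mulrDl ler_pdivlMr// addrC ltW.
Qed.

(** The sigma-algebra is generated by the coordinates, so a continuous f is
    obtained as the limit of the step functions f (dyadic k x). *)
Lemma measurable_cont f : continuous f -> measurable_fun setT f.
Proof.
move=> cf.
suff H (k : nat) : measurable_fun [set: E] (fun x => f (dyadic k x)).
  refine (@measurable_fun_cvg _ _ R setT (fun (n : nat) x => f (dyadic n x)) f H _).
  by move=> x _; exact: (cvg_comp _ _ (@dyadic_cvg x) (cf x)).
move=> _ B mB; rewrite setTI.
pose G (z : 'rV[int]_d) : set E :=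
  [set x | B (f (\row_i ((z 0 i)%:~R / 2 ^+ k))) /\
    forall i, Num.floor (x 0 i * 2 ^+ k) = z 0 i].
rewrite (_ : _ @^-1` B = \bigcup_z G z); last first.
  apply/seteqP; split=> x /=.
    move=> Bx; exists (\row_i Num.floor (x 0 i * 2 ^+ k)) => //; split.
      rewrite (_ : \row_i _ = dyadic k x)//.
      by apply/rowP => i; rewrite !mxE.
    by move=> i; rewrite mxE.
  move=> [z _ [Bz Hz]]; rewrite (_ : dyadic k x = \row_i ((z 0 i)%:~R / 2 ^+ k))//.
  by apply/rowP => i; rewrite !mxE Hz.
apply: countable_bigcupT_measurable; first exact: countableP.
move=> z; have [Bz|nBz] := pselect (B (f (\row_i ((z 0 i)%:~R / 2 ^+ k)))); last first.
  by rewrite (_ : G z = set0)//; apply/seteqP; split => // x [].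
rewrite (_ : G z = \bigcap_(i : 'I_d)
  ((fun x : E => x 0 i * 2 ^+ k) @^-1` `[(z 0 i)%:~R, (z 0 i + 1)%:~R[%classic)).
  apply: fin_bigcap_measurable => // i _.
  rewrite -[X in measurable X]setTI.
  have mc : measurable_fun setT (fun x : E => x 0 i * 2 ^+ k).
    apply: measurable_funM; first exact: measurable_coord.
    exact: measurable_cst.
  by apply: mc => //; exact: measurable_itv.
apply/seteqP; split=> x /=.
  by move=> [_ Hz] i _; rewrite /= in_itv /= -(Hz i) floor_itv.
by move=> H; split => // i; apply: floor_def; have := H i I; rewrite /= in_itv.
Qed.

End measure_rV.

Section reflection.
Context {R : realType}.

Lemma lebesgue_measure_reflect (c : R) (A : set (measurableTypeR R)) : measurable A ->
  lebesgue_measure ((fun t => c - t) @^-1` A) = lebesgue_measure A.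
Proof.
move=> mA.
have mr : measurable_fun [set: measurableTypeR R] (fun t : measurableTypeR R => c - t : measurableTypeR R).
  by apply: measurable_funB => //; exact: measurable_cst.
have [M ME] : {M : {measure set (measurableTypeR R) -> \bar R} |
    M = pushforward (@lebesgue_measure R) (fun t : measurableTypeR R => c - t : measurableTypeR R)
      :> (set _ -> \bar R)}.
  by unshelve eexists (pushforward (@lebesgue_measure R)
    (fun t : measurableTypeR R => c - t : measurableTypeR R) : {measure set _ -> \bar R}).
suff H : forall X, ocitv X -> lebesgue_measure X = M X.
  by rewrite (lebesgue_measure_unique H mA) ME.
rewrite ME.
move=> X /ocitvP[->|[[a b] /= ab ->]]; rewrite /pushforward.
  by rewrite preimage_set0 !measure0.
rewrite (_ : _ @^-1` _ = `[c - b, c - a[%classic); last first.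
  by apply/seteqP; split=> t /=; rewrite !in_itv /=; lra.
rewrite !lebesgue_measure_itv /= !lte_fin ab.
by rewrite (_ : c - b < c - a = true) ?ltrD2l ?ltrN2// -!EFinB; congr EFin; ring.
Qed.

Lemma measurable_reflect n (c : 'rV[R]_n) :
  measurable_fun setT (fun x : 'rV[R]_n => c - x).
Proof.
apply: measurable_fun_rV => i.
rewrite (_ : (fun t => _) = (fun x : 'rV[R]_n => c 0 i - x 0 i)); last first.
  by apply/funext => x; rewrite !mxE.
apply: measurable_funB; first exact: measurable_cst.
exact: measurable_coord.
Qed.

(** Both sides are measures in A; by uniqueness of the product measure they
    need only be compared on boxes, one coordinate being split off at a time. *)
Lemma lebesgue_rV_reflect n (c : 'rV[R]_n) (A : set 'rV[R]_n) : measurable A ->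
  lebesgue_rV n ((fun x => c - x) @^-1` A) = lebesgue_rV n A.
Proof.
elim: n c A => [|n IHn] c A mA.
  congr (lebesgue_rV 0); apply/seteqP; split => x /=;
  by rewrite (_ : c - x = x)//; apply/rowP => -[].
pose S (p : measurableTypeR R * 'rV[R]_n) : measurableTypeR R * 'rV[R]_n :=
  (c 0 ord0 - p.1, (\row_i c 0 (lift ord0 i)) - p.2).
have mS : measurable_fun setT S.
  apply/measurable_fun_pairP; split.
    rewrite (_ : _ \o _ = fun p : measurableTypeR R * 'rV[R]_n => c 0 ord0 - p.1)//.
    by apply: measurable_funB; [exact: measurable_cst|exact: measurable_fst].
  rewrite (_ : _ \o _ = (fun x => (\row_i c 0 (lift ord0 i)) - x) \o snd)//.
  by apply: measurableT_comp; [exact: measurable_reflect|exact: measurable_snd].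
pose P := product_measure1 (@lebesgue_measure R) (@lebesgue_rV R n).
rewrite -[LHS]/(P _) -[RHS]/(P _).
have [M ME] : {M : {measure set (measurableTypeR R * 'rV[R]_n) -> \bar R} |
    M = pushforward P S :> (set _ -> \bar R)}.
  by unshelve eexists (pushforward P S : {measure set _ -> \bar R}).
have mB : measurable (@rV_cons R n @^-1` A).
  by rewrite -[X in measurable X]setTI; exact: measurable_rV_cons.
have H : forall X : set (measurableTypeR R * 'rV[R]_n), measurable X -> P X = M X.
  apply: product_measure_unique => A1 A2 mA1 mA2.
  rewrite ME /pushforward (_ : S @^-1` (A1 `*` A2) =
    ((fun t => c 0 ord0 - t) @^-1` A1) `*`
    ((fun x => (\row_i c 0 (lift ord0 i)) - x) @^-1` A2))//.
  rewrite /P product_measure1E.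
  - have e1 := lebesgue_measure_reflect (c 0 ord0) mA1.
    have e2 := IHn (\row_i c 0 (lift ord0 i)) _ mA2.
    exact: (congr2 (fun a b : \bar R => (a * b)%E) e1 e2).
  - rewrite -[X in measurable X]setTI.
    have mr : measurable_fun [set: measurableTypeR R]
        (fun t : measurableTypeR R => c 0 ord0 - t : measurableTypeR R).
      by apply: measurable_funB => //; exact: measurable_cst.
    exact: mr.
  - by rewrite -[X in measurable X]setTI; exact: measurable_reflect.
rewrite (H _ mB) ME /pushforward; congr P.
apply/seteqP; split => -[t x] /=; rewrite (_ : rV_cons (S (t, x)) = c - rV_cons (t, x))//;
  apply/rowP => i; rewrite !mxE; case: unliftP => [j ->|->]; rewrite ?mxE//.
Qed.

End reflection.

Section integration_rV.
Context {R : realType} {d : nat}.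
Local Notation E := 'rV[R]_d.
Local Notation mu := (@lebesgue_rV R d).
Implicit Types (f g k : E -> R) (x y c v : E).
Local Open Scope ereal_scope.

Lemma ge0_integral_reflect c (f : E -> \bar R) :
  measurable_fun setT f -> (forall x, 0 <= f x) ->
  \int[mu]_x f (c - x)%R = \int[mu]_x f x.
Proof.
move=> mf f0.
transitivity (\int[pushforward mu (fun x : E => c - x)%R]_x f x).
  by rewrite ge0_integral_pushforward//; exact: measurable_reflect.
apply: eq_measure_integral; first exact: measurable_reflect.
by move=> mr A mA _; exact: lebesgue_rV_reflect.
Qed.

Lemma integral_reflect c (f : E -> \bar R) :
  measurable_fun setT f ->
  \int[mu]_x f (c - x)%R = \int[mu]_x f x.
Proof.
move=> mf; rewrite integralE [RHS]integralE; congr (_ - _).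
  transitivity (\int[mu]_x f^\+ (c - x)%R).
    by apply: eq_integral => x _; rewrite !funeposE.
  exact: (ge0_integral_reflect c (measurable_funepos mf) (funepos_ge0 f)).
transitivity (\int[mu]_x f^\- (c - x)%R).
  by apply: eq_integral => x _; rewrite !funenegE.
exact: (ge0_integral_reflect c (measurable_funeneg mf) (funeneg_ge0 f)).
Qed.

Lemma integral_translate c (f : E -> \bar R) :
  measurable_fun setT f ->
  \int[mu]_x f (x + c)%R = \int[mu]_x f x.
Proof.
move=> mf; rewrite -(integral_reflect c mf).
rewrite -(integral_reflect 0%R (f := fun x => f (c - x)%R)); last first.
  by apply: measurableT_comp => //; exact: measurable_reflect.
by apply: eq_integral => x _; rewrite sub0r opprK addrC.
Qed.

Definition cube (r : R) : set E := [set x | forall i, `[(- r)%R, r]%classic (x 0%R i)].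

Lemma measurable_cube r : measurable (cube r).
Proof.
rewrite (_ : cube r = \bigcap_(i : 'I_d)
  ((fun x : E => x 0%R i) @^-1` `[(- r)%R, r]%classic)).
  apply: fin_bigcap_measurable => // i _.
  by rewrite -[X in measurable X]setTI; apply: measurable_coord.
by apply/seteqP; split => x /= H => [i _|i]; apply: H.
Qed.

Lemma cube_norm r x : (`|x| <= r)%R -> cube r x.
Proof.
move=> xr i /=; rewrite in_itv /= -ler_norml.
exact: (le_trans (norm_coord_le x i)).
Qed.

Lemma lebesgue_cube r : (0 <= r)%R -> mu (cube r) = ((r *+ 2) ^+ d)%:E.
Proof.
move=> r0; rewrite (lebesgue_rV_box (A := fun=> `[(- r)%R, r]%classic))//.
rewrite (eq_bigr (fun=> (r *+ 2)%:E)); last first.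
  move=> i _; rewrite lebesgue_measure_itv /= lte_fin.
  rewrite -EFinB opprK -mulr2n; case: ltP => //.
  rewrite lerNr => h; rewrite (_ : r = 0%R) ?mul0rn//; lra.
by rewrite prodEFin prodr_const card_ord.
Qed.

Lemma lebesgue_cube_fin r : mu (cube r) < +oo.
Proof.
have [r0|r0] := leP 0%R r; first by rewrite lebesgue_cube// ltry.
have le : cube r `<=` cube 0.
  by move=> x H i; have := H i; rewrite /= !in_itv /=; lra.
have E1 : mu (cube 0) < +oo by rewrite lebesgue_cube// ltry.
by apply: le_lt_trans E1; apply: le_measure => //; rewrite inE; exact: measurable_cube.
Qed.

Lemma lebesgue_rV_setT_gt0 : 0 < mu setT.
Proof.
have E1 : 0 < mu (cube 1) by rewrite lebesgue_cube// lte_fin exprn_gt0.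
by apply: (lt_le_trans E1); apply: le_measure; rewrite ?inE//; exact: measurable_cube.
Qed.

Lemma bounded_cont_bsupp f : continuous f -> bsupp f ->
  exists M r : R, [/\ (0 <= M)%R, (0 <= r)%R,
    (forall x, (r < `|x|)%R -> f x = 0%R), (forall x, `|f x| <= M)%R &
    forall x, (`|f x| <= M * \1_(cube r) x)%R].
Proof.
move=> cf [r Hr].
have cB : compact [set x : E | (`|x| <= Num.max r 0)%R].
  apply: bounded_closed_compact.
    exists (Num.max r 0%R); split; first exact: num_real.
    by move=> M rM x /= xr; rewrite (le_trans xr)// ltW.
  apply: (@closed_comp _ _ (fun x : E => `|x|%R) [set t | (t <= Num.max r 0)%R]).
    by move=> x _; exact: norm_continuous.
  exact: closed_le.
have [M0 [_ HM]] := compact_bounded (continuous_compact (continuous_subspaceT cf) cB).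
exists (Num.max (M0 + 1)%R 0%R), (Num.max r 0%R).
have H x : (Num.max r 0 < `|x|)%R -> f x = 0%R.
  by rewrite gt_max => /andP[/Hr].
have Hb x : (`|x| <= Num.max r 0 -> `|f x| <= Num.max (M0 + 1) 0)%R.
  move=> xr; rewrite le_max; apply/orP; left.
  by apply: HM; [rewrite ltrDl|exists x].
have Hb' x : (`|f x| <= Num.max (M0 + 1) 0)%R.
  have [xr|/H ->] := leP `|x|%R (Num.max r 0%R); first exact: Hb.
  by rewrite normr0 le_max lexx orbT.
split => //; [by rewrite le_max lexx orbT|by rewrite le_max lexx orbT|].
move=> x; have [xr|/H ->] := leP `|x|%R (Num.max r 0%R).
  by rewrite indicE mem_set ?mulr1//; exact: cube_norm.
by rewrite normr0 mulr_ge0// le_max lexx orbT.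
Qed.

Lemma integrable_cube (M r : R) :
  mu.-integrable setT (fun x => (M * \1_(cube r) x)%:E).
Proof.
rewrite (_ : (fun x => _) = (fun x => M%:E * (\1_(cube r) x)%:E)) //.
have mi : measurable_fun [set: E] (\1_(cube r) : E -> R).
  by apply: measurable_indic; exact: measurable_cube.
apply: integrableZl => //; apply/integrableP; split; first exact/measurable_EFinP.
rewrite (eq_integral (fun x => (\1_(cube r) x)%:E)); last first.
  by move=> x _; rewrite gee0_abs// lee_fin.
rewrite integral_indic//; last exact: measurable_cube.
by rewrite setIT lebesgue_cube_fin.
Qed.

Lemma integrable_cont_bsupp f : continuous f -> bsupp f ->
  mu.-integrable setT (EFin \o f).
Proof.
move=> cf bf; have [M [r [M0 r0 _ _ H]]] := bounded_cont_bsupp cf bf.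
apply: (le_integrable measurableT _ _ (integrable_cube M r)).
  by apply/measurable_EFinP; exact: measurable_cont.
move=> x _; rewrite lee_fin (le_trans (H x))//.
exact: ler_norm.
Qed.

(** The difference quotients have integral zero by invariance under
    translation, and they are dominated thanks to the mean value theorem. *)
Lemma integral_pd_eq0 (psi : E -> R) j : rtest psi -> (\int[mu]_x pd j psi x = 0)%R.
Proof.
move=> tpsi; have [spsi bpsi] := tpsi.
have [spd bpd] := rtest_pd j tpsi.
have [M [r [M0 r0 H0 _ HM]]] := bounded_cont_bsupp (rsmooth_cont spd) bpd.
have [M' [r' [M'0 r'0 H0' _ HM']]] := bounded_cont_bsupp (rsmooth_cont spsi) bpsi.
have iT := integrable_cont_bsupp (rsmooth_cont spsi) bpsi.
pose h (n : nat) : R := (n.+1%:R^-1)%R.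
have h0 n : (0 < h n)%R by rewrite invr_gt0.
have h1 n : (h n <= 1)%R by rewrite invf_le1// ler1n.
pose D n x : R := ((psi (x + h n *: unitv j) - psi x) / h n)%R.
have mpsi := measurable_cont (rsmooth_cont spsi).
have ctr n : continuous (fun x : E => psi (x + h n *: unitv j))%R.
  move=> x; apply: (@continuous_comp _ _ _ (fun x : E => x + h n *: unitv j)%R psi x).
    by apply: continuousD; [exact: cvg_id|exact: cst_continuous].
  exact: rsmooth_cont.
have btr n : bsupp (fun x : E => psi (x + h n *: unitv j))%R.
  exists (r' + 1)%R => x rx; apply: H0'.
  rewrite -(ltrD2r 1%R) (lt_le_trans rx)//.
  rewrite -[in leLHS](addrK (h n *: unitv j)%R x) (le_trans (ler_normB _ _))// lerD2l.
  by rewrite normrZ gtr0_norm// mulr_ile1// ?norm_unitv_le// ltW.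
have iD n : (\int[mu]_x D n x = 0)%R.
  rewrite (_ : (fun x => D n x) = (fun x => (h n)^-1 * (psi (x + h n *: unitv j) - psi x))%R); last first.
    by apply/funext => x; rewrite /D mulrC.
  have i1 := integrable_cont_bsupp (@ctr n) (btr n).
  rewrite RintegralZl//; last first.
    rewrite (_ : _ \o _ = (EFin \o (fun x => psi (x + h n *: unitv j)%R)) \- (EFin \o psi)).
      exact: integrableB.
    by apply/funext => x.
  rewrite RintegralB// /Rintegral.
  rewrite (integral_translate (h n *: unitv j)%R (f := EFin \o psi)); last exact/measurable_EFinP.
  by rewrite subrr mulr0.
have intD n : mu.-integrable setT (EFin \o D n).
  rewrite (_ : _ \o _ = fun x => ((h n)^-1)%:E *
     ((EFin \o (fun x => psi (x + h n *: unitv j)%R)) \- (EFin \o psi)) x); last first.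
    by apply/funext => x; rewrite /D /= mulrC EFinM EFinB.
  apply: integrableZl => //; apply: integrableB => //.
  exact: integrable_cont_bsupp.
have [|||||_ _] := @dominated_convergence _ E R mu setT measurableT
  (fun n x => (D n x)%:E) (fun x => (pd j psi x)%:E) (fun x => (M * \1_(cube (r + 1)) x)%:E).
- move=> n; apply/measurable_EFinP.
  apply: measurable_funM; last exact: measurable_cst.
  by apply: measurable_funB => //; exact: measurable_cont.
- by apply/measurable_EFinP; exact: (measurable_cont (rsmooth_cont spd)).
- apply: aeW => x _; apply: cvg_EFin; first exact: nearW.
  have := rsmooth_derivable spsi j x.
  rewrite /derivable => /cvg_ex[/= l Hl].
  have El : pd j psi x = l by rewrite /pd /derive; exact/cvg_lim.
  rewrite El.
  have hh : h @ \oo --> 0%R by exact: cvg_harmonic.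
  have [Hd _] := cvgr_dnbhsP (fun t => t^-1 *: (psi (t *: unitv j + x) - psi x))%R 0%R l.
  have {}Hd := Hd Hl h (conj (fun n => lt0r_neq0 (h0 n)) hh).
  apply: cvg_trans Hd.
  apply: near_eq_cvg; apply: nearW => n /=.
  by rewrite /D [RHS]mulrC (addrC x).
- exact: integrable_cube.
- apply: aeW => x n _ /=; rewrite lee_fin.
  have [c /andP[c0 ch] Ec] := MVT_line x (h0 n) (rsmooth_derivable spsi j).
  rewrite /D Ec mulrAC mulfV ?gt_eqF// mul1r (le_trans (HM _))// ler_wpM2l//.
  rewrite !indicE; have [|] := boolP (_ \in cube r); last by rewrite ler0n.
  rewrite inE => Hc; rewrite mem_set// => i.
  have := Hc i; rewrite /= !in_itv /= -!ler_norml => Hi.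
  have : (`|(c *: unitv j : E) ord0 i| <= 1)%R.
    apply: (le_trans (norm_coord_le _ i)).
    by rewrite normrZ gtr0_norm// mulr_ile1// ?norm_unitv_le// ltW// (lt_le_trans ch).
  move: Hi; rewrite [(x + _)%R 0%R i]mxE; move: (x 0%R i) ((c *: unitv j : E) 0%R i) => a b.
  by rewrite !ler_norml; lra.
rewrite (_ : [sequence _]_n = fun=> 0); last first.
  apply/funext => n /=; rewrite -[LHS]fineK; last exact: (integrable_fin_num measurableT (intD n)).
  by have := iD n; rewrite /Rintegral => ->.
by move=> H; rewrite /Rintegral -(cvg_lim _ H)// lim_cst.
Qed.

End integration_rV.

(** * L^p bounds and Young's inequality for real functions *)

Section Lp_real.
Context {R : realType} {d : nat}.
Local Notation E := 'rV[R]_d.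
Local Notation mu := (@lebesgue_rV R d).
Implicit Types (f g k : E -> R) (x y c v : E) (p : \bar R).
Local Open Scope ereal_scope.

(** Norms are used only through their upper bounds by real numbers. *)
Definition nrm p f (B : R) := 'N[mu]_p[EFin \o f] <= B%:E.

Lemma integral_powR_ge0 f r : 0 <= \int[mu]_x (`|f x| `^ r)%:E.
Proof. by apply: integral_ge0 => x _; rewrite lee_fin powR_ge0. Qed.

Lemma nrm_realP f (r B : R) : (1 <= r)%R -> (0 <= B)%R ->
  nrm r%:E f B <-> \int[mu]_x (`|f x| `^ r)%:E <= (B `^ r)%:E.
Proof.
move=> r1 B0; have r0 : (0 < r)%R by rewrite (lt_le_trans ltr01).
have E1 : 'N[mu]_r%:E[EFin \o f] `^ r = \int[mu]_x (`|f x| `^ r)%:E.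
  by rewrite poweR_Lnorm ?gt_eqF.
split=> H.
  rewrite -E1 -poweR_EFin; apply: gt0_ler_poweR => //; first exact: ltW.
  - by rewrite in_itv /= Lnorm_ge0 leey.
  - by rewrite in_itv /= lee_fin B0 leey.
have Er (z : \bar R) : 0 <= z -> (z `^ r) `^ r^-1 = z.
  by move=> z0; rewrite -poweRrM mulfV ?gt_eqF// poweRe1.
rewrite /nrm -[leLHS]Er ?Lnorm_ge0// -[leRHS]Er ?lee_fin//.
apply: gt0_ler_poweR; first by rewrite invr_ge0 ltW.
- by rewrite in_itv /= leey andbT E1 integral_powR_ge0.
- by rewrite in_itv /= leey andbT lee_fin powR_ge0.
by rewrite E1 poweR_EFin.
Qed.

Lemma nrm_inftyP f (B : R) :
  nrm +oo f B <-> {ae mu, forall x, (`|f x| <= B)%R}.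
Proof.
rewrite /nrm unlock /= lebesgue_rV_setT_gt0; split.
  by move=> /ess_supP; apply: filterS => x /=; rewrite lee_fin.
by move=> H; apply/ess_supP; apply: filterS H => x /=; rewrite lee_fin.
Qed.

Lemma p1_case (P : \bar R -> Prop) :
  (forall r, (1 <= r)%R -> P r%:E) -> P +oo -> forall p, 1 <= p -> P p.
Proof. by move=> H1 H2 [r| |//]; rewrite ?lee_fin; [exact: H1|]. Qed.

Lemma nrm_ge0 p f B : nrm p f B -> (0 <= B)%R.
Proof. by rewrite /nrm => H; rewrite -lee_fin (le_trans _ H)// Lnorm_ge0. Qed.

Lemma measurable_normpow f r : measurable_fun setT f ->
  measurable_fun setT (fun x => (`|f x| `^ r)%:E).
Proof.
move=> mf; apply/measurable_EFinP.
apply: (measurableT_comp (measurable_powR r)).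
exact: measurableT_comp.
Qed.

Lemma nrm_le_ae p f g B : 1 <= p -> measurable_fun setT f -> measurable_fun setT g ->
  {ae mu, forall x, (`|f x| <= `|g x|)%R} -> nrm p g B -> nrm p f B.
Proof.
move=> p1 mf mg fg Hg; have B0 := nrm_ge0 Hg.
move: p p1 Hg; apply: p1_case => [r r1 /nrm_realP|/nrm_inftyP] Hg; last first.
  apply/nrm_inftyP; apply: filterS2 fg Hg => x; exact: le_trans.
apply/nrm_realP => //; apply: le_trans (Hg r1 B0).
apply: ae_ge0_le_integral => //.
- exact: measurable_normpow.
- exact: measurable_normpow.
apply: filterS fg => x fg _; rewrite lee_fin ge0_ler_powR ?nnegrE//.
by rewrite (le_trans _ r1).
Qed.

Lemma nrm_le p f g B : 1 <= p -> measurable_fun setT f -> measurable_fun setT g ->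
  (forall x, (`|f x| <= `|g x|)%R) -> nrm p g B -> nrm p f B.
Proof. by move=> p1 mf mg fg; apply: nrm_le_ae => //; exact: aeW. Qed.

Lemma nrmW p f A B : (A <= B)%R -> nrm p f A -> nrm p f B.
Proof. by move=> AB; rewrite /nrm => /le_trans; apply; rewrite lee_fin. Qed.

Lemma nrmD p f g A B : 1 <= p -> measurable_fun setT f -> measurable_fun setT g ->
  nrm p f A -> nrm p g B -> nrm p (f \+ g)%R (A + B).
Proof.
move=> p1 mf mg nf ng; rewrite /nrm.
apply: (le_trans (eminkowski _ mf mg p1)).
by rewrite EFinD leeD.
Qed.

Lemma nrmZ p f (c : R) A : 1 <= p -> (0 <= c)%R -> measurable_fun setT f ->
  nrm p f A -> nrm p (fun x => c * f x)%R (c * A).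
Proof.
move=> p1 c0 mf nf; have A0 := nrm_ge0 nf.
move: p p1 nf; apply: p1_case => [r r1 /nrm_realP|/nrm_inftyP] nf; last first.
  apply/nrm_inftyP; apply: filterS nf => x fx.
  by rewrite normrM (ger0_norm c0) ler_wpM2l.
apply/nrm_realP => //; first exact: mulr_ge0.
rewrite (eq_integral (fun x => (c `^ r)%:E * (`|f x| `^ r)%:E)); last first.
  by move=> x _; rewrite normrM (ger0_norm c0) powRM// EFinM.
rewrite ge0_integralZl//.
- by rewrite powRM// EFinM lee_wpmul2l// ?lee_fin ?powR_ge0//; exact: nf.
- exact: measurable_normpow.
- by rewrite lee_fin powR_ge0.
Qed.

(** For p finite this integrates the pointwise bound t <= B (1 + (t / B)^p),
    a substitute for the inequality of Hoelder that also covers p = 1.  The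
    bound is linear in B, so it can be summed over a series in L^p. *)
Lemma nrm_loc p f B r : 1 <= p -> (0 < B)%R -> measurable_fun setT f -> nrm p f B ->
  \int[mu]_x (`|f x| * \1_(cube r) x)%:E <= (B * (fine (mu (cube r)) + 1))%:E.
Proof.
move=> p1 B0 mf nf; have mc := @measurable_cube R d r.
have mi : measurable_fun [set: E] (\1_(cube r) : E -> R) by exact: measurable_indic.
have ic : \int[mu]_x (B * \1_(cube r) x)%:E = (B * fine (mu (cube r)))%:E.
  under eq_integral do rewrite EFinM.
  rewrite ge0_integralZl//=; last 2 first.
    exact/measurable_EFinP.
    by rewrite lee_fin ltW.
  rewrite integral_indic// setIT EFinM fineK// ge0_fin_numE//.
  exact: lebesgue_cube_fin.
have mfi : measurable_fun setT (fun x => (`|f x| * \1_(cube r) x)%:E).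
  by apply/measurable_EFinP; apply: measurable_funM => //; exact: measurableT_comp.
have mBi : measurable_fun setT (fun x => (B * \1_(cube r) x)%:E).
  by apply/measurable_EFinP; apply: measurable_funM => //; exact: measurable_cst.
move: p p1 nf; apply: p1_case => [q q1 /nrm_realP|/nrm_inftyP] nf; last first.
  apply: (@le_trans _ _ (\int[mu]_x (B * \1_(cube r) x)%:E)); last first.
    by rewrite ic lee_fin ler_wpM2l ?ltW// ltrDl.
  apply: ae_ge0_le_integral => //.
  - by move=> x _; rewrite lee_fin mulr_ge0// ltW.
  by apply: filterS nf => x fx _; rewrite lee_fin ler_wpM2r.
have {}nf := nf q1 (ltW B0).
have q0 : (0 < q)%R by rewrite (lt_le_trans ltr01).
pose G x := (B * \1_(cube r) x)%:E + (B / B `^ q)%:E * (`|f x| `^ q)%:E.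
have BB : (0 <= B / B `^ q)%R by rewrite divr_ge0 ?powR_ge0// ltW.
apply: (@le_trans _ _ (\int[mu]_x G x)).
  apply: ge0_le_integral => //.
  - apply: emeasurable_funD => //; apply: measurable_funeM; exact: measurable_normpow.
  move=> x _; rewrite /G -EFinM -EFinD lee_fin indicE.
  case: (_ \in _) => /=; rewrite ?mulr1 ?mulr0; last first.
    by rewrite add0r mulr_ge0// powR_ge0.
  have [fB|Bf] := leP `|f x|%R B.
    by rewrite (le_trans fB)// lerDl mulr_ge0// powR_ge0.
  apply: ler_wpDl; first exact: ltW.
  have {2}-> : `|f x|%R = (`|f x| / B * B)%R by rewrite mulfVK// gt_eqF.
  rewrite powRM//; last 2 first.
    by rewrite divr_ge0// ltW.
    exact: ltW.
  rewrite (mulrC (_ `^ _)%R) mulrA mulfVK; last by rewrite gt_eqF// powR_gt0.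
  rewrite -{1}[`|f x|%R](@mulfVK _ B) ?gt_eqF// mulrC.
  apply: ler_wpM2l; first exact: ltW.
  by rewrite le1r_powR// ler_pdivlMr// mul1r ltW.
have mpw : measurable_fun setT (fun x => (B / B `^ q)%:E * (`|f x| `^ q)%:E).
  by apply: measurable_funeM; exact: measurable_normpow.
have B1 x : 0 <= (B * \1_(cube r) x)%:E by rewrite lee_fin mulr_ge0// ltW.
have B2 x : 0 <= (B / B `^ q)%:E * (`|f x| `^ q)%:E.
  by rewrite mule_ge0// lee_fin powR_ge0.
rewrite ge0_integralD// ic ge0_integralZl//; last first.
  exact: measurable_normpow.
rewrite mulrDr EFinD leeD2l// mulr1.
apply: (@le_trans _ _ ((B / B `^ q)%:E * (B `^ q)%:E)); first by rewrite lee_wpmul2l// lee_fin.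
by rewrite -EFinM mulfVK// gt_eqF// powR_gt0.
Qed.

Lemma limn_einf_le (u : nat -> \bar R) (c : \bar R) :
  (forall n, u n <= c) -> limn_einf u <= c.
Proof.
move=> uc; rewrite limn_einf_lim; apply: lime_le; first exact: is_cvg_einfs.
apply: nearW => n; apply: le_trans (uc n).
by apply: ereal_inf_lbound; exists n => /=.
Qed.

Lemma cvg_powR_seq (r : R) (u : nat -> R) (a : R) : (1 <= r)%R ->
  (fun n => `|u n|%R) @ \oo --> `|a|%R ->
  (fun n => `|u n| `^ r)%R @ \oo --> (`|a| `^ r)%R.
Proof.
move=> r1 ua; have r0 : (0 < r)%R by rewrite (lt_le_trans ltr01).
have [a0|] := ltP 0%R `|a|%R.
  have ca : {for `|a|%R, continuous (fun t : R => t `^ r)%R}.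
    apply/differentiable_continuous/derivable1_diffP.
    by apply: derivable_powR; rewrite in_itv /= a0.
  exact: (cvg_comp _ _ ua ca).
rewrite normr_le0 => /eqP a0; move: ua; rewrite a0 normr0 powR0 ?gt_eqF// => ua.
apply: (@squeeze_cvgr _ _ _ _ (cst 0%R) (fun n => `|u n|%R)) => //; last first.
  exact: cvg_cst.
have /cvgrPdist_lt/(_ 1%R ltr01) := ua; apply: filterS => n.
rewrite sub0r normrN normr_id => u1; rewrite powR_ge0 /=.
have [->|u0] := eqVneq (u n) 0%R; first by rewrite normr0 powR0// gt_eqF.
by rewrite ge1r_powR// normr_gt0 u0 ltW.
Qed.

(** Fatou's lemma; for p = +oo, the countable intersection of conull sets. *)
Lemma nrm_lim p (f_ : nat -> E -> R) f B : 1 <= p ->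
  (forall n, measurable_fun setT (f_ n)) ->
  (forall x, f_ ^~ x @ \oo --> f x) ->
  (forall n, nrm p (f_ n) B) -> nrm p f B.
Proof.
move=> p1 mf_ cf nf; have B0 := nrm_ge0 (nf 0%N).
move: p p1 nf; apply: p1_case => [r r1|] nf; last first.
  apply/nrm_inftyP.
  have : {ae mu, forall x, forall n, (`|f_ n x| <= B)%R}.
    by apply: ae_foralln => n; exact/nrm_inftyP.
  apply: filterS => x H.
  have cn : (fun n => `|f_ n x|%R) @ \oo --> `|f x|%R by exact: cvg_norm.
  rewrite -(cvg_lim _ cn)//; apply: limr_le; first exact: cvgP cn.
  exact: nearW.
apply/nrm_realP => //.
have r0 : (0 < r)%R by rewrite (lt_le_trans ltr01).
have cp x : (fun n => (`|f_ n x| `^ r)%:E) @ \oo --> (`|f x| `^ r)%:E.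
  apply: cvg_EFin; first exact: nearW.
  have cn : (fun n => `|f_ n x|%R) @ \oo --> `|f x|%R by exact: cvg_norm.
  exact: (cvg_powR_seq r1 cn).
apply: (@le_trans _ _ (\int[mu]_x limn_einf (fun n => (`|f_ n x| `^ r)%:E))).
  rewrite le_eqVlt; apply/orP; left; apply/eqP; apply: eq_integral => x _.
  by rewrite (cvg_limn_einf_sup (cp x)).
apply: (le_trans (fatou _ _ _ _)) => //.
- by move=> n; exact: measurable_normpow.
apply: limn_einf_le => n.
by have /nrm_realP := nf n; exact.
Qed.

(** Jensen's inequality for the measure of density K, from that of Hoelder
    applied to the splitting K = K^(1/r) K^(1-1/r). *)
Lemma jensen_weight (K h : E -> R) (kap r : R) : (1 <= r)%R ->
  measurable_fun setT K -> measurable_fun setT h ->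
  (forall y, (0 <= K y)%R) -> (forall y, (0 <= h y)%R) -> (0 <= kap)%R ->
  \int[mu]_y (K y)%:E = kap%:E ->
  (\int[mu]_y (K y * h y)%:E) `^ r <=
    (kap `^ (r - 1))%:E * \int[mu]_y (K y * h y `^ r)%:E.
Proof.
move=> r1 mK mh K0 h0 kap0 EK.
have [->|rn1] := eqVneq r 1%R.
  rewrite subrr powRr0 mul1e poweRe1; last first.
    by apply: integral_ge0 => y _; rewrite lee_fin mulr_ge0.
  by under [leRHS]eq_integral do rewrite powRr1//.
have {r1} r1 : (1 < r)%R by rewrite lt_neqAle eq_sym rn1.
have r0 : (0 < r)%R by rewrite (lt_trans ltr01).
have rm0 : (0 < r - 1)%R by rewrite subr_gt0.
pose q := (r / (r - 1))%R.
have q0 : (0 < q)%R by rewrite divr_gt0.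
have rq : (r^-1 + q^-1 = 1)%R.
  rewrite /q invf_div; field; rewrite gt_eqF//=.
have mKp s : measurable_fun setT (fun y => K y `^ s)%R.
  exact: (measurableT_comp (measurable_powR s)).
have m1 : measurable_fun setT (fun y => K y `^ r^-1 * h y)%R by exact: measurable_funM.
have := hoelder mu m1 (mKp q^-1%R) r0 q0 rq.
rewrite Lnorm1.
have E1 : \int[mu]_y `|(EFin \o ((fun y => K y `^ r^-1 * h y) \* (fun y => K y `^ q^-1))%R) y|
   = \int[mu]_y (K y * h y)%:E.
  apply: eq_integral => y _ /=.
  rewrite ger0_norm ?mulr_ge0 ?powR_ge0//.
  congr EFin; rewrite mulrAC -powRD; last by rewrite rq oner_eq0.
  by rewrite rq powRr1.
rewrite {}E1 => H.
have I0 : 0 <= \int[mu]_y (K y * h y)%:E.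
  by apply: integral_ge0 => y _; rewrite lee_fin mulr_ge0.
have := gt0_ler_poweR (ltW r0) _ _ H.
rewrite !in_itv /= !leey !andbT I0 mule_ge0 ?Lnorm_ge0// => /(_ isT isT).
move=> /le_trans; apply.
rewrite poweRM ?Lnorm_ge0// poweR_Lnorm ?gt_eqF//.
have -> : 'N[mu]_q%:E[EFin \o (fun y => K y `^ q^-1)%R] = (kap `^ q^-1)%:E.
  rewrite unlock -poweR_EFin; congr (_ `^ _); rewrite -EK.
  apply: eq_integral => y _; rewrite /= ger0_norm ?powR_ge0//.
  by rewrite -powRrM mulVf ?gt_eqF// powRr1.
rewrite poweR_EFin -powRrM muleC (_ : (q^-1 * r = r - 1)%R); last first.
  by rewrite /q invf_div mulfVK// gt_eqF.
rewrite le_eqVlt; apply/orP; left; apply/eqP; congr (_ * _).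
apply: eq_integral => y _ /=; congr EFin.
rewrite ger0_norm ?mulr_ge0 ?powR_ge0// powRM ?powR_ge0//.
by rewrite -powRrM mulVf ?gt_eqF// powRr1.
Qed.

Lemma measurable_conv_kernel k : continuous k ->
  measurable_fun setT (fun z : E * E => k (z.1 - z.2)%R).
Proof.
move=> ck; apply: (measurableT_comp (measurable_cont ck)).
apply: measurable_fun_rV => i.
rewrite (_ : (fun t => _) = (fun z : E * E => z.1 0 i - z.2 0 i)%R); last first.
  by apply/funext => z; rewrite !mxE.
apply: measurable_funB.
  exact: (measurableT_comp (measurable_coord i) measurable_fst).
exact: (measurableT_comp (measurable_coord i) measurable_snd).
Qed.

Lemma measurable_int_param (g : E * E -> R) : measurable_fun setT g ->
  measurable_fun setT (fun x => \int[mu]_y (g (x, y))%:E).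
Proof.
move=> mg; have mG : measurable_fun setT (EFin \o g) by exact/measurable_EFinP.
rewrite (_ : (fun x => _) =
  (fun x => \int[mu]_y ((EFin \o g)^\+ (x, y)) - \int[mu]_y ((EFin \o g)^\- (x, y)))); last first.
  apply/funext => x; rewrite integralE; congr (_ - _).
    by apply: eq_integral => y _; rewrite !funeposE.
  by apply: eq_integral => y _; rewrite !funenegE.
apply: emeasurable_funB.
  exact: (measurable_fun_fubini_tonelli_F _ (measurable_funepos mG) (funepos_ge0 _)).
exact: (measurable_fun_fubini_tonelli_F _ (measurable_funeneg mG) (funeneg_ge0 _)).
Qed.

Definition L1n k : R := fine (\int[mu]_x `|k x|%:E).

Lemma L1nE k : continuous k -> bsupp k -> \int[mu]_x `|k x|%:E = (L1n k)%:E.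
Proof.
move=> ck bk; rewrite /L1n fineK//.
have /integrableP[mk] := integrable_cont_bsupp ck bk.
by rewrite ge0_fin_numE//; apply: integral_ge0 => x _; rewrite lee_fin.
Qed.

Lemma L1n_ge0 k : (0 <= L1n k)%R.
Proof. by apply: fine_ge0; apply: integral_ge0 => x _; rewrite lee_fin. Qed.

Lemma L1n_reflect k x : continuous k -> bsupp k ->
  \int[mu]_y `|k (x - y)%R|%:E = (L1n k)%:E.
Proof.
move=> ck bk; rewrite -L1nE//.
rewrite -(integral_reflect x (f := fun z => `|k z|%:E))//.
by apply/measurable_EFinP; apply: measurableT_comp => //; exact: measurable_cont.
Qed.

Lemma L1n_translate k y : continuous k -> bsupp k ->
  \int[mu]_x `|k (x - y)%R|%:E = (L1n k)%:E.
Proof.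
move=> ck bk; rewrite -L1nE//.
rewrite -(integral_translate (- y)%R (f := fun z => `|k z|%:E))//.
by apply/measurable_EFinP; apply: measurableT_comp => //; exact: measurable_cont.
Qed.

Definition aconv k f x := \int[mu]_y (`|k (x - y)%R| * `|f y|)%:E.

Lemma aconv_ge0 k f x : 0 <= aconv k f x.
Proof. by apply: integral_ge0 => y _; rewrite lee_fin mulr_ge0. Qed.

Lemma nrm_loc_fin p f B r : 1 <= p -> measurable_fun setT f -> nrm p f B ->
  \int[mu]_x (`|f x| * \1_(cube r) x)%:E < +oo.
Proof.
move=> p1 mf nf; have B0 := nrm_ge0 nf.
have nf' : nrm p f (B + 1)%R by apply: nrmW nf; rewrite lerDl.
have B1 : (0 < B + 1)%R by rewrite ltr_wpDl.
by rewrite (le_lt_trans (nrm_loc r p1 B1 mf nf'))// ltry.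
Qed.

Lemma bound_reflect k x : continuous k -> bsupp k ->
  exists M r : R, (0 <= M)%R /\ forall y, (`|k (x - y)%R| <= M * \1_(cube r) y)%R.
Proof.
move=> ck bk.
have ckx : continuous (fun y => k (x - y)%R).
  move=> y; apply: (@continuous_comp _ _ _ (fun y : E => (x : E) - y : E)%R k y).
    by apply: continuousB; [exact: cst_continuous|exact: cvg_id].
  exact: ck.
have [M [r [M0 _ _ _ H]]] := bounded_cont_bsupp ckx (bsupp_reflect x bk).
by exists M, r.
Qed.

Lemma aconv_fin p k f B x : 1 <= p -> continuous k -> bsupp k ->
  measurable_fun setT f -> nrm p f B -> aconv k f x < +oo.
Proof.
move=> p1 ck bk mf nf; have [M [r [M0 H]]] := bound_reflect x ck bk.
have mfi : measurable_fun setT (fun y => `|f y| * \1_(cube r) y)%R.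
  apply: measurable_funM; first exact: measurableT_comp.
  by apply: measurable_indic; exact: measurable_cube.
apply: (@le_lt_trans _ _ (\int[mu]_y (M%:E * (`|f y| * \1_(cube r) y)%:E))).
  apply: ge0_le_integral => //.
  - apply/measurable_EFinP; apply: measurable_funM; last exact: measurableT_comp.
    apply: measurableT_comp => //; apply: (measurableT_comp (measurable_cont ck)).
    exact: measurable_reflect.
  - by apply: measurable_funeM; exact/measurable_EFinP.
  by move=> y _; rewrite -EFinM lee_fin mulrCA mulrC ler_wpM2l.
have mE := (measurable_EFinP _ _).2 mfi.
rewrite ge0_integralZl//.
by rewrite lte_mul_pinfty ?lee_fin//; exact: (nrm_loc_fin _ p1 mf nf).
Qed.

Lemma measurable_aconv k f : continuous k -> measurable_fun setT f ->
  measurable_fun setT (aconv k f).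
Proof.
move=> ck mf.
apply: (measurable_int_param (g := fun z => `|k (z.1 - z.2)| * `|f z.2|)%R).
apply: measurable_funM.
  by apply: measurableT_comp => //; exact: measurable_conv_kernel.
by apply: measurableT_comp => //; apply: measurableT_comp => //; exact: measurable_snd.
Qed.

(** Young's inequality with an L^1 kernel: by jensen_weight, the r-th power of
    the convolution is at most (L1n k)^(r-1) times the convolution of k with
    |f|^r, whose integral is computed by Tonelli's theorem. *)
Lemma nrm_aconv p k f B : 1 <= p -> continuous k -> bsupp k ->
  measurable_fun setT f -> nrm p f B ->
  nrm p (fun x => fine (aconv k f x)) (L1n k * B).
Proof.
move=> p1 ck bk mf nf; have B0 := nrm_ge0 nf.
have L0 := L1n_ge0 k.
have fin x : aconv k f x \is a fin_num.
  by rewrite ge0_fin_numE ?aconv_ge0//; exact: (aconv_fin _ p1 ck bk mf nf).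
have mkx x : measurable_fun setT (fun y => `|k (x - y)|%R).
  apply: measurableT_comp => //; apply: (measurableT_comp (measurable_cont ck)).
  exact: measurable_reflect.
have mka : measurable_fun setT (fun y => `|f y|%R) by exact: measurableT_comp.
move: p p1 nf; apply: p1_case => [r r1 /nrm_realP|/nrm_inftyP] nf; last first.
  apply/nrm_inftyP; apply: aeW => x.
  rewrite ger0_norm ?fine_ge0 ?aconv_ge0// -lee_fin fineK//.
  apply: (@le_trans _ _ (\int[mu]_y (B%:E * `|k (x - y)%R|%:E))).
    apply: ae_ge0_le_integral => //.
    - by apply/measurable_EFinP; exact: measurable_funM.
    - by move=> y _; rewrite mule_ge0.
    - by apply: measurable_funeM; exact/measurable_EFinP.
    apply: filterS nf => y fy _; rewrite -EFinM lee_fin mulrC ler_wpM2r//.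
  rewrite ge0_integralZl//; first by rewrite L1n_reflect// -EFinM mulrC.
  exact/measurable_EFinP.
have {}nf := nf r1 B0.
have r0 : (0 < r)%R by rewrite (lt_le_trans ltr01).
apply/nrm_realP => //; first exact: mulr_ge0.
pose H x := \int[mu]_y (`|k (x - y)%R| * `|f y| `^ r)%:E.
have mg : measurable_fun setT (fun z : E * E => `|k (z.1 - z.2)| * `|f z.2| `^ r)%R.
  apply: measurable_funM.
    by apply: measurableT_comp => //; exact: measurable_conv_kernel.
  apply: (measurableT_comp (measurable_powR r)).
  by apply: measurableT_comp => //; apply: measurableT_comp => //; exact: measurable_snd.
have mH : measurable_fun setT H by exact: (measurable_int_param mg).
have H0 x : 0 <= H x.
  by apply: integral_ge0 => y _; rewrite lee_fin mulr_ge0// powR_ge0.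
apply: (@le_trans _ _ (\int[mu]_x ((L1n k `^ (r - 1))%:E * H x))).
  apply: ge0_le_integral => //.
  - apply: measurable_normpow; apply: measurableT_comp => //; exact: measurable_aconv.
  - exact: measurable_funeM.
  move=> x _; rewrite ger0_norm ?fine_ge0 ?aconv_ge0// -fine_poweR fineK//; last first.
    exact: fin_num_poweR.
  have := @jensen_weight (fun y => `|k (x - y)|%R) (fun y => `|f y|%R) (L1n k) r r1.
  apply => //; exact: L1n_reflect.
rewrite ge0_integralZl//; last by rewrite lee_fin powR_ge0.
rewrite /H (fubini_tonelli (fun z : E * E => (`|k (z.1 - z.2)| * `|f z.2| `^ r)%:E)); last 2 first.
- exact/measurable_EFinP.
- by move=> z; rewrite lee_fin mulr_ge0// powR_ge0.
rewrite (eq_integral (fun y => (L1n k)%:E * (`|f y| `^ r)%:E)); last first.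
  move=> y _ /=; rewrite -(L1n_translate y ck bk) muleC -ge0_integralZl//.
  - by apply: eq_integral => x _; rewrite -EFinM mulrC.
  - apply/measurable_EFinP; apply: measurableT_comp => //.
    apply: measurable_cont => x.
    apply: (@continuous_comp _ _ _ (fun x : E => (x : E) - y : E)%R k x); last exact: ck.
    by apply: continuousB; [exact: cvg_id|exact: cst_continuous].
rewrite ge0_integralZl//; last first.
- exact: measurable_normpow.
apply: (@le_trans _ _ ((L1n k `^ (r - 1))%:E * ((L1n k)%:E * (B `^ r)%:E))).
  by rewrite !lee_wpmul2l// lee_fin powR_ge0.
rewrite muleA -!EFinM lee_fin powRM// ler_wpM2r ?powR_ge0// mulrC mulr_powRB1//.
Qed.

End Lp_real.

(** * L^p bounds and convolution for complex functions *)

Section Lp_complex.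
Context {R : realType} {d : nat}.
Local Notation E := 'rV[R]_d.
Local Notation mu := (@lebesgue_rV R d).
Local Notation Re := (@complex.Re R).
Local Notation Im := (@complex.Im R).
Implicit Types (f g phi : E -> R[i]) (k : E -> R) (x y : E) (p : \bar R).

Lemma normc_ge0 (z : R[i]) : 0 <= normc z.
Proof. by case: z => a b; exact: sqrtr_ge0. Qed.

Lemma Re_le_normc (z : R[i]) : `|Re z| <= normc z.
Proof.
case: z => a b /=; rewrite -sqrtr_sqr ler_wsqrtr// lerDl; exact: sqr_ge0.
Qed.

Lemma Im_le_normc (z : R[i]) : `|Im z| <= normc z.
Proof.
case: z => a b /=; rewrite -sqrtr_sqr ler_wsqrtr// lerDr; exact: sqr_ge0.
Qed.

Lemma normc_le (z : R[i]) : normc z <= `|Re z| + `|Im z|.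
Proof.
case: z => a b /=; rewrite -[leRHS]ger0_norm ?addr_ge0// -sqrtr_sqr ler_wsqrtr//.
have -> : (`|a| + `|b|) ^+ 2 = a ^+ 2 + b ^+ 2 + `|a| * `|b| *+ 2.
  by rewrite sqrrD !real_normK ?num_real// addrAC.
by rewrite lerDl mulrn_wge0// mulr_ge0.
Qed.

Lemma normc_real (a : R) : normc (a%:C%C) = `|a|.
Proof. by rewrite /= expr0n /= addr0 sqrtr_sqr. Qed.

Lemma measurable_normc f : Cmeasurable f -> measurable_fun setT (@normc R \o f).
Proof.
move=> [m1 m2].
rewrite (_ : _ \o _ = Num.sqrt \o (fun x => Re (f x) ^+ 2 + Im (f x) ^+ 2)); last first.
  by apply/funext => x /=; case: (f x).
apply: measurableT_comp; first exact: (continuous_measurable_fun (@sqrt_continuous R)).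
by apply: measurable_funD; exact: measurable_funX.
Qed.

Lemma CmeasurableD f g : Cmeasurable f -> Cmeasurable g -> Cmeasurable (f \+ g).
Proof.
move=> [a b] [a' b']; split.
  rewrite (_ : (fun x => _) = (fun x => Re (f x) + Re (g x))); first exact: measurable_funD.
  by apply/funext => x /=; rewrite cReD.
rewrite (_ : (fun x => _) = (fun x => Im (f x) + Im (g x))); first exact: measurable_funD.
by apply/funext => x /=; rewrite cImD.
Qed.

Lemma CmeasurableN f : Cmeasurable f -> Cmeasurable (\- f).
Proof.
move=> [a b]; split.
  rewrite (_ : (fun x => _) = (fun x => - Re (f x))); first exact: measurableT_comp.
  by apply/funext => x /=; rewrite cReN.
rewrite (_ : (fun x => _) = (fun x => - Im (f x))); first exact: measurableT_comp.
by apply/funext => x /=; rewrite cImN.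
Qed.

Lemma CmeasurableB f g : Cmeasurable f -> Cmeasurable g -> Cmeasurable (f \- g).
Proof. by move=> mf mg; exact/CmeasurableD/CmeasurableN. Qed.

Lemma CmeasurableM f g : Cmeasurable f -> Cmeasurable g -> Cmeasurable (f \* g).
Proof.
move=> [a b] [a' b']; split.
  rewrite (_ : (fun x => _) = (fun x => Re (f x) * Re (g x) - Im (f x) * Im (g x))).
    by apply: measurable_funB; exact: measurable_funM.
  by apply/funext => x /=; rewrite cReM.
rewrite (_ : (fun x => _) = (fun x => Re (f x) * Im (g x) + Im (f x) * Re (g x))).
  by apply: measurable_funD; exact: measurable_funM.
by apply/funext => x /=; rewrite cImM.
Qed.

Lemma Cmeasurable_smooth f : smooth f -> Cmeasurable f.
Proof.
move=> /smoothP[s1 s2].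
by split; [exact: (measurable_cont (rsmooth_cont s1))|
           exact: (measurable_cont (rsmooth_cont s2))].
Qed.

Lemma Cmeasurable0 : Cmeasurable (fun _ : E => 0 : R[i]).
Proof. by split; exact: measurable_cst. Qed.

Definition Cnrm p f B := nrm p (@normc R \o f) B.

Lemma CnrmE p f B : Cnrm p f B = (CLnorm p f <= B%:E)%E.
Proof. by []. Qed.

Lemma Cnrm_le_ae p f g B : (1 <= p)%E -> Cmeasurable f -> Cmeasurable g ->
  {ae mu, forall x, (normc (f x) <= normc (g x))} -> Cnrm p g B -> Cnrm p f B.
Proof.
move=> p1 mf mg H; apply: nrm_le_ae => //; [exact: measurable_normc|exact: measurable_normc|].
by apply: filterS H => x; rewrite /= !ger0_norm ?normc_ge0.
Qed.

Lemma Cnrm_le p f g B : (1 <= p)%E -> Cmeasurable f -> Cmeasurable g ->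
  (forall x, normc (f x) <= normc (g x)) -> Cnrm p g B -> Cnrm p f B.
Proof. by move=> p1 mf mg H; apply: Cnrm_le_ae => //; exact: aeW. Qed.

Lemma CnrmD p f g A B : (1 <= p)%E -> Cmeasurable f -> Cmeasurable g ->
  Cnrm p f A -> Cnrm p g B -> Cnrm p (f \+ g) (A + B).
Proof.
move=> p1 mf mg nf ng.
have m1 := measurable_normc mf; have m2 := measurable_normc mg.
apply: (nrm_le p1 _ _ _ (nrmD p1 m1 m2 nf ng)).
- by apply: measurable_normc; exact: CmeasurableD.
- exact: measurable_funD.
by move=> x; rewrite /= !ger0_norm ?addr_ge0 ?normc_ge0// le_normcD.
Qed.

Lemma CnrmN p f B : (1 <= p)%E -> Cmeasurable f -> Cnrm p f B -> Cnrm p (\- f) B.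
Proof.
move=> p1 mf; apply: Cnrm_le => //; first exact: CmeasurableN.
by move=> x /=; rewrite normcN.
Qed.

Lemma CnrmW p f A B : A <= B -> Cnrm p f A -> Cnrm p f B.
Proof. exact: nrmW. Qed.

Lemma CnrmM p f g (c : R) B : (1 <= p)%E -> Cmeasurable f -> Cmeasurable g -> 0 <= c ->
  (forall x, normc (g x) <= c) -> Cnrm p f B -> Cnrm p (g \* f) (c * B).
Proof.
move=> p1 mf mg c0 gc nf; have mn := measurable_normc mf.
apply: (nrm_le p1 _ _ _ (nrmZ p1 c0 mn nf)).
- by apply: measurable_normc; exact: CmeasurableM.
- by apply: measurable_funM => //; exact: measurable_cst.
move=> x /=; rewrite normcM !ger0_norm ?mulr_ge0 ?normc_ge0//.
by rewrite ler_wpM2r ?normc_ge0.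
Qed.

Lemma Cnrm0 p : (1 <= p)%E -> Cnrm p (fun _ => 0) 0.
Proof.
move=> p1; rewrite CnrmE /CLnorm (_ : _ \o _ = cst 0%E); last first.
  by apply/funext => x /=; congr EFin; exact: (@normc0 R).
by rewrite Lnorm0// gt_eqF// (lt_le_trans _ p1).
Qed.

Definition cbound phi (M r : R) := forall x, normc (phi x) <= M * \1_(cube r) x.

Lemma cube_sub (r s : R) : r <= s -> @cube R d r `<=` cube s.
Proof. by move=> rs x H i; have := H i; rewrite /= !in_itv /=; lra. Qed.

Lemma indic_cube_le (r s : R) x : r <= s -> \1_(cube r) x <= \1_(cube s) x :> R.
Proof.
move=> rs; rewrite !indicE; have [|] := boolP (x \in cube r); last by rewrite ler0n.
by rewrite inE => /(cube_sub rs) xs; rewrite mem_set.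
Qed.

Lemma test_bound phi : test_function phi -> exists M r, 0 <= M /\ cbound phi M r.
Proof.
move=> /test_functionP[/smoothP[s1 s2] [q Hq]].
have [|M1 [r1 [M10 _ _ _ H1]]] := @bounded_cont_bsupp R d _ (rsmooth_cont s1).
  by exists q => x /Hq; rewrite /= => ->.
have [|M2 [r2 [M20 _ _ _ H2]]] := @bounded_cont_bsupp R d _ (rsmooth_cont s2).
  by exists q => x /Hq; rewrite /= => ->.
exists (M1 + M2), (Num.max r1 r2); split; first exact: addr_ge0.
move=> x; rewrite (le_trans (normc_le _))// mulrDl lerD//.
  by rewrite (le_trans (H1 x))// ler_wpM2l// indic_cube_le// le_max lexx.
by rewrite (le_trans (H2 x))// ler_wpM2l// indic_cube_le// le_max lexx orbT.
Qed.

Definition Cintegrable f :=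
  mu.-integrable setT (EFin \o (Re \o f)) /\ mu.-integrable setT (EFin \o (Im \o f)).

Lemma Cintegrable_le f (g : E -> R) : Cmeasurable f ->
  mu.-integrable setT (EFin \o g) -> (forall x, normc (f x) <= g x) -> Cintegrable f.
Proof.
move=> [m1 m2] ig H; split; apply: (le_integrable measurableT _ _ ig).
- exact/measurable_EFinP.
- move=> x _; rewrite lee_fin (le_trans (Re_le_normc _))// (le_trans (H x))//.
  exact: ler_norm.
- exact/measurable_EFinP.
- move=> x _; rewrite lee_fin (le_trans (Im_le_normc _))// (le_trans (H x))//.
  exact: ler_norm.
Qed.

Lemma loc_integrable p f B r : (1 <= p)%E -> Cmeasurable f -> Cnrm p f B ->
  mu.-integrable setT (fun x => (normc (f x) * \1_(cube r) x)%:E).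
Proof.
move=> p1 mf nf; have mn := measurable_normc mf.
apply/integrableP; split.
  apply/measurable_EFinP; apply: measurable_funM => //.
  by apply: measurable_indic; exact: measurable_cube.
apply: le_lt_trans (nrm_loc_fin r p1 mn nf).
rewrite le_eqVlt; apply/orP; left; apply/eqP; apply: eq_integral => x _ /=.
by rewrite !ger0_norm ?mulr_ge0 ?normc_ge0.
Qed.

Lemma Cintegrable_pair p f phi B M r : (1 <= p)%E -> Cmeasurable f ->
  Cnrm p f B -> Cmeasurable phi -> cbound phi M r ->
  Cintegrable (fun x => f x * phi x).
Proof.
move=> p1 mf nf mphi bphi.
apply: (@Cintegrable_le _ (fun x => M * (normc (f x) * \1_(cube r) x))).
- exact: (CmeasurableM mf mphi).
- rewrite (_ : _ \o _ = fun x => M%:E * (normc (f x) * \1_(cube r) x)%:E)%E//.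
  by apply: integrableZl => //; exact: (loc_integrable r p1 mf nf).
by move=> x; rewrite normcM mulrCA ler_wpM2l ?normc_ge0.
Qed.

Lemma Cintegrable_test p f phi B : (1 <= p)%E -> Cmeasurable f ->
  Cnrm p f B -> test_function phi -> Cintegrable (fun x => f x * phi x).
Proof.
move=> p1 mf nf tphi; have [M [r [_ bphi]]] := test_bound tphi.
have [sphi _] := tphi.
exact: (Cintegrable_pair p1 mf nf (Cmeasurable_smooth sphi) bphi).
Qed.

Lemma CintegralD f g : Cintegrable f -> Cintegrable g ->
  Cintegral (f \+ g) = Cintegral f + Cintegral g.
Proof.
move=> [f1 f2] [g1 g2]; apply: complexP => /=.
  rewrite -RintegralD//; apply: eq_Rintegral => x _; exact: cReD.
rewrite -RintegralD//; apply: eq_Rintegral => x _; exact: cImD.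
Qed.

Lemma CintegralN f : Cintegrable f -> Cintegral (\- f) = - Cintegral f.
Proof.
move=> [f1 f2]; apply: complexP => /=.
  rewrite -mulN1r -RintegralZl//; apply: eq_Rintegral => x _; rewrite cReN; lra.
rewrite -mulN1r -RintegralZl//; apply: eq_Rintegral => x _; rewrite cImN; lra.
Qed.

(** The convolution of f with the real kernel k. *)
Definition cv k f : E -> R[i] := fun x => dist_of f (at_ k x).

Lemma cvE k f x : cv k f x =
  Complex (\int[mu]_y (Re (f y) * k (x - y))) (\int[mu]_y (Im (f y) * k (x - y))).
Proof.
rewrite /cv /dist_of /Cintegral; congr Complex; apply: eq_Rintegral => y _.
  by rewrite cReM /= mulr0 subr0.
by rewrite cImM /= mulr0 add0r.
Qed.

Lemma measurable_cv k f : continuous k -> Cmeasurable f -> Cmeasurable (cv k f).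
Proof.
move=> ck [m1 m2].
have H (g : E -> R) : measurable_fun setT g ->
    measurable_fun setT (fun x => \int[mu]_y (g y * k (x - y))).
  move=> mg; rewrite /Rintegral.
  have mm : measurable_fun setT (fun z : E * E => g z.2 * k (z.1 - z.2)).
    apply: measurable_funM; last exact: measurable_conv_kernel.
    by apply: measurableT_comp => //; exact: measurable_snd.
  by apply: measurableT_comp => //; exact: (measurable_int_param mm).
split.
  rewrite (_ : (fun x => _) = (fun x => \int[mu]_y (Re (f y) * k (x - y)))); first exact: H.
  by apply/funext => x; rewrite cvE.
rewrite (_ : (fun x => _) = (fun x => \int[mu]_y (Im (f y) * k (x - y)))); first exact: H.
by apply/funext => x; rewrite cvE.
Qed.

Lemma rtest_cont k : rtest k -> continuous k.
Proof. by move=> [/rsmooth_cont]. Qed.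

Lemma normc_cv p k f B x : (1 <= p)%E -> rtest k -> Cmeasurable f -> Cnrm p f B ->
  normc (cv k f x) <= 2 * fine (aconv k (@normc R \o f) x).
Proof.
move=> p1 tk mf nf; have [sk bk] := tk; have ck := rsmooth_cont sk.
have [i1 i2] := Cintegrable_test p1 mf nf (test_at x tk).
have mn := measurable_normc mf.
have fin := aconv_fin x p1 ck bk mn nf.
have H (g : E -> R) : measurable_fun setT g ->
    (forall y, `|g y| <= normc (f y) * `|k (x - y)|) ->
    `|\int[mu]_y g y| <= fine (aconv k (@normc R \o f) x).
  move=> mg gH.
  have ia : mu.-integrable setT (fun y => (`|k (x - y)| * `|normc (f y)|)%:E).
    apply/integrableP; split.
      apply/measurable_EFinP; apply: measurable_funM; last exact: measurableT_comp.
      apply: measurableT_comp => //; apply: (measurableT_comp (measurable_cont ck)).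
      exact: measurable_reflect.
    apply: le_lt_trans fin; rewrite le_eqVlt; apply/orP; left; apply/eqP.
    by apply: eq_integral => y _; rewrite gee0_abs// lee_fin mulr_ge0.
  have gH' y : `|g y| <= `|k (x - y)| * `|normc (f y)|.
    by rewrite mulrC (ger0_norm (normc_ge0 _)).
  have ig : mu.-integrable setT (EFin \o g).
    apply: (le_integrable measurableT _ _ ia); first exact/measurable_EFinP.
    by move=> y _; rewrite lee_fin (le_trans (gH' y))// ler_norm.
  rewrite (le_trans (le_normr_Rintegral measurableT ig))//.
  apply: le_Rintegral => //.
  by apply: integrable_norm.
rewrite (le_trans (normc_le _))// mulr_natl mulr2n lerD// /cv /dist_of /=.
  apply: H; first by have /integrableP[/measurable_EFinP] := i1.
  by move=> y; rewrite (le_trans (Re_le_normc _))// normcM /at_ normc_real.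
apply: H; first by have /integrableP[/measurable_EFinP] := i2.
by move=> y; rewrite (le_trans (Im_le_normc _))// normcM /at_ normc_real.
Qed.

(** The factor 2 comes from estimating real and imaginary parts separately. *)
Lemma Cnrm_cv p k f B : (1 <= p)%E -> rtest k -> Cmeasurable f -> Cnrm p f B ->
  Cnrm p (cv k f) (2 * L1n k * B).
Proof.
move=> p1 tk mf nf; have [sk bk] := tk; have ck := rsmooth_cont sk.
have mn := measurable_normc mf.
have ma : measurable_fun setT (fun x => fine (aconv k (@normc R \o f) x)).
  by apply: measurableT_comp => //; exact: measurable_aconv.
have n1 := nrm_aconv p1 ck bk mn nf.
rewrite -mulrA; apply: (nrm_le p1 _ _ _ (nrmZ p1 (ler0n R 2) ma n1)).
- by apply: measurable_normc; exact: measurable_cv.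
- by apply: measurable_funM => //; exact: measurable_cst.
move=> x /=; rewrite ger0_norm ?normc_ge0//.
by rewrite (le_trans (normc_cv x p1 tk mf nf))// ler_norm.
Qed.

End Lp_complex.

(** * Convergence of a normally convergent series in L^p *)

Section Lp_limit.
Context {R : realType} {d : nat}.
Local Notation E := 'rV[R]_d.
Local Notation mu := (@lebesgue_rV R d).
Local Notation Re := (@complex.Re R).
Local Notation Im := (@complex.Im R).
Implicit Types (f g phi : E -> R[i]) (x y : E) (p : \bar R).

Lemma dist_of_ae f g phi : Cmeasurable f -> Cmeasurable g -> Cmeasurable phi ->
  {ae mu, forall x, f x = g x} -> dist_of f phi = dist_of g phi.
Proof.
move=> mf mg mphi fg; rewrite /dist_of /Cintegral.
have H (u v : E -> R) : measurable_fun setT u -> measurable_fun setT v ->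
    {ae mu, forall x, u x = v x} -> \int[mu]_x u x = \int[mu]_x v x.
  move=> m1 m2 uv; rewrite /Rintegral; congr fine.
  apply: ae_eq_integral => //; [exact/measurable_EFinP|exact/measurable_EFinP|].
  by apply: filterS uv => x /= -> .
have [a b] := CmeasurableM mf mphi; have [a' b'] := CmeasurableM mg mphi.
by congr Complex; apply: H => //; apply: filterS fg => x /= ->.
Qed.

Section construction.
Variables (p : \bar R) (f_ : nat -> E -> R[i]) (b : nat -> R) (B : R).
Hypotheses (p1 : (1 <= p)%E) (mf_ : forall n, Cmeasurable (f_ n)).
Hypotheses (b0 : forall n, 0 < b n) (bB : forall n, \sum_(k < n) b k <= B).
Hypotheses (nf0 : Cnrm p (f_ 0%N) (b 0%N)).
Hypotheses (nfS : forall n, Cnrm p (f_ n.+1 \- f_ n) (b n.+1)).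

(* the terms of the series whose partial sums are the f_ n *)
Let g_ (n : nat) : E -> R[i] := if n is m.+1 then f_ m.+1 \- f_ m else f_ 0%N.

Let mg n : Cmeasurable (g_ n).
Proof. by case: n => [|n]; [exact: mf_|apply: CmeasurableB; exact: mf_]. Qed.

Let ng n : Cnrm p (g_ n) (b n).
Proof. by case: n. Qed.

Let gn n x : R := normc (g_ n x).

Let mgn n : measurable_fun setT (gn n).
Proof. exact: measurable_normc. Qed.

Let gn0 n x : 0 <= gn n x. Proof. exact: normc_ge0. Qed.

Let f_sum n x : f_ n x = \sum_(k < n.+1) g_ k x.
Proof.
elim: n => [|n IHn]; first by rewrite big_ord_recl big_ord0 addr0.
by rewrite big_ord_recr /= -IHn /= addrCA subrr addr0.
Qed.

Let FF x : \bar R := (\sum_(k <oo) (gn k x)%:E)%E.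

Let FF0 x : (0 <= FF x)%E.
Proof. by apply: nneseries_ge0 => n _ _; rewrite lee_fin. Qed.

Let mFF : measurable_fun setT FF.
Proof.
apply: (@ge0_emeasurable_sum _ E R setT (fun k x => (gn k x)%:E) xpredT).
- by move=> k x _ _; rewrite lee_fin.
- by move=> k _; exact/measurable_EFinP.
Qed.

(* nrm_loc bounds the integral of each term over a cube by a multiple of b k *)
Let FF_loc r : (\int[mu]_x (FF x * (\1_(cube r) x)%:E) < +oo)%E.
Proof.
rewrite (eq_integral (fun x => \sum_(k <oo) (gn k x * \1_(cube r) x)%:E)%E); last first.
  move=> x _; rewrite muleC -nneseriesZl//; last by move=> k _; rewrite lee_fin.
  by apply: eq_eseriesr => k _; rewrite EFinM muleC.
rewrite integral_nneseries//; last first.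
- by move=> n x _; rewrite lee_fin mulr_ge0.
- move=> n; apply/measurable_EFinP; apply: measurable_funM => //.
  by apply: measurable_indic; exact: measurable_cube.
apply: (@le_lt_trans _ _ (B * (fine (mu (cube r)) + 1))%:E); last exact: ltry.
apply: lime_le.
  apply: is_cvg_nneseries => n _ _; apply: integral_ge0 => x _.
  by rewrite lee_fin mulr_ge0.
apply: nearW => n.
apply: (@le_trans _ _ (\sum_(0 <= k < n) (b k * (fine (mu (cube r)) + 1))%:E)%E).
  apply: lee_sum => k _.
  apply: le_trans (nrm_loc r p1 (b0 k) (mgn k) (ng k)).
  rewrite le_eqVlt; apply/orP; left; apply/eqP.
  by apply: eq_integral => x _; rewrite ger0_norm ?normc_ge0.
rewrite sumEFin lee_fin -mulr_suml ler_wpM2r//.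
  by rewrite addr_ge0// fine_ge0.
by rewrite big_mkord.
Qed.

Let A : set E := [set x | (FF x < +oo)%E].

Let mA : measurable A.
Proof.
rewrite -[X in measurable X]setTI.
exact: (emeasurable_fun_infty_o measurableT mFF).
Qed.

Let Aae : {ae mu, forall x, A x}.
Proof.
have H : {ae mu, forall x, forall n : nat, (FF x * (\1_(cube n%:R) x)%:E)%E \is a fin_num}.
  apply: ae_foralln => n.
  have : mu.-integrable setT (fun x => (FF x * (\1_(cube n%:R) x)%:E)%E).
    apply/integrableP; split.
      apply: emeasurable_funM => //; apply/(measurable_EFinP setT (\1_(cube n%:R) : E -> R)).
      by apply: measurable_indic; exact: measurable_cube.
    apply: le_lt_trans (FF_loc n%:R); rewrite le_eqVlt; apply/orP; left; apply/eqP.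
    by apply: eq_integral => x _; rewrite gee0_abs// mule_ge0// lee_fin.
  move=> /(integrable_ae measurableT); apply: filterS => x; exact.
apply: filterS H => x Hx; rewrite /A /=.
pose n := (Num.truncn `|x|).+1.
have xn : cube n%:R x.
  apply: cube_norm; rewrite /n; apply/ltW; exact: truncnS_gt.
by have := Hx n; rewrite indicE mem_set// mule1 ge0_fin_numE.
Qed.

(* f_ n is set to 0 off the conull set A where the series converges absolutely,
   so that convergence and domination hold everywhere *)
Let f' n x : R[i] := ((\1_A x : R)%:C)%C * f_ n x.

Let mf' n : Cmeasurable (f' n).
Proof.
apply: (@CmeasurableM _ _ (fun x => ((\1_A x : R)%:C)%C)) => //.
by split => /=; [exact: (measurable_indic mA)|exact: measurable_cst].
Qed.

Let f'E n x : A x -> f' n x = f_ n x.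
Proof. by move=> Ax; rewrite /f' indicE mem_set// mul1r. Qed.

Let f'N n x : ~ A x -> f' n x = 0.
Proof. by move=> Ax; rewrite /f' indicE memNset// mul0r. Qed.

Let SS x : R := fine (FF x) * \1_A x.

Let sum_le x n : A x -> \sum_(k < n) gn k x <= fine (FF x).
Proof.
move=> Ax; rewrite -lee_fin fineK ?ge0_fin_numE// -sumEFin.
have := @nneseries_lim_ge R (fun k => (gn k x)%:E) xpredT 0%N n.
rewrite big_mkord; apply => k _; by rewrite lee_fin.
Qed.

Let f'_bound n x : normc (f' n x) <= SS x.
Proof.
have [Ax|nAx] := pselect (A x); last first.
  by rewrite f'N// normc0 /SS indicE memNset// mulr0.
rewrite f'E// /SS indicE mem_set// mulr1 f_sum.
apply: le_trans (sum_le n.+1 Ax).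
elim: n.+1 => [|m IHm]; first by rewrite !big_ord0 normc0.
by rewrite !big_ord_recr /= (le_trans (le_normcD _ _))// lerD.
Qed.

Let cvg_series (h : R[i] -> R) : (forall z w, h (z + w) = h z + h w) -> h 0 = 0 ->
  (forall z, `|h z| <= normc z) -> forall x, cvgn (fun n => h (f' n x)).
Proof.
move=> hD h0 hle x.
have [Ax|nAx] := pselect (A x); last first.
  rewrite (_ : (fun n => _) = cst 0); first exact: is_cvg_cst.
  by apply/funext => n; rewrite f'N.
rewrite (_ : (fun n => _) = (fun n => series (fun k => h (g_ k x)) n.+1)); last first.
  apply/funext => n; rewrite f'E// f_sum /series /= big_mkord.
  elim: n.+1 => [|m IHm]; first by rewrite !big_ord0.
  by rewrite !big_ord_recr /= hD IHm.
have c1 : cvgn (series (fun k => gn k x)).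
  apply: nondecreasing_is_cvgn.
    apply/nondecreasing_seqP => n; rewrite /series /= big_nat_recr//= lerDl.
    exact: gn0.
  exists (fine (FF x)) => _ [n _ <-]; rewrite /series /= big_mkord.
  exact: sum_le.
have c2 : cvgn (series (fun k => h (g_ k x))).
  apply: normed_cvg.
  by apply: (series_le_cvg _ _ _ c1) => n; [exact: normr_ge0|exact: gn0|exact: hle].
have [l Hl] := (cvg_ex _).1 c2.
by apply/cvg_ex; exists l; rewrite (cvg_shiftS (series (fun k => h (g_ k x)))).
Qed.

Let v x : R[i] := Complex (limn (fun n => Re (f' n x))) (limn (fun n => Im (f' n x))).

Let cvRe x : (fun n => Re (f' n x)) @ \oo --> Re (v x).
Proof. by apply: (cvg_series (h := Re)) => //; [exact: cReD|exact: Re_le_normc]. Qed.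

Let cvIm x : (fun n => Im (f' n x)) @ \oo --> Im (v x).
Proof. by apply: (cvg_series (h := Im)) => //; [exact: cImD|exact: Im_le_normc]. Qed.

Let mv : Cmeasurable v.
Proof.
split.
  apply: (@measurable_fun_cvg _ _ R setT (fun n x => Re (f' n x))).
    by move=> n; exact: (mf' n).1.
  by move=> x _; exact: cvRe.
apply: (@measurable_fun_cvg _ _ R setT (fun n x => Im (f' n x))).
  by move=> n; exact: (mf' n).2.
by move=> x _; exact: cvIm.
Qed.

Let nf n : Cnrm p (f_ n) (\sum_(k < n.+1) b k).
Proof.
elim: n => [|n IHn]; first by rewrite big_ord_recl big_ord0 addr0.
rewrite big_ord_recr /=.
have -> : f_ n.+1 = f_ n \+ (f_ n.+1 \- f_ n).
  by apply/funext => x /=; rewrite addrCA subrr addr0.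
by apply: CnrmD => //; apply: CmeasurableB.
Qed.

Let nfB m n : Cnrm p (f_ (m + n)%N \- f_ m)
  (\sum_(k < (m + n).+1) b k - \sum_(k < m.+1) b k).
Proof.
elim: n => [|n IHn].
  rewrite addn0 subrr (_ : _ \- _ = fun=> 0); first exact: Cnrm0.
  by apply/funext => x /=; rewrite subrr.
rewrite addnS big_ord_recr /= addrAC.
have -> : f_ (m + n).+1 \- f_ m = (f_ (m + n)%N \- f_ m) \+ (f_ (m + n).+1 \- f_ (m + n)%N).
  by apply/funext => x /=; rewrite [RHS]addrC addrA subrK.
by apply: CnrmD => //; apply: CmeasurableB.
Qed.

Let f'_le n x : normc (f' n x) <= normc (f_ n x).
Proof.
have [Ax|nAx] := pselect (A x); first by rewrite f'E.
by rewrite f'N// normc0 normc_ge0.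
Qed.

Let cvnorm (u : nat -> R[i]) (l : R[i]) : (fun n => Re (u n)) @ \oo --> Re l ->
  (fun n => Im (u n)) @ \oo --> Im l -> (fun n => normc (u n)) @ \oo --> normc l.
Proof.
move=> c1 c2.
have E1 (z : R[i]) : normc z = Num.sqrt (Re z ^+ 2 + Im z ^+ 2) by case: z.
rewrite (_ : (fun n => _) = (fun n => Num.sqrt (Re (u n) ^+ 2 + Im (u n) ^+ 2))); last first.
  by apply/funext => n.
rewrite E1.
have c3 : (fun n => Re (u n) ^+ 2 + Im (u n) ^+ 2) @ \oo --> Re l ^+ 2 + Im l ^+ 2.
  by rewrite !expr2; apply: cvgD; apply: cvgM.
exact: (cvg_comp _ _ c3 (@sqrt_continuous R _)).
Qed.

Let nv : Cnrm p v B.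
Proof.
apply: (nrm_lim (f_ := fun n => @normc R \o f' n)) => //.
- by move=> n; exact: measurable_normc.
- by move=> x; apply: cvnorm; [exact: cvRe|exact: cvIm].
move=> n; apply: CnrmW (bB n.+1) _; exact: (Cnrm_le p1 _ _ _ (nf n)).
Qed.

Let nvB m : Cnrm p (v \- f_ m) (B - \sum_(k < m.+1) b k).
Proof.
have H : Cnrm p (v \- f' m) (B - \sum_(k < m.+1) b k).
  apply: (nrm_lim (f_ := fun n => @normc R \o (f' (m + n)%N \- f' m))) => //.
  - by move=> n; apply: measurable_normc; exact: CmeasurableB.
  - move=> x; apply: cvnorm.
      rewrite /= cReD cReN (_ : (fun n => _) = (fun n => Re (f' (m + n)%N x) - Re (f' m x))).
        apply: cvgB; last exact: cvg_cst.
        have := @cvRe x; rewrite -(cvg_shiftn m).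
        by under eq_fun do rewrite addnC.
      by apply/funext => n; rewrite /= cReD cReN.
    rewrite /= cImD cImN (_ : (fun n => _) = (fun n => Im (f' (m + n)%N x) - Im (f' m x))).
      apply: cvgB; last exact: cvg_cst.
      have := @cvIm x; rewrite -(cvg_shiftn m).
      by under eq_fun do rewrite addnC.
    by apply/funext => n; rewrite /= cImD cImN.
  move=> n; apply: (@CnrmW _ _ _ _ (\sum_(k < (m + n).+1) b k - \sum_(k < m.+1) b k)).
    by rewrite lerD2r.
  apply: (Cnrm_le p1 _ _ _ (nfB m n)); [exact: CmeasurableB|exact: CmeasurableB|].
  move=> x /=; have [Ax|nAx] := pselect (A x); first by rewrite !f'E.
  by rewrite !f'N// subr0 normc0 normc_ge0.
apply: (Cnrm_le_ae p1 _ _ _ H); [exact: CmeasurableB|exact: CmeasurableB|].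
by apply: filterS Aae => x Ax; rewrite /= f'E.
Qed.

Let Rdominated (u_ : nat -> E -> R) (u : E -> R) (g : E -> R) :
  (forall n, measurable_fun setT (u_ n)) -> measurable_fun setT u ->
  (forall x, u_ ^~ x @ \oo --> u x) ->
  mu.-integrable setT (EFin \o g) -> (forall n x, `|u_ n x| <= g x) ->
  (fun n => \int[mu]_x u_ n x) @ \oo --> \int[mu]_x u x.
Proof.
move=> mu_ mu' cu ig H.
have [|||||iu _ c] := @dominated_convergence _ E R mu setT measurableT
  (fun n x => (u_ n x)%:E) (fun x => (u x)%:E) (EFin \o g).
- by move=> n; exact/measurable_EFinP.
- exact/measurable_EFinP.
- by apply: aeW => x _; apply: cvg_EFin; [exact: nearW|exact: cu].
- exact: ig.
- by apply: aeW => x n _; rewrite lee_fin.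
rewrite /Rintegral; apply: fine_cvg; rewrite fineK//.
exact: (integrable_fin_num measurableT iu).
Qed.

Let cvd phi : test_function phi ->
  (fun n => Re (dist_of (f_ n) phi)) @ \oo --> Re (dist_of v phi) /\
  (fun n => Im (dist_of (f_ n) phi)) @ \oo --> Im (dist_of v phi).
Proof.
move=> tphi; have [M [r [M0 bphi]]] := test_bound tphi.
have [sphi _] := tphi; have mphi := Cmeasurable_smooth sphi.
have E1 n : dist_of (f_ n) phi = dist_of (f' n) phi.
  apply: dist_of_ae => //.
  by apply: filterS Aae => x Ax; rewrite f'E.
have ig : mu.-integrable setT (EFin \o (fun x => SS x * (M * \1_(cube r) x))).
  have mi : measurable_fun setT (fun x => (\1_(cube r) x : R)).
    by apply: measurable_indic; exact: measurable_cube.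
  have mS : measurable_fun setT SS.
    apply: measurable_funM; last exact: measurable_indic.
    by apply: measurableT_comp.
  rewrite (_ : _ \o _ = fun x => (M%:E * (SS x * \1_(cube r) x)%:E)%E); last first.
    by apply/funext => x; rewrite /= mulrCA EFinM.
  apply: integrableZl => //; apply/integrableP; split.
    by apply/measurable_EFinP; exact: measurable_funM.
  apply: le_lt_trans (FF_loc r); apply: ge0_le_integral => //.
  - by apply: measurableT_comp => //; apply/measurable_EFinP; exact: measurable_funM.
  - by apply: emeasurable_funM => //; exact/(measurable_EFinP setT (\1_(cube r) : E -> R)).
  move=> x _; rewrite gee0_abs; last first.
    by rewrite lee_fin !mulr_ge0// fine_ge0.
  rewrite EFinM lee_wpmul2r ?lee_fin//.
  have [Ax|nAx] := pselect (A x); last by rewrite /SS indicE memNset// mulr0.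
  by rewrite /SS indicE mem_set// mulr1 fineK// ge0_fin_numE.
have bd n x : normc (f' n x * phi x) <= SS x * (M * \1_(cube r) x).
  by rewrite normcM ler_pM ?normc_ge0.
have mp n := CmeasurableM (mf' n) mphi; have mpv := CmeasurableM mv mphi.
split.
  under eq_fun do rewrite E1.
  apply: (Rdominated (fun n => (mp n).1) mpv.1 _ ig) => [x|n x].
    rewrite /= cReM; under eq_fun do rewrite /= cReM.
    apply: cvgB; (apply: cvgM; last exact: cvg_cst); [exact: cvRe|exact: cvIm].
  exact: (le_trans (Re_le_normc _) (bd n x)).
under eq_fun do rewrite E1.
apply: (Rdominated (fun n => (mp n).2) mpv.2 _ ig) => [x|n x].
  rewrite /= cImM; under eq_fun do rewrite /= cImM.
  apply: cvgD; (apply: cvgM; last exact: cvg_cst); [exact: cvRe|exact: cvIm].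
exact: (le_trans (Im_le_normc _) (bd n x)).
Qed.

(** Completeness of L^p, in the form of the convergence of an absolutely
    convergent series, with its rate.  Convergence against test functions holds
    because the partial sums are dominated by a locally integrable function. *)
Lemma Lp_limit : exists v, [/\ Cmeasurable v, Cnrm p v B,
  forall m, Cnrm p (v \- f_ m) (B - \sum_(k < m.+1) b k) &
  forall phi, test_function phi ->
  (fun n => Re (dist_of (f_ n) phi)) @ \oo --> Re (dist_of v phi) /\
  (fun n => Im (dist_of (f_ n) phi)) @ \oo --> Im (dist_of v phi)].
Proof.
exists v; split; [exact: mv|exact: nv|by move=> m; exact: nvB|by move=> phi; exact: cvd].
Qed.

End construction.
End Lp_limit.

(** * Mollifiers whose consecutive differences are Laplacians *)

Section derive_R.
Context {R : realType}.
Implicit Types (f g : R -> R) (t a b c : R).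

Lemma is_derive_eqr f t a b : is_derive t (1 : R) f a -> a = b -> is_derive t (1 : R) f b.
Proof. by move=> H <-. Qed.

Lemma is_derive_scale f t c a : is_derive t (1 : R) f a -> is_derive t (1 : R) (fun t => c * f t) (c * a).
Proof. by move=> H; exact: (is_deriveZ c H). Qed.

Lemma is_derive_mulr f g t a b : is_derive t (1 : R) f a -> is_derive t (1 : R) g b ->
  is_derive t (1 : R) (fun t => f t * g t) (a * g t + f t * b).
Proof.
move=> Hf Hg; have H := is_deriveM Hf Hg.
rewrite (_ : (fun t => _) = f * g)//.
apply: (is_derive_eqr H).
by rewrite /GRing.scale /= addrC (mulrC (g t)).
Qed.

Lemma is_derive_expr t n : is_derive t (1 : R) (fun t => t ^+ n) (n%:R * t ^+ n.-1).
Proof.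
apply: DeriveDef; first exact: exprn_derivable.
by rewrite exp_derive /GRing.scale /= mulr1.
Qed.

Lemma is_derive_invr t : t != 0 -> is_derive t (1 : R) (fun t => t^-1) (- t ^- 2).
Proof.
move=> t0; apply: DeriveDef.
  by apply: (@derivableV _ _ (@idfun R)).
apply: etrans; first exact: (@deriveV _ _ (@idfun R) _ _ t0 (@derivable_id _ _ t 1)).
by rewrite derive_id /GRing.scale /= mulr1.
Qed.

Lemma is_derive_compr f g t a b : is_derive (g t) (1 : R) f a -> is_derive t (1 : R) g b ->
  is_derive t (1 : R) (fun t => f (g t)) (a * b).
Proof. exact: is_derive1_comp. Qed.

End derive_R.

Section cutoff.
Context {R : realType}.
Implicit Types (P Q : {poly R}) (s t u : R).

Lemma expr_expRN_le n u : 0 < u -> u ^+ n * expR (- u) <= n%:R ^+ n.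
Proof.
move=> u0; case: n => [|n]; first by rewrite !expr0 mul1r -[leRHS]expR0 ler_expR lerNl oppr0 ltW.
rewrite expRN ler_pdivrMr ?expR_gt0//.
have n0 : 0 < n.+1%:R :> R by [].
have -> : expR u = expR (u / n.+1%:R) ^+ n.+1 by rewrite -expRM_natl mulrC divfK// gt_eqF.
rewrite -exprMn; apply: lerXn2r; rewrite ?nnegrE; [exact: ltW|by rewrite mulr_ge0// expR_ge0|].
rewrite mulrC -ler_pdivrMr//; apply: le_trans (expR_ge1Dx _).
by rewrite lerDr.
Qed.

(** An exponential beats every polynomial: this makes exp(- 1 / t) flat at 0. *)
Lemma horner_expRN_bound P : exists2 C : R, 0 <= C &
  forall u, 0 < u -> `|P.[u] * expR (- u)| <= C.
Proof.
exists (\sum_(i < size P) `|P`_i| * i%:R ^+ i).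
  by apply: sumr_ge0 => i _; rewrite mulr_ge0// exprn_ge0.
move=> u u0; rewrite horner_coef mulr_suml (le_trans (ler_norm_sum _ _ _))//.
apply: ler_sum => i _; rewrite -mulrA normrM ler_wpM2l// ger0_norm.
  exact: expr_expRN_le.
by rewrite mulr_ge0 ?expR_ge0// exprn_ge0// ltW.
Qed.

Definition flat P t := if 0 < t then P.[t^-1] * expR (- t^-1) else 0.

Lemma flat_pos P t : 0 < t -> flat P t = P.[t^-1] * expR (- t^-1).
Proof. by rewrite /flat => ->. Qed.

Lemma flat_neg P t : t <= 0 -> flat P t = 0.
Proof. by rewrite /flat ltNge => ->. Qed.

(** The functions P(1/t) exp(- 1/t), extended by 0, are stable under
    differentiation; at t = 0 the quotient is t times a bounded function. *)
Lemma is_derive_flat P t : is_derive t 1 (flat P) (flat ('X^2 * (P - P^`())) t).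
Proof.
have [t0|t0|t0] := ltgtP t 0.
- rewrite flat_neg ?ltW//.
  have Hc : is_derive t (1 : R) (cst (0 : R)) (0 : R) by exact: is_derive_cst.
  apply: (near_eq_is_derive _ Hc).
  near=> s; rewrite flat_neg//; apply/ltW; near: s.
  exact: lt_nbhsl.
- rewrite flat_pos//.
  have H1 := is_derive_invr (lt0r_neq0 t0).
  have HP : is_derive t^-1 (1 : R) (horner P) (P^`()).[t^-1].
    by apply: DeriveDef; [exact: derivable_horner|rewrite -derive1E -derivE].
  have H2 := @is_derive_compr _ (horner P) (fun s : R => s^-1) t _ _ HP H1.
  have He : is_derive (-1 * t^-1) (1 : R) expR (expR (-1 * t^-1)) by exact: is_derive_expR.
  have H4 := @is_derive_compr _ expR (fun s : R => -1 * s^-1) t _ _ He (is_derive_scale (-1) H1).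
  have H5 := is_derive_mulr H2 H4.
  apply: (@near_eq_is_derive _ _ _ (fun s : R => P.[s^-1] * expR (-1 * s^-1))).
    near=> s; rewrite flat_pos ?mulN1r//; near: s; exact: lt_nbhsr.
  apply: (is_derive_eqr H5).
  rewrite !mulN1r !hornerE /= exprVn; ring.
rewrite t0 flat_neg//.
have [C C0 HC] := horner_expRN_bound ('X^2 * P).
have cv : h^-1 *: (flat P (h *: 1 + 0) - flat P 0) @[h --> 0^'] --> (0 : R).
  apply/cvgrPdist_le => e e0.
  have d0 : 0 < e / (C + 1) by rewrite divr_gt0// ltr_wpDl.
  near=> h; rewrite sub0r normrN addr0 (flat_neg _ (lexx 0)) subr0.
  rewrite [h *: 1]mulr1.
  have [h0|h0] := leP h 0; first by rewrite flat_neg// scaler0 normr0 ltW.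
  rewrite flat_pos//.
  have -> : h^-1 *: (P.[h^-1] * expR (- h^-1)) = h * (('X^2 * P).[h^-1] * expR (- h^-1)).
    rewrite /GRing.scale /= !hornerE /=; field; exact: lt0r_neq0.
  rewrite normrM gtr0_norm// (le_trans (ler_wpM2l (ltW h0) (HC _ _))) ?invr_gt0//.
  rewrite (@le_trans _ _ (h * (C + 1)))//.
    by rewrite ler_wpM2l ?ltW// ltrDl.
  rewrite -ler_pdivlMr ?ltr_wpDl//.
  have : `|h| < e / (C + 1).
    by near: h; apply: dnbhs0_lt.
  by rewrite gtr0_norm// => /ltW.
by apply: DeriveDef; [apply/cvg_ex; exists 0|exact/cvg_lim].
Unshelve. all: by end_near. Qed.

Fixpoint flat_poly n : {poly R} :=
  if n is m.+1 then - ('X^2 * (flat_poly m - (flat_poly m)^`())) else 1.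

(** [cutoff 0] is exp(- 1 / (1 - s)) for s < 1 and 0 for s >= 1, and [cutoff n]
    is its n-th derivative. *)
Definition cutoff n s := flat (flat_poly n) (1 - s).

Lemma is_derive_cutoff n s : is_derive s 1 (cutoff n) (cutoff n.+1 s).
Proof.
have H1 : is_derive s 1 (fun s : R => 1 - s) (-1 : R).
  rewrite (_ : (fun s => _) = (fun s : R => s * -1 + 1)); first exact: is_derive_affine.
  by apply/funext => t; rewrite mulrN1 addrC.
have := @is_derive_compr _ (flat (flat_poly n)) (fun s : R => 1 - s) s _ (-1) (is_derive_flat (flat_poly n) (1 - s)) H1.
rewrite (_ : _ * -1 = cutoff n.+1 s)//.
by rewrite /cutoff /flat /=; case: ifP => _; rewrite ?mul0r// mulrN1 hornerN mulNr.
Qed.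

Lemma cutoff_supp n s : 1 <= s -> cutoff n s = 0.
Proof. by move=> s1; rewrite /cutoff flat_neg// subr_le0. Qed.

Lemma cutoff1_le0 s : cutoff 1 s <= 0.
Proof.
rewrite /cutoff /flat; case: ifP => // s1.
rewrite /= !hornerE /= derivC !hornerE /= subr0 mulr1 mulNr oppr_le0.
by rewrite mulr_ge0 ?expR_ge0// sqr_ge0.
Qed.

Lemma cutoff1_0_lt0 : cutoff 1 0 < 0.
Proof.
rewrite /cutoff /flat subr0 ltr01.
by rewrite /= !hornerE /= derivC !hornerE /= subr0 invr1 expr1n !mulr1 mulN1r oppr_lt0 expR_gt0.
Qed.

End cutoff.

Section dilation_average.
Context {R : realType}.
Variable F : nat -> R -> R.
Hypothesis dF : forall n (s : R), is_derive s (1 : R) (F n) (F n.+1 s).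
Local Notation leb := (@lebesgue_measure R).
Local Notation J := `[(1 / 2 : R), 1]%classic.

Lemma profile_cont n : continuous (F n).
Proof.
move=> s; apply/differentiable_continuous/derivable1_diffP.
have H := dF n s; exact: ex_derive.
Qed.

(** For a radial profile F 0 in the variable s = |x|^2, [davg d 0] is the
    profile of an average of its dilates,
      int_(1/2)^1 tau^(d-2) F(tau^2 |x|^2) dtau / tau,
    and [davg d n] is its n-th derivative in s. *)
Definition davg (e n : nat) (s : R) : R :=
  \int[leb]_(t in J) (t ^+ (e + n.*2) / t ^+ 3 * F n (s * t ^+ 2)).

Lemma davg_integrand_cont (e n : nat) s :
  {within J, continuous (fun t : R => t ^+ (e + n.*2) / t ^+ 3 * F n (s * t ^+ 2))}.
Proof.
apply: continuous_in_subspaceT => t; rewrite inE /= in_itv /= => /andP[t1 _].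
have t0 : t != 0 by rewrite gt_eqF// (lt_le_trans _ t1).
apply: cvgM; first apply: cvgM.
- exact: exprn_continuous.
- by apply: cvgV; [rewrite expf_neq0|exact: exprn_continuous].
- apply: (@continuous_comp _ _ _ (fun t : R => s * t ^+ 2) (F n)); last exact: profile_cont.
  by apply: cvgM; [exact: cvg_cst|exact: exprn_continuous].
Qed.

Lemma davg_integrable (e n : nat) s :
  leb.-integrable J (EFin \o (fun t : R => t ^+ (e + n.*2) / t ^+ 3 * F n (s * t ^+ 2))).
Proof.
by apply: continuous_compact_integrable; [exact: segment_compact|exact: davg_integrand_cont].
Qed.

(** Differentiation under the integral sign, on a compact interval. *)
Lemma is_derive_davg e n (s : R) : is_derive s (1 : R) (davg e n) (davg e n.+1 s).
Proof.
pose f (u t : R) := t ^+ (e + n.*2) / t ^+ 3 * F n (u * t ^+ 2).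
have df (u t : R) : is_derive u (1 : R) (f ^~ t)
    (t ^+ (e + n.+1.*2) / t ^+ 3 * F n.+1 (u * t ^+ 2)).
  have H1 : is_derive u (1 : R) (fun u : R => u * t ^+ 2 + 0) (t ^+ 2) by exact: is_derive_affine.
  have H2 := is_derive_scale (t ^+ (e + n.*2) / t ^+ 3) (@is_derive_compr _ (F n) (fun u : R => u * t ^+ 2 + 0) u _ _ (dF n (u * t ^+ 2 + 0)) H1).
  rewrite (_ : f ^~ t = (fun u => t ^+ (e + n.*2) / t ^+ 3 * F n (u * t ^+ 2 + 0))).
    apply: (is_derive_eqr H2).
    by rewrite addr0 doubleS !addnS !exprS; ring.
  by apply/funext => v; rewrite /f /= addr0.
have cB : compact `[- (`|s| + 1), `|s| + 1]%classic by exact: segment_compact.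
have [M0 [_ HM]] := compact_bounded (continuous_compact (continuous_subspaceT (@profile_cont n.+1)) cB).
pose M := Num.max (M0 + 1) 0.
have Is : `]s - 1, s + 1[%classic s by rewrite /= in_itv /=; lra.
have mJ : measurable (J : set (measurableTypeR R)) by exact: measurable_itv.
have i1 u : `]s - 1, s + 1[%classic u -> leb.-integrable J (EFin \o f u).
  by move=> _; exact: davg_integrable.
have d1 u t : `]s - 1, s + 1[%classic u -> J t -> derivable (f ^~ t) u 1.
  by move=> _ _; have H := df u t; exact: ex_derive.
have G0 : forall t : R, 0 <= cst (8 * M) t.
  by move=> t; rewrite /= mulr_ge0// le_max lexx orbT.
have iG : leb.-integrable J (EFin \o cst (8 * M)).
  apply: continuous_compact_integrable; first exact: segment_compact.
  by apply: continuous_subspaceT => t; exact: cst_continuous.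
have Gub u t : `]s - 1, s + 1[%classic u -> J t -> `|partial1of2 f u t| <= cst (8 * M) t.
  move=> /=; rewrite !in_itv /= => /andP[u1 u2] /andP[t1 t2].
  rewrite partial1of2E; have H := df u t; rewrite derive_val normrM.
  have t0 : 0 < t by rewrite (lt_le_trans _ t1).
  apply: ler_pM => //.
    have t0' := ltW t0.
    rewrite normrM ger0_norm ?exprn_ge0// normfV ger0_norm ?exprn_ge0//.
    rewrite ler_pdivrMr ?exprn_gt0// (@le_trans _ _ 1)//.
      by rewrite exprn_ile1// ltW.
    rewrite -(@ler_pM2l _ (1/8)) ?divr_gt0// mulrA mul1r mulVf// mul1r mulr1.
    rewrite (_ : 8^-1 = (1 / 2) ^+ 3); last by field.
    by apply: lerXn2r; rewrite ?nnegrE// ltW.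
  rewrite /M le_max; apply/orP; left; apply: HM; first by rewrite ltrDl.
  exists (u * t ^+ 2) => //=; rewrite in_itv /= -ler_norml normrM.
  rewrite (ger0_norm (sqr_ge0 t)) (@le_trans _ _ `|u|)//.
    by rewrite ler_piMr// exprn_ile1// ltW.
  have := ler_norm s; have := ler_norm (- s); rewrite normrN ler_norml; lra.
have D := derivable_under_integral (mu := leb) mJ Is i1 d1 G0 iG Gub.
have D' := differentiation_under_integral (mu := leb) mJ Is i1 d1 G0 iG Gub.
apply: DeriveDef; first exact: D.
rewrite -derive1E; apply: etrans; first exact: D'.
apply: eq_Rintegral => t _.
by rewrite partial1of2E; have H := df s t; rewrite derive_val.
Qed.

Lemma davg_supp e n s : (forall u, 1 <= u -> F n u = 0) -> 4 <= s -> davg e n s = 0.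
Proof.
move=> F0 s4; rewrite /davg (@eq_Rintegral _ _ _ leb J (fun=> 0)); first by rewrite Rintegral_cst// mul0r.
move=> t; rewrite inE /= in_itv /= => /andP[t1 t2].
rewrite F0 ?mulr0//.
rewrite (@le_trans _ _ (4 * (1 / 2) ^+ 2))//; first by rewrite expr2; lra.
by apply: ler_pM => //; apply: lerXn2r; rewrite ?nnegrE//; lra.
Qed.

(** The left-hand side is the Laplacian of the radial function of profile
    [davg e 0] in dimension e.  Up to the factor 2, the integrand is the
    derivative in t of t^e F_1(s t^2), so that the integral
    is the difference of the values at t = 1 and t = 1/2, that is, of two
    dilates of one function with the same integral. *)
Lemma davg_laplace (e : nat) s :
  4 * s * davg e 2 s + 2 * e%:R * davg e 1 s =
  2 * (F 1 s - (1 / 2) ^+ e * F 1 (s / 4)).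
Proof.
pose P (t : R) := t ^+ e * F 1 (s * t ^+ 2).
pose p (t : R) := e%:R * t ^+ e / t * F 1 (s * t ^+ 2) + t ^+ e * (2 * s * t * F 2 (s * t ^+ 2)).
have dP (t : R) : t != 0 -> is_derive t (1 : R) P (p t).
  move=> t0.
  have H2 := @is_derive_compr _ (F 1) (fun t : R => s * t ^+ 2) t _ _ (dF 1 (s * t ^+ 2)) (is_derive_scale s (is_derive_expr t 2)).
  have H3 := is_derive_mulr (is_derive_expr t e) H2.
  apply: (is_derive_eqr H3).
  rewrite /p /= expr1; case: (e) => [|m]; first by rewrite !mul0r; ring.
  rewrite -[m.+1.-1]/m; set a := F 1 _; set b := F 2 _; rewrite exprS; set c := t ^+ m.
  by field.
have cc (c : R -> R) n : continuous c -> continuous (fun t : R => F n (c t)).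
  by move=> H t; apply: (@continuous_comp _ _ _ c (F n)); [exact: H|exact: profile_cont].
have cs : continuous (fun t : R => s * t ^+ 2).
  by move=> t; apply: cvgM; [exact: cvg_cst|exact: exprn_continuous].
have cp (t : R) : t != 0 -> {for t, continuous p}.
  move=> t0; apply: cvgD.
    apply: cvgM; last exact: (cc _ 1%N cs).
    apply: cvgM; first by apply: cvgM; [exact: cvg_cst|exact: exprn_continuous].
    by apply: cvgV => //; exact: cvg_id.
  apply: cvgM; first exact: exprn_continuous.
  apply: cvgM; last exact: (cc _ 2%N cs).
  by apply: cvgM; [exact: cvg_cst|exact: cvg_id].
have tJ (t : R) : 1 / 2 <= t -> t != 0 by move=> h; rewrite gt_eqF//; lra.
have cP (t : R) : 1 / 2 <= t -> {for t, continuous P}.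
  move=> /tJ t0; apply/differentiable_continuous/derivable1_diffP.
  by have H := dP _ t0; exact: ex_derive.
have FTC : \int[leb]_(t in J) p t = P 1 - P (1 / 2).
  rewrite /Rintegral (@continuous_FTC2 _ p P)//.
  - by lra.
  - apply: continuous_in_subspaceT => t; rewrite inE /= in_itv /= => /andP[/tJ + _].
    exact: cp.
  - split.
    + move=> t; rewrite in_itv /= => /andP[h _].
      by have H := dP _ (tJ _ (ltW h)); exact: ex_derive.
    + by apply: cvg_at_right_filter; apply: cP.
    + by apply: cvg_at_left_filter; apply: cP; lra.
  - move=> t; rewrite in_itv /= => /andP[h _].
    by rewrite derive1E; have H := dP _ (tJ _ (ltW h)); rewrite derive_val.
have -> : 2 * (F 1 s - (1 / 2) ^+ e * F 1 (s / 4)) = 2 * (P 1 - P (1 / 2)).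
  rewrite /P !expr1n mul1r mulr1; congr (_ * (_ - _ * F 1 _)); by field.
rewrite -FTC.
have mJ : measurable (J : set (measurableTypeR R)) by exact: measurable_itv.
have iZ (c : R) (f : measurableTypeR R -> R) : leb.-integrable J (EFin \o f) ->
    leb.-integrable J (EFin \o (fun t => c * f t)).
  by move=> H; exact: (integrableZl mJ c H).
rewrite -!RintegralZl//; last 3 first.
- exact: davg_integrable.
- exact: davg_integrable.
- apply: continuous_compact_integrable; first exact: segment_compact.
  apply: continuous_in_subspaceT => t; rewrite inE /= in_itv /= => /andP[/tJ + _].
  exact: cp.
rewrite -RintegralD//; last 2 first.
- by apply: iZ; exact: davg_integrable.
- by apply: iZ; exact: davg_integrable.
apply: eq_Rintegral => t; rewrite inE /= in_itv /= => /andP[/tJ t0 _].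
by rewrite /p addn2 addn4 !exprS expr0; field.
Qed.

End dilation_average.

Section radial.
Context {R : realType} {d : nat}.
Local Notation E := 'rV[R]_d.
Implicit Types (f g k : E -> R) (x y : E).

Lemma rsmooth_sum (I : Type) (s : seq I) (f : I -> E -> R) :
  (forall i, rsmooth (f i)) -> rsmooth (fun x => \sum_(i <- s) f i x).
Proof.
move=> sf; elim: s => [|i s IHs].
  rewrite (_ : (fun x => _) = cst 0); first exact: rsmooth_cst.
  by apply/funext => x; rewrite big_nil.
rewrite (_ : (fun x => _) = f i \+ (fun x => \sum_(i <- s) f i x)); first exact: rsmoothD.
by apply/funext => x; rewrite big_cons.
Qed.

Lemma pd_sum (I : Type) (s : seq I) (f : I -> E -> R) j :
  (forall i, rsmooth (f i)) ->
  pd j (fun x => \sum_(i <- s) f i x) = (fun x => \sum_(i <- s) pd j (f i) x).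
Proof.
move=> sf; elim: s => [|i s IHs].
  rewrite (_ : (fun x => _) = cst 0) ?pd_cst; last by apply/funext => x; rewrite big_nil.
  by apply/funext => x; rewrite big_nil.
rewrite (_ : (fun x => _) = f i \+ (fun x => \sum_(i <- s) f i x)); last first.
  by apply/funext => x; rewrite big_cons.
rewrite pdD; last 2 first.
- exact: rsmooth_derivable.
- by apply: rsmooth_derivable; exact: rsmooth_sum.
by rewrite IHs; apply/funext => x; rewrite big_cons.
Qed.

(** The norm on row vectors is the maximum norm, so the Euclidean one, on which
    radial functions depend, is introduced through its square. *)
Definition sq x : R := \sum_(i < d) x 0 i ^+ 2.

Lemma rsmooth_coord2 i : rsmooth (fun x : E => x 0 i ^+ 2).
Proof. by apply: (rsmoothM (rsmooth_coord i) (rsmooth_coord i)). Qed.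

Lemma rsmooth_sq : rsmooth sq.
Proof. by apply: rsmooth_sum => i; exact: rsmooth_coord2. Qed.

Lemma pd_sq j : pd j sq = (fun x => 2 * x 0 j).
Proof.
rewrite /sq pd_sum; last exact: rsmooth_coord2.
apply/funext => x; rewrite (bigD1 j)//= big1 ?addr0; last first.
  move=> i ij; rewrite (_ : (fun x : E => _) = (fun x : E => x 0 i) \* (fun x : E => x 0 i))//.
  rewrite pdM; [|exact/rsmooth_derivable/rsmooth_coord|exact/rsmooth_derivable/rsmooth_coord].
  by rewrite pd_coord /= (negbTE ij) mul0r mulr0 addr0.
rewrite (_ : (fun x : E => _) = (fun x : E => x 0 j) \* (fun x : E => x 0 j))//.
rewrite pdM; [|exact/rsmooth_derivable/rsmooth_coord|exact/rsmooth_derivable/rsmooth_coord].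
by rewrite pd_coord /= eqxx mul1r mulr1; ring.
Qed.

Section profile.
Variable F : nat -> R -> R.
Hypothesis dF : forall n (s : R), is_derive s (1 : R) (F n) (F n.+1 s).

Definition rad n x := F n (sq x).

Lemma is_derive_rad n i x : is_derive x (unitv i) (rad n) (2 * x 0 i * rad n.+1 x).
Proof.
apply: derive_line.
have H1 := @is_derive_line _ _ sq x (unitv i) 0 (rsmooth_derivable rsmooth_sq _ _).
rewrite -/(pd i sq _) pd_sq scale0r addr0 in H1.
have H2 : is_derive (sq (x + 0 *: unitv i)) (1 : R) (F n) (F n.+1 (sq x)).
  by rewrite scale0r addr0.
have := @is_derive_compr _ (F n) (fun t => sq (x + t *: unitv i)) 0 _ _ H2 H1.
by rewrite mulrC.
Qed.

Lemma pd_rad n i : pd i (rad n) = (fun x => 2 * x 0 i) \* rad n.+1.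
Proof.
by apply/funext => x; rewrite /pd; have H := is_derive_rad n i x; rewrite derive_val.
Qed.

Lemma rsmooth_rad n : rsmooth (rad n).
Proof.
have s2 i : rsmooth (fun x : E => 2 * x 0 i).
  exact: (rsmoothM (@rsmooth_cst _ _ 2) (rsmooth_coord i)).
have cr (k : nat) : continuous (rad k).
  move=> x; apply: (@continuous_comp _ _ _ sq (F k)).
    exact: (rsmooth_cont rsmooth_sq).
  exact: profile_cont.
move=> m; elim: m n => [|m IHm] n; first by split => //; exact: cr.
split; first exact: cr.
split=> [i x|i]; first by have H := is_derive_rad n i x; exact: ex_derive.
by rewrite pd_rad; apply: CkM; [exact: s2|exact: IHm].
Qed.

Lemma laplace_rad x :
  \sum_(i < d) pd i (pd i (rad 0)) x = 4 * sq x * rad 2 x + 2 * d%:R * rad 1 x.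
Proof.
have s2 i : rsmooth (fun x : E => 2 * x 0 i).
  exact: (rsmoothM (@rsmooth_cst _ _ 2) (rsmooth_coord i)).
rewrite (eq_bigr (fun i => 4 * x 0 i ^+ 2 * rad 2 x + 2 * rad 1 x)).
  rewrite big_split /= sumr_const card_ord -mulr_suml -mulr_sumr /sq.
  by rewrite -mulr_natr; ring.
move=> i _; rewrite pd_rad pdM; last 2 first.
- exact: rsmooth_derivable.
- by apply: rsmooth_derivable; exact: rsmooth_rad.
rewrite /= pd_rad /=.
have -> : pd i (fun x : E => 2 * x 0 i) x = 2.
  rewrite (_ : (fun x : E => _) = (cst 2 : E -> R) \* (fun x : E => x 0 i))//.
  rewrite pdM; [|exact/rsmooth_derivable/rsmooth_cst|exact/rsmooth_derivable/rsmooth_coord].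
  by rewrite pd_cst pd_coord /= eqxx mul0r add0r mulr1.
ring.
Qed.

End profile.

Lemma sq_ge0 x : 0 <= sq x.
Proof. by apply: sumr_ge0 => i _; exact: sqr_ge0. Qed.

Lemma sq_ge_norm x : `|x| ^+ 2 <= sq x.
Proof.
rewrite -[leRHS](sqr_sqrtr (sq_ge0 x)); apply: lerXn2r; rewrite ?nnegrE ?sqrtr_ge0//.
apply: norm_le_coord => [|i]; first exact: sqrtr_ge0.
rewrite -sqrtr_sqr; apply: ler_wsqrtr; rewrite /sq (bigD1 i)//= lerDl.
by apply: sumr_ge0 => j _; exact: sqr_ge0.
Qed.

Section dilation.
Variable l : R.

Definition dil f : E -> R := fun x => f (l *: x).

Lemma is_derive_dil f i x : rsmooth f ->
  is_derive x (unitv i) (dil f) (l * pd i f (l *: x)).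
Proof.
move=> sf; apply: derive_line.
have H1 := @is_derive_line _ _ f (l *: x) (unitv i) 0 (rsmooth_derivable sf _ _).
rewrite scale0r addr0 -/(pd i f _) in H1.
have H2 : is_derive (0 : R) (1 : R) (fun t : R => t * l + 0) l by exact: is_derive_affine.
have H3 : is_derive ((fun t : R => t * l + 0) 0) (1 : R) (fun t => f (l *: x + t *: unitv i)) (pd i f (l *: x)).
  by rewrite mul0r addr0.
have := @is_derive_compr _ (fun t => f (l *: x + t *: unitv i)) (fun t : R => t * l + 0) 0 _ _ H3 H2.
rewrite mulrC; congr (is_derive _ _ _ _); apply/funext => t.
by rewrite /dil scalerDr scalerA addr0 [t * l]mulrC.
Qed.

Lemma pd_dil f i : rsmooth f -> pd i (dil f) = (fun x => l * dil (pd i f) x).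
Proof.
by move=> sf; apply/funext => x; rewrite /pd; have H := is_derive_dil i x sf; rewrite derive_val.
Qed.

Lemma rsmooth_dil f : rsmooth f -> rsmooth (dil f).
Proof.
move=> sf n; elim: n f sf => [|n IHn] f sf; have cf : continuous (dil f).
- move=> x; apply: (@continuous_comp _ _ _ (fun x : E => l *: x) f); first exact: scaler_continuous.
  exact: (rsmooth_cont sf).
- by split.
- move=> x; apply: (@continuous_comp _ _ _ (fun x : E => l *: x) f); first exact: scaler_continuous.
  exact: (rsmooth_cont sf).
- split; first exact: cf.
  split=> [i x|i]; first by have H := is_derive_dil i x sf; exact: ex_derive.
  rewrite pd_dil//; apply: (@CkM _ _ _ (cst l) (dil (pd i f))); first exact: Ck_cst.
  by apply: IHn; exact: rsmooth_pd.
Qed.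

End dilation.

Local Notation mu := (@lebesgue_rV R d).

(** The dilate normalised so that the L^1 norm does not depend on l. *)
Definition scl (a l : R) f : E -> R := fun x => a * l ^+ d * dil l f x.

Lemma rsmooth_scl a l f : rsmooth f -> rsmooth (scl a l f).
Proof. by move=> sf; exact: (rsmoothM (@rsmooth_cst _ _ (a * l ^+ d)) (rsmooth_dil l sf)). Qed.

Lemma pd_scl a l f i : rsmooth f -> pd i (scl a l f) = scl (a * l) l (pd i f).
Proof.
move=> sf; rewrite (_ : scl a l f = cst (a * l ^+ d) \* dil l f)// pdM; last 2 first.
- by apply: rsmooth_derivable; exact: rsmooth_cst.
- by apply: rsmooth_derivable; exact: rsmooth_dil.
by apply/funext => x; rewrite /scl /= pd_cst pd_dil//=; ring.
Qed.

Lemma bsupp_scl a l f : 0 < l -> bsupp f -> bsupp (scl a l f).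
Proof.
move=> l0 [r Hr]; exists (r / l) => x; rewrite ltr_pdivrMr// => rx.
by rewrite /scl /dil Hr ?mulr0// normrZ gtr0_norm// mulrC.
Qed.

Lemma rtest_scl a l f : 0 < l -> rtest f -> rtest (scl a l f).
Proof. by move=> l0 [sf bf]; split; [exact: rsmooth_scl|exact: bsupp_scl]. Qed.

(** f is bounded by a multiple of the indicator of a cube, which scales
    exactly. *)
Lemma L1n_scl f : rtest f -> exists2 C : R, 0 <= C &
  forall a l, 0 < l -> L1n (scl a l f) <= `|a| * C.
Proof.
move=> tf; have [sf bf] := tf.
have [M [r [M0 r0 _ _ HM]]] := bounded_cont_bsupp (rsmooth_cont sf) bf.
exists (M * (r *+ 2) ^+ d); first by rewrite mulr_ge0// exprn_ge0// mulrn_wge0.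
move=> a l l0; rewrite -lee_fin.
have [sS bS] := rtest_scl a l0 tf.
rewrite -(L1nE (rsmooth_cont sS) bS).
pose c := `|a| * l ^+ d * M.
have c0 : 0 <= c by rewrite /c !mulr_ge0// exprn_ge0// ltW.
have mi : measurable_fun [set: E] (\1_(cube (r / l)) : E -> R).
  by apply: measurable_indic; exact: measurable_cube.
apply: (@le_trans _ _ (\int[mu]_x (c * \1_(cube (r / l)) x)%:E)%E).
  apply: ge0_le_integral => //.
  - by apply/measurable_EFinP; apply: measurableT_comp => //; apply: measurable_cont; exact: (rsmooth_cont sS).
  - by apply/measurable_EFinP; exact: measurable_funM.
  move=> x _; rewrite lee_fin /scl /dil /c -mulrA !normrM (ger0_norm (exprn_ge0 _ (ltW l0))).
  have l0' := ltW l0.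
  rewrite [leLHS]mulrA -[leRHS]mulrA ler_wpM2l ?mulr_ge0 ?exprn_ge0//.
  suff -> : (\1_(cube (r / l)) x : R) = \1_(cube r) (l *: x) by exact: HM.
  rewrite !indicE; congr (_ : bool)%:R; apply/idP/idP; rewrite !inE => H i;
    have := H i; rewrite /= !in_itv /= mxE -!ler_norml normrM gtr0_norm// ler_pdivlMr//; by rewrite mulrC.
under eq_integral do rewrite EFinM.
rewrite ge0_integralZl//; last by apply/measurable_EFinP.
rewrite integral_indic ?setIT//; last exact: measurable_cube.
rewrite [X in (_ * X)%E](@lebesgue_cube R d) ?divr_ge0 ?(ltW l0)// -EFinM lee_fin /c -mulrnAl expr_div_n.
have ln0 : l ^+ d != 0 by rewrite expf_neq0// gt_eqF.
by rewrite le_eqVlt; apply/orP; left; apply/eqP; field.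
Qed.

(** An approximation of the identity at the scales 2^-m, whose consecutive
    differences are Laplacians of kernels of L^1 size 4^-m; each derivative
    costs a factor 2^m. *)
Record kernels (C : R) (rho kap : nat -> E -> R) : Prop := Kernels {
  kC : 1 <= C;
  k_rho : forall m, rtest (rho m);
  k_kap : forall m, rtest (kap m);
  k_lap : forall m x, \sum_(i < d) pd i (pd i (kap m.+1)) x = rho m x - rho m.+1 x;
  k_int : forall m, \int[mu]_x rho m x = 1;
  k_supp : forall m x, 2^-1 ^+ m < `|x| -> rho m x = 0;
  k_rho0 : forall m, L1n (rho m) <= C;
  k_rho1 : forall m i, L1n (pd i (rho m)) <= C * 2 ^+ m;
  k_kap0 : forall m, L1n (kap m) <= C * (2^-1 ^+ m) ^+ 2;
  k_kap1 : forall m i, L1n (pd i (kap m)) <= C * 2^-1 ^+ m;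
  k_kap2 : forall m i j, L1n (pd i (pd j (kap m))) <= C
}.

Let r0 := rad (@cutoff R) 1.
Let k0 := rad (davg (@cutoff R) d) 0.

Let dcutoff := @is_derive_cutoff R.
Let ddavg := is_derive_davg dcutoff d.

Let rtest_r0 : rtest r0.
Proof.
split; first exact: rsmooth_rad.
exists 1 => x x1; rewrite /r0 /rad cutoff_supp//.
by apply: le_trans (sq_ge_norm x); rewrite expr_ge1// ltW.
Qed.

Let rtest_k0 : rtest k0.
Proof.
split; first exact: rsmooth_rad.
exists 2 => x x1; rewrite /k0 /rad davg_supp//; first exact: cutoff_supp.
apply: le_trans (sq_ge_norm x).
rewrite (_ : 4 = 2 ^+ 2 :> R); last by ring.
by apply: lerXn2r; rewrite ?nnegrE// ltW.
Qed.

Let r0_le0 x : r0 x <= 0.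
Proof. exact: cutoff1_le0. Qed.

(* the mass of - r0, which normalises rho; it is positive as r0 <= 0 is
   continuous and r0 0 < 0 *)
Let I0 := - \int[mu]_x r0 x.

Let I0_gt0 : 0 < I0.
Proof.
have [sr br] := rtest_r0.
have i0 := integrable_cont_bsupp (rsmooth_cont sr) br.
have r00 : r0 0 < 0.
  rewrite /r0 /rad (_ : sq 0 = 0); first exact: cutoff1_0_lt0.
  by rewrite /sq big1// => i _; rewrite mxE expr0n.
pose e := - r0 0 / 2.
have e0 : 0 < e by rewrite divr_gt0// oppr_gt0.
have cr0 : r0 x @[x --> (0 : E)] --> r0 0 by exact: (rsmooth_cont sr).
have /cvgrPdist_lt /(_ _ e0) := cr0.
rewrite -nbhs_ballE => -[h /= h0 Hh].
have cube_ball x : cube (h / 2) x -> r0 x <= - e.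
  move=> Hx; have : `|r0 0 - r0 x| < e.
    apply: Hh; rewrite -ball_normE /ball_ /= sub0r normrN.
    apply: (@le_lt_trans _ _ (h / 2)); last by rewrite ltr_pdivrMr// ltr_pMr// ltr1n.
    apply: norm_le_coord => [|i]; first by rewrite divr_ge0// ltW.
    by have := Hx i; rewrite /= in_itv /= -ler_norml.
  rewrite ltr_norml => /andP[+ _]; rewrite /e; lra.
have mi : measurable_fun [set: E] (\1_(cube (h / 2)) : E -> R).
  by apply: measurable_indic; exact: measurable_cube.
rewrite /I0 -mulN1r -RintegralZl// -lte_fin /Rintegral fineK; last first.
  apply: integrable_fin_num => //.
  rewrite (_ : (fun x => _) = (fun x => (-1)%:E * (r0 x)%:E)%E)//.
  exact: integrableZl.
apply: (@lt_le_trans _ _ (\int[mu]_x (e * \1_(cube (h / 2)) x)%:E)%E).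
  under eq_integral do rewrite EFinM.
  rewrite ge0_integralZl//; [|exact/measurable_EFinP|by rewrite lee_fin ltW].
  rewrite integral_indic ?setIT//; last exact: measurable_cube.
  rewrite [X in (_ * X)%E](@lebesgue_cube R d) ?divr_ge0 ?(ltW h0)// -EFinM lte_fin mulr_gt0// exprn_gt0//.
  by rewrite mulrn_wgt0// divr_gt0.
apply: ge0_le_integral => //.
- by move=> x _; rewrite lee_fin mulr_ge0// ltW.
- by apply/measurable_EFinP; exact: measurable_funM.
- apply/measurable_EFinP; apply: measurable_funM => //.
  by apply: measurable_cont; exact: (rsmooth_cont sr).
move=> x _; rewrite lee_fin mulN1r indicE.
have [|_] := boolP (x \in _); last by rewrite mulr0 oppr_ge0.
by rewrite inE => /cube_ball; rewrite mulr1 lerNr.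
Qed.

Let laplace_k0 x : \sum_(i < d) pd i (pd i k0) x = 2 * (r0 x - (1 / 2) ^+ d * r0 (2^-1 *: x)).
Proof.
rewrite (laplace_rad ddavg); apply: etrans; first exact: (davg_laplace dcutoff).
congr (_ * (_ - _ * _)); rewrite /r0 /rad; congr (cutoff 1 _).
rewrite /sq mulr_suml; apply: eq_bigr => i _; rewrite mxE; by field.
Qed.

(** rho_m and kappa_m are the normalised dilates by 2^m of - F_1(|x|^2), for
    F = cutoff, and of the dilation average of F(|x|^2), the latter with a
    further factor 4^-m.  davg_laplace gives the identity between them, and the
    mass of rho_m is constant in m because a Laplacian has integral zero. *)
Lemma kernels_exist : exists C rho kap, kernels C rho kap.
Proof.
pose l (m : nat) : R := 2 ^+ m.
have l0 m : 0 < l m by rewrite exprn_gt0.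
have lV (m : nat) : (l m)^-1 = 2^-1 ^+ m by rewrite exprVn.
pose rho (m : nat) := scl (- I0^-1) (l m) r0.
pose kap (m : nat) := scl ((2 * I0)^-1 / l m ^+ 2) (l m) k0.
have [sr br] := rtest_r0; have [sk bk] := rtest_k0.
have [C1 C10 H1] := L1n_scl rtest_r0.
have [C3 C30 H3] := L1n_scl rtest_k0.
have [C2 HC2] : exists C2 : R, forall i a l, 0 < l -> L1n (scl a l (pd i r0)) <= `|a| * C2.
  have /choice[c Hc] : forall i, exists c : R, 0 <= c /\ forall a l, 0 < l -> L1n (scl a l (pd i r0)) <= `|a| * c.
    by move=> i; have [c c0 Hc] := L1n_scl (rtest_pd i rtest_r0); exists c.
  exists (\sum_i c i) => i a b b0; have [ci Hi] := Hc i; apply: (le_trans (Hi _ _ b0)).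
  rewrite ler_wpM2l// (bigD1 i)//= lerDl; apply: sumr_ge0 => j _; exact: (Hc j).1.
have [C4 HC4] : exists C4 : R, forall i a l, 0 < l -> L1n (scl a l (pd i k0)) <= `|a| * C4.
  have /choice[c Hc] : forall i, exists c : R, 0 <= c /\ forall a l, 0 < l -> L1n (scl a l (pd i k0)) <= `|a| * c.
    by move=> i; have [c c0 Hc] := L1n_scl (rtest_pd i rtest_k0); exists c.
  exists (\sum_i c i) => i a b b0; have [ci Hi] := Hc i; apply: (le_trans (Hi _ _ b0)).
  rewrite ler_wpM2l// (bigD1 i)//= lerDl; apply: sumr_ge0 => j _; exact: (Hc j).1.
have [C5 HC5] : exists C5 : R, forall ij a l, 0 < l -> L1n (scl a l (pd ij.1 (pd ij.2 k0))) <= `|a| * C5.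
  have /choice[c Hc] : forall ij : 'I_d * 'I_d, exists c : R, 0 <= c /\ forall a l, 0 < l -> L1n (scl a l (pd ij.1 (pd ij.2 k0))) <= `|a| * c.
    by move=> i; have [c c0 Hc] := L1n_scl (rtest_pd i.1 (rtest_pd i.2 rtest_k0)); exists c.
  exists (\sum_i c i) => i a b b0; have [ci Hi] := Hc i; apply: (le_trans (Hi _ _ b0)).
  rewrite ler_wpM2l// (bigD1 i)//= lerDl; apply: sumr_ge0 => j _; exact: (Hc j).1.
pose b := I0^-1 + (2 * I0)^-1.
have i1 : 0 < I0^-1 by rewrite invr_gt0.
have i2 : 0 < (2 * I0)^-1 by rewrite invr_gt0 mulr_gt0.
pose S := `|C1| + `|C2| + `|C3| + `|C4| + `|C5|.
pose C := 1 + b * S.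
have S0 : 0 <= S by rewrite /S !addr_ge0.
have CP (c c' X : R) : 0 <= c <= b -> c' <= S -> 0 <= X -> c * X * c' <= C * X.
  move=> /andP[c0 cb] cS X0; rewrite mulrAC ler_wpM2r// /C.
  apply: (@le_trans _ _ (b * S)); last by rewrite lerDr.
  apply: (@le_trans _ _ (c * S)); [exact: ler_wpM2l|exact: ler_wpM2r].
have [s1 s2 s3 s4 s5] : [/\ C1 <= S, C2 <= S, C3 <= S, C4 <= S & C5 <= S].
  have := (ler_norm C1, ler_norm C2, ler_norm C3, ler_norm C4, ler_norm C5).
  have := (normr_ge0 C1, normr_ge0 C2, normr_ge0 C3, normr_ge0 C4, normr_ge0 C5).
  by move=> [[[[? ?] ?] ?] ?] [[[[? ?] ?] ?] ?]; rewrite /S; split; lra.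
have b1 : 0 <= I0^-1 <= b by rewrite /b ltW//= lerDl ltW.
have b2 : 0 <= (2 * I0)^-1 <= b by rewrite /b ltW//= lerDr ltW.
have absr (X : R) : 0 <= X -> `|- I0^-1 * X| = I0^-1 * X.
  by move=> X0; rewrite mulNr normrN ger0_norm// mulr_ge0// ltW.
have absk (X : R) : 0 <= X -> `|(2 * I0)^-1 * X| = (2 * I0)^-1 * X.
  by move=> X0; rewrite ger0_norm// mulr_ge0// ltW.
have Hlap m x : \sum_(i < d) pd i (pd i (kap m.+1)) x = rho m x - rho m.+1 x.
  rewrite (eq_bigr (fun i => (2 * I0)^-1 * l m.+1 ^+ d * pd i (pd i k0) (l m.+1 *: x))); last first.
    move=> i _; rewrite /kap pd_scl// pd_scl; last exact: rsmooth_pd.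
    rewrite /scl /dil; have := l0 m.+1 => /lt0r_neq0 ln; field.
    by rewrite ln gt_eqF.
  rewrite -mulr_sumr laplace_k0 /rho /scl /dil scalerA.
  have -> : 2^-1 * l m.+1 = l m by rewrite /l exprS mulKf.
  rewrite /l exprS exprMn expr_div_n expr1n.
  have n2 : (2 : R) ^+ d != 0 by rewrite expf_neq0.
  by field; rewrite n2 gt_eqF.
have rr (m : nat) : rtest (rho m) by exact: rtest_scl.
have rk (m : nat) : rtest (kap m) by exact: rtest_scl.
have Hint m : \int[mu]_x rho m x = 1.
  elim: m => [|m IHm].
    rewrite (_ : rho 0%N = (fun x => - I0^-1 * r0 x)); last first.
      by apply/funext => x; rewrite /rho /scl /dil /l expr0 expr1n mulr1 scale1r.
    rewrite RintegralZl//; last exact: integrable_cont_bsupp (rsmooth_cont sr) br.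
    by rewrite mulNr -mulrN mulVf// gt_eqF.
  apply/eqP; rewrite -subr_eq0 -IHm -oppr_eq0 opprB -RintegralB//; last 2 first.
  - by apply: integrable_cont_bsupp; [exact: (rsmooth_cont (rr m).1)|exact: (rr m).2].
  - by apply: integrable_cont_bsupp; [exact: (rsmooth_cont (rr m.+1).1)|exact: (rr m.+1).2].
  rewrite (@eq_Rintegral _ _ _ mu setT (fun x => \sum_(i < d) pd i (pd i (kap m.+1)) x)); last first.
    by move=> x _; rewrite Hlap.
  have HS (s : seq 'I_d) : \int[mu]_x (\sum_(i <- s) pd i (pd i (kap m.+1)) x) = 0.
    elim: s => [|i s IHs].
      rewrite (@eq_Rintegral _ _ _ mu setT (fun x => 0)).
        by rewrite /Rintegral integral0.
      by move=> x _; rewrite big_nil.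
    have ti := rtest_pd i (rtest_pd i (rk m.+1)).
    rewrite (@eq_Rintegral _ _ _ mu setT (fun x => pd i (pd i (kap m.+1)) x + \sum_(i <- s) pd i (pd i (kap m.+1)) x)); last first.
      by move=> x _; rewrite big_cons.
    rewrite RintegralD//.
    - by rewrite IHs integral_pd_eq0 ?addr0//; exact: rtest_pd.
    - by apply: integrable_cont_bsupp; [exact: (rsmooth_cont ti.1)|exact: ti.2].
    elim: (s) => [|j s' IHs'].
      rewrite (_ : _ \o _ = cst 0%E); first exact: integrable0.
      by apply/funext => x /=; rewrite big_nil.
    have tj := rtest_pd j (rtest_pd j (rk m.+1)).
    rewrite (_ : _ \o _ = (EFin \o pd j (pd j (kap m.+1))) \+ (EFin \o (fun x => (\sum_(i <- s') pd i (pd i (kap m.+1)) x)%R)))%E; last first.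
      by apply/funext => x /=; rewrite big_cons EFinD.
    apply: integrableD => //.
    by apply: integrable_cont_bsupp; [exact: (rsmooth_cont tj.1)|exact: tj.2].
  by rewrite HS eqxx.
exists C, rho, kap; split => //.
- by rewrite lerDl mulr_ge0// /b addr_ge0// ltW.
- move=> m x mx; rewrite /rho /scl /dil (_ : r0 _ = 0) ?mulr0//.
  rewrite /r0 /rad cutoff_supp//; apply: le_trans (sq_ge_norm _).
  rewrite expr_ge1// normrZ gtr0_norm// mulrC -ler_pdivrMr// div1r lV.
  exact: ltW.
- move=> m; rewrite (le_trans (H1 _ _ (l0 m)))//.
  by rewrite -[- I0^-1]mulr1 absr// -[leRHS]mulr1 CP.
- move=> m i; rewrite /rho pd_scl// (le_trans (HC2 _ _ _ (l0 m)))//.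
  by rewrite absr ?CP// ltW.
- move=> m; rewrite (le_trans (H3 _ _ (l0 m)))//.
  have X0 : 0 <= (l m ^+ 2)^-1 by rewrite invr_ge0 exprn_ge0// ltW.
  rewrite absk// -lV exprVn CP//.
- move=> m i; rewrite /kap pd_scl// (le_trans (HC4 _ _ _ (l0 m)))//.
  have X0 : 0 <= (l m)^-1 by rewrite invr_ge0 ltW.
  rewrite -mulrA (_ : (l m ^+ 2)^-1 * l m = (l m)^-1); last first.
    by field; rewrite gt_eqF.
  by rewrite absk// -lV CP.
- move=> m i j; rewrite /kap pd_scl// pd_scl; last exact: rsmooth_pd.
  rewrite (le_trans (HC5 (i, j) _ _ (l0 m)))//.
  rewrite -!mulrA (_ : (l m ^+ 2)^-1 * (l m * l m) = 1); last first.
    by field; rewrite gt_eqF.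
  by rewrite absk// -[leRHS]mulr1 CP.
Qed.

End radial.

(** * Mollification and duality *)

Section real_pairing.
Context {R : realType} {d : nat}.
Local Notation E := 'rV[R]_d.
Local Notation mu := (@lebesgue_rV R d).
Implicit Types (f g k : E -> R) (x y : E).

Definition locint f := measurable_fun setT f /\
  forall r, mu.-integrable setT (fun x => (`|f x| * \1_(cube r) x)%:E).

Definition rcv k f x := \int[mu]_y (f y * k (x - y)).

Lemma rcv_bound k : continuous k -> bsupp k -> exists M r : R, [/\ 0 <= M, 0 <= r &
  forall q x y, cube q x -> `|k (x - y)| <= M * \1_(cube (q + r)) y].
Proof.
move=> ck bk; have [M [r [M0 r0 H0 HM _]]] := bounded_cont_bsupp ck bk.
exists M, r; split => // q x y qx.
have [xy|xy] := ltP r `|x - y|; first by rewrite H0// normr0 mulr_ge0.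
rewrite indicE mem_set ?mulr1//= => i; rewrite /= in_itv /= -ler_norml.
have := qx i; rewrite /= in_itv /= -ler_norml => qi.
rewrite -(subrK (x 0 i) (y 0 i)) addrC (le_trans (ler_normD _ _))// lerD//.
rewrite distrC (le_trans _ xy)//; have := norm_coord_le (x - y) i; by rewrite !mxE.
Qed.

Lemma integrable_translate_pair k g y : continuous k -> continuous g -> bsupp g ->
  mu.-integrable setT (EFin \o (fun x => k (x - y) * g x)).
Proof.
move=> ck cg bg; apply: integrable_cont_bsupp; last exact: (@bsuppMl _ _ (fun x => k (x - y)) g).
have c1 : continuous (fun x : E => k (x - y)).
  move=> x; apply: (@continuous_comp _ _ _ (fun x : E => x - y) k); last exact: ck.
  by apply: continuousB; [exact: cvg_id|exact: cst_continuous].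
by move=> x; exact: (cvgM (c1 x) (cg x)).
Qed.

Lemma integrable_rcv k f x : locint f -> continuous k -> bsupp k ->
  mu.-integrable setT (EFin \o (fun y => f y * k (x - y))).
Proof.
move=> [mf lf] ck bk; have [M [r [M0 r0 H]]] := rcv_bound ck bk.
have i1 : mu.-integrable setT (fun y => M%:E * (`|f y| * \1_(cube (`|x| + r)) y)%:E)%E.
  by apply: integrableZl.
apply: (le_integrable measurableT _ _ i1).
  apply/measurable_EFinP; apply: measurable_funM => //.
  by apply: (measurableT_comp (measurable_cont ck)); exact: measurable_reflect.
move=> y _; rewrite -EFinM lee_fin [leRHS]ger0_norm ?mulr_ge0// normrM mulrCA ler_wpM2l//.
by apply: H; exact: cube_norm.
Qed.

(** Transposition of a convolution; the integrand has compact support once x is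
    confined to the support of g, so Fubini's theorem applies. *)
Lemma pair_fubini f k g : locint f -> continuous k -> bsupp k ->
  continuous g -> bsupp g ->
  mu.-integrable setT (EFin \o (fun x => rcv k f x * g x)) /\
  \int[mu]_x (rcv k f x * g x) = \int[mu]_y (f y * \int[mu]_x (k (x - y) * g x)).
Proof.
move=> lof ck bk cg bg; have [mf lf] := lof.
have [M [r [M0 r0 H]]] := rcv_bound ck bk.
have [N [q [N0 q0 _ _ Hg]]] := bounded_cont_bsupp cg bg.
pose F (z : E * E) := (f z.2 * k (z.1 - z.2) * g z.1)%:E.
have mF : measurable_fun setT F.
  apply/measurable_EFinP; apply: measurable_funM; last first.
    exact: (measurableT_comp (measurable_cont cg) measurable_fst).
  apply: measurable_funM; last exact: measurable_conv_kernel.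
  exact: (measurableT_comp mf measurable_snd).
pose A := \int[mu]_y (`|f y| * \1_(cube (q + r)) y).
have lA : (\int[mu]_y (`|f y| * \1_(cube (q + r)) y)%:E = A%:E)%E.
  rewrite fineK//; exact: integrable_fin_num.
have iF : (mu \x mu)%E.-integrable setT F.
  apply/(integrable12ltyP mu mu mF).
  have iq : mu.-integrable setT (fun x => (N * M * A * \1_(cube q) x)%:E).
    exact: integrable_cube.
  have /integrableP[miq] := iq.
  apply: le_lt_trans; apply: ge0_le_integral => //.
  - by move=> x _; exact: integral_ge0.
  - have mF' : measurable_fun setT (fun z : E * E => `|f z.2 * k (z.1 - z.2) * g z.1|).
      by apply: measurableT_comp => //; apply/measurable_EFinP.
    exact: (measurable_int_param mF').
  - exact: measurableT_comp.
  move=> x _.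
  apply: (@le_trans _ _ (N * M * \1_(cube q) x * A)%:E); last first.
    by rewrite [X in (_ <= X)%E]/= lee_fin -mulrA [\1__ _ * A]mulrC mulrA ler_norm.
  have mfc : measurable_fun setT (fun y => (`|f y| * \1_(cube (q + r)) y)%:E).
    apply/measurable_EFinP; apply: measurable_funM; first exact: measurableT_comp.
    by apply: measurable_indic; exact: measurable_cube.
  have c0 : (0 <= (N * M * \1_(cube q) x)%:E)%E by rewrite lee_fin !mulr_ge0.
  have f0 y : setT y -> (0 <= (`|f y| * \1_(cube (q + r)) y)%:E)%E.
    by move=> _; rewrite lee_fin mulr_ge0.
  rewrite EFinM -lA -(ge0_integralZl mu measurableT mfc f0 c0).
  apply: ge0_le_integral => //.
  - apply: measurableT_comp => //; apply/measurable_EFinP.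
    change (measurable_fun setT (fun y => f y * k (x - y) * g x)).
    apply: measurable_funM => //; apply: measurable_funM => //.
    by apply: (measurableT_comp (measurable_cont ck)); exact: measurable_reflect.
  - by apply/measurable_EFinP; apply: measurable_funM => //; apply/measurable_EFinP.
  move=> y _; rewrite lee_fin !normrM /=.
  have := Hg x; rewrite indicE; have [|_] := boolP (x \in cube q); last first.
    by rewrite mulr0 normr_le0 => /eqP ->; rewrite normr0 !mulr0 mul0r.
  rewrite inE mulr1 => xq gN; rewrite mulr1.
  rewrite mulrC (mulrC `|f y|) mulrA (mulrC `|f y|) mulrA ler_wpM2r//.
  rewrite -mulrA; apply: ler_pM => //; exact: H.
have E1 x : (\int[mu]_y F (x, y) = (rcv k f x * g x)%:E)%E.
  rewrite /F /= /rcv mulrC -RintegralZl//; last exact: integrable_rcv.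
  rewrite /Rintegral fineK; last first.
    apply: integrable_fin_num => //.
    exact: (integrableZl measurableT (g x) (integrable_rcv x lof ck bk)).
  by apply: eq_integral => y _; rewrite mulrC.
have E2 y : (\int[mu]_x F (x, y) = (f y * \int[mu]_x (k (x - y) * g x))%:E)%E.
  have it := integrable_translate_pair y ck cg bg.
  rewrite /F /= -RintegralZl//.
  rewrite /Rintegral fineK; last first.
    exact: (integrable_fin_num measurableT (integrableZl measurableT (f y) it)).
  by apply: eq_integral => x _; rewrite mulrA.
split.
  have := integrable_fubini_F iF; rewrite /fubini_F.
  by under eq_fun do rewrite E1.
rewrite /Rintegral; congr fine.
transitivity (\int[mu]_x \int[mu]_y F (x, y))%E.
  by apply: eq_integral => x _; rewrite E1.
apply: etrans (Fubini iF) _; apply: eq_integral => y _; exact: E2.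
Qed.

Lemma translate_reflect k x y : k (x - y) = (fun z => k (0 - z)) (y - x).
Proof. by rewrite /= sub0r opprB. Qed.

Lemma pd_translate k y i : rsmooth k ->
  pd i (fun x => k (x - y)) = (fun x => pd i k (x - y)).
Proof.
move=> sk; have sk' := rsmooth_reflect 0 sk.
rewrite (_ : (fun x => k (x - y)) = (fun x => (fun z => k (0 - z)) (y - x))); last first.
  by apply/funext => x; rewrite translate_reflect.
rewrite (pd_reflect y i sk'); apply/funext => x /=.
by rewrite (pd_reflect 0 i sk) /= opprK sub0r opprB.
Qed.

Lemma rsmooth_translate k y : rsmooth k -> rsmooth (fun x => k (x - y)).
Proof.
move=> sk; have := rsmooth_reflect y (rsmooth_reflect 0 sk).
by congr rsmooth; apply/funext => x; rewrite sub0r opprB.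
Qed.

(** After transposition this is an integration by parts in the smooth factor
    k (x - y) g x. *)
Lemma rcv_ibp f k g j : locint f -> rtest k -> rtest g ->
  \int[mu]_x (rcv (pd j k) f x * g x) = - \int[mu]_x (rcv k f x * pd j g x).
Proof.
move=> lof tk tg; have [sk bk] := tk; have [sg bg] := tg.
have [spk bpk] := rtest_pd j tk; have [spg bpg] := rtest_pd j tg.
have ck := rsmooth_cont sk; have cg := rsmooth_cont sg.
have cpk := rsmooth_cont spk; have cpg := rsmooth_cont spg.
have [_ ->] := pair_fubini lof cpk bpk cg bg.
have cN : continuous (\- pd j g) by exact: (rsmooth_cont (rsmoothN spg)).
have [i2 E2] := pair_fubini lof ck bk cN (bsuppN bpg).
have [i3 _] := pair_fubini lof ck bk cpg bpg.
transitivity (\int[mu]_x (rcv k f x * (- pd j g x))); last first.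
  rewrite -mulN1r -RintegralZl//; apply: eq_Rintegral => x _.
  by rewrite mulrN mulN1r.
apply: etrans (esym E2); apply: eq_Rintegral => y _; congr (_ * _).
have int1 := integrable_translate_pair y cpk cg bg.
have int2 := integrable_translate_pair y ck cpg bpg.
transitivity (- \int[mu]_x (k (x - y) * pd j g x)); last first.
  by rewrite -mulN1r -RintegralZl//; apply: eq_Rintegral => x _; rewrite mulrN mulN1r.
apply/eqP; rewrite -addr_eq0 -RintegralD//.
have tkg : rtest ((fun x => k (x - y)) \* g).
  by split; [apply: rsmoothM => //; exact: rsmooth_translate|exact: bsuppMl].
have := integral_pd_eq0 j tkg; rewrite pdM; last 2 first.
- by apply: rsmooth_derivable; exact: rsmooth_translate.
- exact: rsmooth_derivable.
rewrite pd_translate// => H; apply/eqP; rewrite -[RHS]H.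
by apply: eq_Rintegral => x _ /=; rewrite addrC.
Qed.

(** By transposition f is integrated against the mollified g, which converges
    to g pointwise with a common bound and a common support. *)
Lemma rcv_limit f g (C : R) (rho kap : nat -> E -> R) : kernels C rho kap -> locint f ->
  continuous g -> bsupp g ->
  (fun m => \int[mu]_x (rcv (rho m) f x * g x)) @ \oo --> \int[mu]_x (f x * g x).
Proof.
move=> K lof cg bg; have [mf lf] := lof.
have [N [q [N0 q0 _ HN Hg]]] := bounded_cont_bsupp cg bg.
have cr m : continuous (rho m) by exact: (rtest_cont (k_rho K m)).
have br m : bsupp (rho m) by exact: (k_rho K m).2.
have tr (m : nat) y := integrable_translate_pair y (cr m) cg bg.
have Lt (m : nat) y : (\int[mu]_x `|rho m (x - y)|%:E = (L1n (rho m))%:E)%E.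
  exact: L1n_translate.
have supp (m : nat) z : 1 < `|z| -> rho m z = 0.
  move=> z1; apply: (k_supp K); apply: le_lt_trans z1.
  by rewrite exprn_ile1// invf_le1// ler1n.
pose G (m : nat) y := \int[mu]_x (rho m (x - y) * g x).
have it m y : mu.-integrable setT (EFin \o (fun x => rho m (x - y))).
  apply: integrable_cont_bsupp.
    move=> x; apply: (@continuous_comp _ _ _ (fun x : E => x - y) (rho m)); last exact: cr.
    by apply: continuousB; [exact: cvg_id|exact: cst_continuous].
  have [r Hr] := br m; exists (r + `|y|) => x rx; apply: Hr.
  rewrite -(ltrD2r `|y|) (lt_le_trans rx)//.
  by rewrite -[X in `|X| <= _](subrK y x) ler_normD.
have GB (m : nat) y (e : R) : (forall x, rho m (x - y) != 0 -> `|g x - g y| <= e) ->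
    `|G m y - g y| <= C * e.
  move=> He; have e0 : 0 <= e.
    (* rho m has integral 1, so it does not vanish identically *)
    have [x xy] : exists x, rho m (x - y) != 0.
      apply/not_existsP => H.
      have := k_int K m; rewrite (@eq_Rintegral _ _ _ mu setT (fun=> 0)); last first.
        move=> x _; apply/eqP; have := H (x + y); rewrite addrK => /negP; by rewrite negbK.
      by rewrite /Rintegral integral0 /= => /eqP; rewrite eq_sym oner_eq0.
    exact: le_trans (He _ xy).
  have -> : g y = \int[mu]_x (g y * rho m (x - y)).
    rewrite RintegralZl// (_ : Rintegral _ _ _ = 1) ?mulr1// -(k_int K m).
    rewrite /Rintegral; congr fine.
    apply: (integral_translate (- y) (f := fun z => (rho m z)%:E)).
    by apply/measurable_EFinP; exact: measurable_cont.
  have ig : mu.-integrable setT (EFin \o (fun x => g y * rho m (x - y))).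
    exact: (integrableZl measurableT (g y) (it m y)).
  rewrite /G -RintegralB//.
  have iab : mu.-integrable setT (EFin \o (fun x => rho m (x - y) * g x - g y * rho m (x - y))).
    exact: (integrableB measurableT (tr m y) ig).
  rewrite (le_trans (le_normr_Rintegral measurableT iab))//.
  rewrite -lee_fin /Rintegral fineK; last first.
    by apply: integrable_fin_num => //; exact: integrable_norm.
  apply: (@le_trans _ _ (\int[mu]_x (e%:E * `|rho m (x - y)|%:E))%E).
    apply: ge0_le_integral => //.
    - by apply/measurable_EFinP; apply: measurableT_comp => //; have /integrableP[/measurable_EFinP] := iab.
    - apply: emeasurable_funM => //; apply/measurable_EFinP; apply: measurableT_comp => //.
      by have /integrableP[/measurable_EFinP] := it m y.
    move=> x _; rewrite -EFinM lee_fin [g y * _]mulrC -mulrBr normrM mulrC.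
    have [->|xy] := eqVneq (rho m (x - y)) 0; first by rewrite normr0 !mulr0.
    by rewrite ler_wpM2r// He.
  rewrite ge0_integralZl//; last first.
    apply/measurable_EFinP; apply: measurableT_comp => //.
    by have /integrableP[/measurable_EFinP] := it m y.
  by rewrite Lt -EFinM lee_fin mulrC ler_wpM2r// (k_rho0 K).
have Gc y : (fun m => G m y) @ \oo --> g y.
  apply/cvgrPdist_le => e e0.
  have C0 : 0 < C by rewrite (lt_le_trans _ (kC K)).
  have d0 : 0 < e / C by rewrite divr_gt0.
  have cgy : g x @[x --> y] --> g y by exact: cg.
  have /cvgrPdist_lt /(_ _ d0) := cgy.
  rewrite -nbhs_ballE => -[h /= h0 Hh].
  have p0 : (fun m : nat => 2^-1 ^+ m : R) @ \oo --> (0 : R).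
    by apply: cvg_expr; rewrite ger0_norm// invf_lt1// ltr1n.
  near=> m; rewrite distrC (le_trans (GB m y (e / C) _))//.
    move=> x xy; rewrite distrC; apply/ltW/Hh; rewrite -ball_normE /ball_ /= distrC.
    rewrite ltNge; apply/negP => hx; move/eqP: xy; apply; apply: (k_supp K).
    apply: lt_le_trans hx.
    near: m; exact: (cvgr_lt _ p0).
  by rewrite mulrCA divff ?mulr1// gt_eqF.
have GD (m : nat) y : `|G m y| <= (N + C * (2 * N)) * \1_(cube (q + 1)) y.
  rewrite indicE; have [yq|yq] := boolP (y \in _); last first.
    rewrite mulr0 /G (@eq_Rintegral _ _ _ mu setT (fun=> 0)); last first.
      move=> x _; have := Hg x; rewrite indicE; have [xq _|xq] := boolP (x \in _); last first.
        by rewrite mulr0 normr_le0 => /eqP ->; rewrite mulr0.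
      rewrite supp ?mul0r// ltNge; apply: contra yq => xy; rewrite inE => i.
      move: xq; rewrite inE => /(_ i); rewrite /= !in_itv /= -!ler_norml => xq.
      rewrite -(subrK (x 0 i) (y 0 i)) addrC (le_trans (ler_normD _ _))// lerD//.
      rewrite distrC (le_trans _ xy)//; have := norm_coord_le (x - y) i; by rewrite !mxE.
    by rewrite /Rintegral integral0 normr0.
  rewrite mulr1 -[G m y](subrK (g y)) addrC (le_trans (ler_normD _ _))// lerD//.
  apply: GB => x _; rewrite (le_trans (ler_normB _ _))// mulr_natl mulr2n lerD//.
have -> : (fun m => \int[mu]_x (rcv (rho m) f x * g x)) = (fun m => \int[mu]_y (f y * G m y)).
  by apply/funext => m; have [_ ->] := pair_fubini lof (cr m) (br m) cg bg.
have mG (m : nat) : measurable_fun setT (G m).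
  have mm : measurable_fun setT (fun z : E * E => rho m (z.2 - z.1) * g z.2).
    apply: measurable_funM; last exact: (measurableT_comp (measurable_cont cg) measurable_snd).
    rewrite (_ : (fun z : E * E => rho m (z.2 - z.1)) = (fun z : E * E => (fun t => rho m (0 - t)) (z.1 - z.2))).
      apply: (@measurable_conv_kernel _ _ (fun t => rho m (0 - t))) => t.
      apply: (@continuous_comp _ _ _ (fun t : E => 0 - t) (rho m)); last exact: cr.
      by apply: continuousB; [exact: cst_continuous|exact: cvg_id].
    by apply/funext => z; rewrite sub0r opprB.
  by apply: measurableT_comp => //; exact: (measurable_int_param mm).
pose Q := N + C * (2 * N).
have iQ : mu.-integrable setT (fun x => Q%:E * (`|f x| * \1_(cube (q + 1)) x)%:E)%E.
  by apply: integrableZl.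
have [| | | |_ _ DC] := @dominated_convergence _ _ _ mu setT measurableT
  (fun m y => (f y * G m y)%:E) (fun y => (f y * g y)%:E) _ _ _ _ iQ.
- by move=> m; apply/measurable_EFinP; exact: measurable_funM.
- by apply/measurable_EFinP; apply: measurable_funM => //; exact: measurable_cont.
- apply: aeW => y _; apply/cvg_EFin; first by near=> m.
  by apply: cvgM; [exact: cvg_cst|exact: Gc].
- apply: aeW => y m _; rewrite -EFinM lee_fin normrM mulrCA ler_wpM2l//.
have := DC; rewrite /Rintegral => H.
have ig2 : mu.-integrable setT (fun y => (f y * g y)%:E).
  apply: (le_integrable measurableT _ _ (integrableZl measurableT N (lf q))).
    by apply/measurable_EFinP; apply: measurable_funM => //; exact: measurable_cont.
  move=> y _; rewrite -EFinM lee_fin [leRHS]ger0_norm ?mulr_ge0// normrM mulrCA ler_wpM2l//.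
apply: (@fine_cvg _ _ _ _ (fun m => \int[mu]_y (f y * G m y)%:E)%E (fine _)).
rewrite fineK//; exact: integrable_fin_num.
Unshelve. all: by end_near. Qed.

End real_pairing.

Section complex_pairing.
Context {R : realType} {d : nat}.
Local Notation E := 'rV[R]_d.
Local Notation mu := (@lebesgue_rV R d).
Local Notation Re := (@complex.Re R).
Local Notation Im := (@complex.Im R).
Implicit Types (p : \bar R) (f g w phi : E -> R[i]) (x y : E).

Lemma locint_Re p w B : (1 <= p)%E -> Cmeasurable w -> Cnrm p w B -> locint (Re \o w).
Proof.
move=> p1 mw nw; split; first exact: mw.1.
move=> r; apply: (le_integrable measurableT _ _ (loc_integrable r p1 mw nw)).
  apply/measurable_EFinP; apply: measurable_funM; first by apply: measurableT_comp => //; exact: mw.1.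
  by apply: measurable_indic; exact: measurable_cube.
move=> x _; rewrite lee_fin !normrM !normr_id (ger0_norm (normc_ge0 _)).
by rewrite ler_wpM2r//; exact: Re_le_normc.
Qed.

Lemma locint_Im p w B : (1 <= p)%E -> Cmeasurable w -> Cnrm p w B -> locint (Im \o w).
Proof.
move=> p1 mw nw; split; first exact: mw.2.
move=> r; apply: (le_integrable measurableT _ _ (loc_integrable r p1 mw nw)).
  apply/measurable_EFinP; apply: measurable_funM; first by apply: measurableT_comp => //; exact: mw.2.
  by apply: measurable_indic; exact: measurable_cube.
move=> x _; rewrite lee_fin !normrM !normr_id (ger0_norm (normc_ge0 _)).
by rewrite ler_wpM2r//; exact: Im_le_normc.
Qed.

Lemma Re_cv k w x : Re (cv k w x) = rcv k (Re \o w) x.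
Proof. by rewrite cvE. Qed.

Lemma Im_cv k w x : Im (cv k w x) = rcv k (Im \o w) x.
Proof. by rewrite cvE. Qed.

Lemma rtest_Re phi : test_function phi -> rtest (Re \o phi).
Proof.
move=> /test_functionP[/smoothP[s _] [r Hr]]; split=> //.
by exists r => x /Hr /= ->.
Qed.

Lemma rtest_Im phi : test_function phi -> rtest (Im \o phi).
Proof.
move=> /test_functionP[/smoothP[_ s] [r Hr]]; split=> //.
by exists r => x /Hr /= ->.
Qed.

Lemma dist_of_cvE p k w B phi : (1 <= p)%E -> Cmeasurable w -> Cnrm p w B ->
  rtest k -> test_function phi ->
  dist_of (cv k w) phi =
  Complex (\int[mu]_x (rcv k (Re \o w) x * Re (phi x)) - \int[mu]_x (rcv k (Im \o w) x * Im (phi x)))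
          (\int[mu]_x (rcv k (Re \o w) x * Im (phi x)) + \int[mu]_x (rcv k (Im \o w) x * Re (phi x))).
Proof.
move=> p1 mw nw [sk bk] tphi.
have [sr br] := rtest_Re tphi; have [si bi] := rtest_Im tphi.
have l1 := locint_Re p1 mw nw; have l2 := locint_Im p1 mw nw.
have ck := rsmooth_cont sk; have cr := rsmooth_cont sr; have ci := rsmooth_cont si.
have [i1 _] := pair_fubini l1 ck bk cr br.
have [i2 _] := pair_fubini l1 ck bk ci bi.
have [i3 _] := pair_fubini l2 ck bk cr br.
have [i4 _] := pair_fubini l2 ck bk ci bi.
rewrite /dist_of /Cintegral; congr Complex.
  rewrite -RintegralB//; apply: eq_Rintegral => x _.
  by rewrite cReM Re_cv Im_cv.
rewrite -RintegralD//; apply: eq_Rintegral => x _.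
by rewrite cImM Re_cv Im_cv.
Qed.

Lemma dist_ofE p w B phi : (1 <= p)%E -> Cmeasurable w -> Cnrm p w B -> test_function phi ->
  dist_of w phi =
  Complex (\int[mu]_x (Re (w x) * Re (phi x)) - \int[mu]_x (Im (w x) * Im (phi x)))
          (\int[mu]_x (Re (w x) * Im (phi x)) + \int[mu]_x (Im (w x) * Re (phi x))).
Proof.
move=> p1 mw nw tphi.
have [sr br] := rtest_Re tphi; have [si bi] := rtest_Im tphi.
have ip (f g : E -> R) : locint f -> rsmooth g -> bsupp g ->
    mu.-integrable setT (EFin \o (fun x => f x * g x)).
  move=> [mf lf] sg bg; have cg := rsmooth_cont sg.
  have [M [r [M0 _ _ _ H]]] := bounded_cont_bsupp cg bg.
  apply: (le_integrable measurableT _ _ (integrableZl measurableT M (lf r))).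
    by apply/measurable_EFinP; apply: measurable_funM => //; exact: measurable_cont.
  move=> y _; rewrite -EFinM lee_fin [leRHS]ger0_norm ?mulr_ge0// normrM mulrCA ler_wpM2l//.
have l1 := locint_Re p1 mw nw; have l2 := locint_Im p1 mw nw.
rewrite /dist_of /Cintegral; congr Complex.
  rewrite -RintegralB//; [|exact: ip|exact: ip]; apply: eq_Rintegral => x _; exact: cReM.
rewrite -RintegralD//; [|exact: ip|exact: ip]; apply: eq_Rintegral => x _; exact: cImM.
Qed.

(** The distributional derivative of a mollified function is the convolution
    with the derivative of the kernel. *)
Lemma cv_ibp p k w B phi j : (1 <= p)%E -> Cmeasurable w -> Cnrm p w B ->
  rtest k -> test_function phi ->
  dist_of (cv (pd j k) w) phi = - dist_of (cv k w) (Cpartial j phi).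
Proof.
move=> p1 mw nw tk tphi.
have l1 := locint_Re p1 mw nw; have l2 := locint_Im p1 mw nw.
have t1 := rtest_Re tphi; have t2 := rtest_Im tphi.
rewrite (dist_of_cvE p1 mw nw (rtest_pd j tk) tphi).
rewrite (dist_of_cvE p1 mw nw tk (test_Cpartial j tphi)).
rewrite (rcv_ibp j l1 tk t1) (rcv_ibp j l1 tk t2) (rcv_ibp j l2 tk t1) (rcv_ibp j l2 tk t2).
by apply: complexP; rewrite /= opprD.
Qed.

(** Convergence of complex numbers through real and imaginary parts. *)
Definition Cwlim (z : nat -> R[i]) (l : R[i]) :=
  (fun n => Re (z n)) @ \oo --> Re l /\ (fun n => Im (z n)) @ \oo --> Im l.

Lemma Cwlim_unique z l l' : Cwlim z l -> Cwlim z l' -> l = l'.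
Proof.
move=> [a b] [a' b']; apply: complexP.
  exact: (cvg_unique _ a a').
exact: (cvg_unique _ b b').
Qed.

Lemma CwlimN z l : Cwlim z l -> Cwlim (fun n => - z n) (- l).
Proof.
move=> [a b]; split.
  by rewrite cReN (_ : (fun n => _) = (fun n => - Re (z n))); [exact: cvgN|apply/funext => n; rewrite cReN].
by rewrite cImN (_ : (fun n => _) = (fun n => - Im (z n))); [exact: cvgN|apply/funext => n; rewrite cImN].
Qed.

Lemma Cwlim_shift z l (k : nat) : Cwlim z l -> Cwlim (fun n => z (k + n)%N) l.
Proof.
have S (u : nat -> R) (a : R) : u @ \oo --> a -> (fun n => u (k + n)%N) @ \oo --> a.
  move=> H; exact: (cvg_comp _ _ (cvg_addnl k) H).
by move=> [a b]; split; [exact: (S (fun n => Re (z n)))|exact: (S (fun n => Im (z n)))].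
Qed.

Lemma cv_limit p C rho kap w B phi : (1 <= p)%E -> Cmeasurable w -> Cnrm p w B ->
  kernels C rho kap -> test_function phi ->
  Cwlim (fun m => dist_of (cv (rho m) w) phi) (dist_of w phi).
Proof.
move=> p1 mw nw K tphi.
have l1 := locint_Re p1 mw nw; have l2 := locint_Im p1 mw nw.
have [sr br] := rtest_Re tphi; have [si bi] := rtest_Im tphi.
have cr := rsmooth_cont sr; have ci := rsmooth_cont si.
rewrite (dist_ofE p1 mw nw tphi).
split=> /=.
  rewrite (_ : (fun m => _) = (fun m => \int[mu]_x (rcv (rho m) (Re \o w) x * Re (phi x)) -
     \int[mu]_x (rcv (rho m) (Im \o w) x * Im (phi x)))); last first.
    by apply/funext => m; exact: (congr1 Re (dist_of_cvE p1 mw nw (k_rho K m) tphi)).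
  by apply: cvgB; [exact: (rcv_limit K l1 cr br)|exact: (rcv_limit K l2 ci bi)].
rewrite (_ : (fun m => _) = (fun m => \int[mu]_x (rcv (rho m) (Re \o w) x * Im (phi x)) +
   \int[mu]_x (rcv (rho m) (Im \o w) x * Re (phi x)))); last first.
  by apply/funext => m; exact: (congr1 Im (dist_of_cvE p1 mw nw (k_rho K m) tphi)).
by apply: cvgD; [exact: (rcv_limit K l1 ci bi)|exact: (rcv_limit K l2 cr br)].
Qed.

End complex_pairing.

(** * Gradient estimates *)

Section Lp_bounded.
Context {R : realType} {d : nat}.
Local Notation E := 'rV[R]_d.
Implicit Types (p : \bar R) (f g w phi : E -> R[i]) (x y : E) (k : E -> R) (rho kap : nat -> E -> R).

Definition LpB p f (B : R) := Cmeasurable f /\ Cnrm p f B.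

Lemma LpB_ge0 p f B : LpB p f B -> 0 <= B.
Proof. by move=> [_ /nrm_ge0]. Qed.

Lemma addBfun f g : f = g \+ (f \- g).
Proof. by apply/funext => x; rewrite /= addrC subrK. Qed.

Lemma LpBW p f A B : LpB p f A -> A <= B -> LpB p f B.
Proof. by move=> [mf nf] AB; split => //; exact: CnrmW nf. Qed.

Lemma LpBD p f g A B : (1 <= p)%E -> LpB p f A -> LpB p g B -> LpB p (f \+ g) (A + B).
Proof. by move=> p1 [mf nf] [mg ng]; split; [exact: CmeasurableD|exact: CnrmD]. Qed.

Lemma LpBN p f B : (1 <= p)%E -> LpB p f B -> LpB p (\- f) B.
Proof. by move=> p1 [mf nf]; split; [exact: CmeasurableN|exact: CnrmN]. Qed.

Lemma LpBB p f g A B : (1 <= p)%E -> LpB p f A -> LpB p g B -> LpB p (f \- g) (A + B).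
Proof. by move=> p1 lf /(LpBN p1); exact: LpBD. Qed.

Lemma LpB0 p : (1 <= p)%E -> LpB p (fun _ => 0) 0.
Proof. by move=> p1; split; [exact: Cmeasurable0|exact: Cnrm0]. Qed.

Lemma LpB_sum p (I : Type) (s : seq I) (f : I -> E -> R[i]) (B : I -> R) : (1 <= p)%E ->
  (forall i, LpB p (f i) (B i)) ->
  LpB p (fun x => \sum_(i <- s) f i x) (\sum_(i <- s) B i).
Proof.
move=> p1 H; elim: s => [|i s IHs].
  rewrite big_nil (_ : (fun x => _) = (fun=> 0)); first exact: LpB0.
  by apply/funext => x; rewrite big_nil.
rewrite big_cons (_ : (fun x => _) = f i \+ (fun x => \sum_(i <- s) f i x)); first exact: LpBD.
by apply/funext => x; rewrite big_cons.
Qed.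

Lemma LpB_mul p f W c B : (1 <= p)%E -> smooth W -> 0 <= c ->
  (forall x, normc (W x) <= c) -> LpB p f B -> LpB p (W \* f) (c * B).
Proof.
move=> p1 sW c0 Wc [mf nf]; have mW := Cmeasurable_smooth sW.
by split; [exact: CmeasurableM|exact: CnrmM].
Qed.

Lemma LpB_cv p f k a B : (1 <= p)%E -> rtest k -> L1n k <= a -> LpB p f B ->
  LpB p (cv k f) (2 * a * B).
Proof.
move=> p1 tk ka lf; have [mf nf] := lf; split; first by apply: measurable_cv => //; exact: rtest_cont.
apply: CnrmW (Cnrm_cv p1 tk mf nf).
by rewrite ler_wpM2r ?(LpB_ge0 lf)// ler_wpM2l.
Qed.

Section linearity.
Variables (p : \bar R) (w : E -> R[i]) (B : R).
Hypotheses (p1 : (1 <= p)%E) (lw : LpB p w B).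

Lemma Cint_test phi : test_function phi -> Cintegrable (fun x => w x * phi x).
Proof. by move=> tphi; exact: (Cintegrable_test p1 lw.1 lw.2 tphi). Qed.

Lemma dist_ofD phi psi : test_function phi -> test_function psi ->
  dist_of w (phi \+ psi) = dist_of w phi + dist_of w psi.
Proof.
move=> tphi tpsi; rewrite /dist_of -CintegralD; [|exact: Cint_test|exact: Cint_test].
by congr Cintegral; apply/funext => x; rewrite /= mulrDr.
Qed.

Lemma dist_ofN phi : test_function phi -> dist_of w (\- phi) = - dist_of w phi.
Proof.
move=> tphi; rewrite /dist_of -CintegralN; last exact: Cint_test.
by congr Cintegral; apply/funext => x; rewrite /= mulrN.
Qed.

Lemma dist_ofB phi psi : test_function phi -> test_function psi ->
  dist_of w (phi \- psi) = dist_of w phi - dist_of w psi.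
Proof.
move=> tphi tpsi; rewrite -(dist_ofN tpsi) -dist_ofD//; exact: test_opp.
Qed.

Lemma dist_of_sum (I : Type) (s : seq I) (phi : I -> E -> R[i]) :
  (forall i, test_function (phi i)) ->
  dist_of w (fun y => \sum_(i <- s) phi i y) = \sum_(i <- s) dist_of w (phi i).
Proof.
move=> tphi.
have t0 : test_function (fun y : E => \sum_(i <- [::]) phi i y).
  rewrite (_ : (fun y => _) = (fun y => (cst 0 y)%:C%C)); last by apply/funext => y; rewrite big_nil.
  apply/test_functionP; split; first by apply: smooth_real; exact: rsmooth_cst.
  by exists 0.
have ts (t : seq I) : test_function (fun y => \sum_(i <- t) phi i y).
  elim: t => // i t IHt.
  rewrite (_ : (fun y => _) = phi i \+ (fun y => \sum_(i <- t) phi i y)); first exact: test_add.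
  by apply/funext => y; rewrite big_cons.
elim: s => [|i s IHs].
  rewrite big_nil; apply: (@addrI _ (dist_of w (fun y => \sum_(i <- [::]) phi i y))).
  rewrite addr0 -dist_ofD//; congr dist_of; apply/funext => y /=.
  by rewrite big_nil addr0.
rewrite big_cons -IHs -dist_ofD//; congr dist_of; apply/funext => y /=.
by rewrite big_cons.
Qed.

End linearity.

Lemma Cpartial2_at i k x : rtest k ->
  Cpartial i (Cpartial i (at_ k x)) = at_ (pd i (pd i k)) x.
Proof.
move=> tk; have tk' := rtest_pd i tk; rewrite Cpartial_at// CpartialN; last first.
  by have [] := test_at x tk'.
by rewrite Cpartial_at//; apply/funext => y /=; rewrite opprK.
Qed.

(** When a - b = Delta k, the difference of the convolutions of w with a and b
    is the convolution of k with the distribution Delta w. *)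
Lemma cv_laplace p w B k a b x : (1 <= p)%E -> LpB p w B -> rtest k -> rtest a -> rtest b ->
  (forall y, \sum_(i < d) pd i (pd i k) y = a y - b y) ->
  cv a w x - cv b w x =
  \sum_(i < d) dist_of w (Cpartial i (Cpartial i (at_ k x))).
Proof.
move=> p1 lw tk ta tb H.
rewrite -(dist_of_sum p1 lw); last first.
  by move=> i; apply: test_Cpartial; apply: test_Cpartial; exact: test_at.
rewrite /cv -(dist_ofB p1 lw (test_at x ta) (test_at x tb)).
congr dist_of; apply/funext => y.
rewrite (eq_bigr (fun i => (pd i (pd i k) (x - y))%:C%C)); last first.
  by move=> i _; rewrite Cpartial2_at.
by rewrite -rmorph_sum /= H rmorphB.
Qed.

Lemma laplace_pd k a b j : rtest k -> rtest a -> rtest b ->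
  (forall y, \sum_(i < d) pd i (pd i k) y = a y - b y) ->
  forall y, \sum_(i < d) pd i (pd i (pd j k)) y = pd j a y - pd j b y.
Proof.
move=> [sk _] [sa _] [sb _] H y.
have := congr1 (fun f : E -> R => pd j f y) (funext H : (fun y => _) = a \- b).
rewrite /= pdB; last 2 first.
- exact: rsmooth_derivable.
- exact: rsmooth_derivable.
move=> H2; rewrite -[RHS]/((pd j a \- pd j b) y) -H2.
rewrite pd_sum; last by move=> i; apply: rsmooth_pd; exact: rsmooth_pd.
apply: eq_bigr => i _.
by rewrite (pdC i j sk) (pdC i j (rsmooth_pd i sk)).
Qed.

(** If the gradients of the mollified w form a convergent series in L^p, the
    limit represents d_j w, since w * rho_m converges weakly to w. *)
Lemma weak_derivative_limit p C rho kap w A j (m0 : nat) (b : nat -> R) (B : R) :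
  (1 <= p)%E -> kernels C rho kap -> LpB p w A ->
  (forall n, 0 < b n) -> (forall n, \sum_(k < n) b k <= B) ->
  LpB p (cv (pd j (rho m0)) w) (b 0%N) ->
  (forall m, LpB p (cv (pd j (rho (m0 + m).+1)) w \- cv (pd j (rho (m0 + m)%N)) w) (b m.+1)) ->
  exists v, LpB p v B /\
    forall phi, test_function phi -> dist_of v phi = - dist_of w (Cpartial j phi).
Proof.
move=> p1 K lw b0 bB n0 nS; have [mw nw] := lw.
pose f_ (m : nat) := cv (pd j (rho (m0 + m)%N)) w.
have mf (m : nat) : Cmeasurable (f_ m).
  by apply: measurable_cv => //; apply: rtest_cont; exact: rtest_pd (k_rho K _).
have nf0 : Cnrm p (f_ 0%N) (b 0%N) by rewrite /f_ addn0; exact: n0.2.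
have nfS (m : nat) : Cnrm p (f_ m.+1 \- f_ m) (b m.+1) by rewrite /f_ addnS; exact: (nS m).2.
have [v [mv nv _ cv_]] := Lp_limit p1 mf b0 bB nf0 nfS.
exists v; split; first by split.
move=> phi tphi.
have L1 : Cwlim (fun n => dist_of (f_ n) phi) (dist_of v phi) := cv_ phi tphi.
apply: (Cwlim_unique L1).
have := CwlimN (Cwlim_shift m0 (cv_limit p1 mw nw K (test_Cpartial j tphi))).
congr Cwlim; apply/funext => n.
by rewrite /f_ (cv_ibp j p1 mw nw (k_rho K _) tphi).
Qed.

Lemma geo_sum (a b : R) n : \sum_(k < n.+1) (if (k : nat) is k'.+1 then b * 2^-1 ^+ k'.+1 else a) =
  a + b * (1 - 2^-1 ^+ n).
Proof.
elim: n => [|n IHn]; first by rewrite big_ord_recl big_ord0 expr0 subrr mulr0.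
by rewrite big_ord_recr /= IHn !exprS; field.
Qed.

Lemma geo_sum_le (a b : R) n : 0 <= a -> 0 <= b ->
  \sum_(k < n) (if (k : nat) is k'.+1 then b * 2^-1 ^+ k'.+1 else a) <= a + b.
Proof.
move=> a0 b0; case: n => [|n]; first by rewrite big_ord0 addr_ge0.
rewrite geo_sum lerD2l ler_piMr// gerBl exprn_ge0//.
Qed.

(** The expansion starts at the scale 2^-m, where w * d_j rho_m costs 2^m A; the
    remaining differences are g * d_j kappa, whose norms sum to at most a
    multiple of 2^-m G. *)
Lemma gradient_bound p C rho kap w g A G j (m : nat) :
  (1 <= p)%E -> kernels C rho kap -> LpB p w A -> LpB p g G -> 0 < A -> 0 < G ->
  (forall phi, test_function phi ->
    \sum_(i < d) dist_of w (Cpartial i (Cpartial i phi)) = dist_of g phi) ->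
  exists v, LpB p v (2 * C * (2 ^+ m * A + 2^-1 ^+ m * G)) /\
    forall phi, test_function phi -> dist_of v phi = - dist_of w (Cpartial j phi).
Proof.
move=> p1 K lw lg A0 G0 H; have C1 := kC K; have C0 : 0 < C by rewrite (lt_le_trans _ C1).
pose a := 2 * (C * 2 ^+ m) * A; pose b := 2 * C * (2^-1 ^+ m) * G.
have a0 : 0 < a by rewrite !mulr_gt0// exprn_gt0.
have b0 : 0 < b by rewrite !mulr_gt0// exprn_gt0.
apply: (@weak_derivative_limit p C rho kap w A j m
  (fun n => if n is k.+1 then b * 2^-1 ^+ k.+1 else a)) => //.
- by case=> [//|n]; rewrite mulr_gt0// exprn_gt0.
- move=> n; rewrite (le_trans (geo_sum_le n (ltW a0) (ltW b0)))//.
  by rewrite /a /b le_eqVlt; apply/orP; left; apply/eqP; ring.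
- by apply: LpB_cv => //; [exact: rtest_pd (k_rho K _)|exact: (k_rho1 K)].
move=> n; set M := (m + n)%N.
have tk := k_kap K M.+1; have tr := k_rho K M; have tr' := k_rho K M.+1.
rewrite (_ : _ \- _ = \- cv (pd j (kap M.+1)) g); last first.
  apply/funext => x /=; rewrite -opprB; congr (- _).
  rewrite (cv_laplace x p1 lw (rtest_pd j tk) (rtest_pd j tr) (rtest_pd j tr')).
    by rewrite H//; apply: test_at; exact: rtest_pd.
  by apply: laplace_pd => //; exact: (k_lap K).
apply: LpBN => //.
apply: (LpBW (LpB_cv p1 (rtest_pd j tk) (k_kap1 K M.+1 j) lg)).
rewrite /b -addnS exprD le_eqVlt; apply/orP; left; apply/eqP; ring.
Qed.

Section drift.
Variables (p : \bar R) (C : R) (rho kap : nat -> E -> R).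
Hypotheses (p1 : (1 <= p)%E) (K : kernels C rho kap).
Variables (W : 'I_d -> E -> R[i]) (c : R).
Hypotheses (sW : forall l, smooth (W l)) (c0 : 0 <= c).
Hypotheses (Wc : forall l x, normc (W l x) <= c).
Hypotheses (dWc : forall l x, normc (Cpartial l (W l) x) <= c).
Variables (g : E -> R[i]) (G : R).
Hypothesis (lg : LpB p g G).

Let C0 : 0 < C. Proof. by rewrite (lt_le_trans _ (kC K)). Qed.
Let G0 : 0 <= G. Proof. exact: LpB_ge0 lg. Qed.

(** Delta w = W . grad w + g in the sense of distributions. *)
Definition drift_eq w := forall phi, test_function phi ->
  \sum_(i < d) dist_of w (Cpartial i (Cpartial i phi)) =
  \sum_(l < d) (- dist_of w (Cpartial l (W l \* phi))) + dist_of g phi.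

(** (W_l d_l w) * k without derivatives on w: they are moved onto the kernel and
    onto W_l. *)
Lemma drift_at w A l k x : LpB p w A -> rtest k ->
  - dist_of w (Cpartial l (W l \* at_ k x)) =
  cv (pd l k) (W l \* w) x - cv k (Cpartial l (W l) \* w) x.
Proof.
move=> lw tk; have tk' := rtest_pd l tk; have ta := test_at x tk.
have ta' := test_at x tk'.
have [sa _] := ta.
rewrite CpartialM// Cpartial_at// (_ : _ \+ _ =
  (Cpartial l (W l) \* at_ k x) \- (W l \* at_ (pd l k) x)); last first.
  by apply/funext => y /=; rewrite mulrN.
rewrite (dist_ofB p1 lw); last 2 first.
- exact: (test_mul (smooth_Cpartial l (sW l)) ta).
- exact: (test_mul (sW l) ta').
rewrite opprB; congr (_ - _); rewrite /cv /dist_of; congr Cintegral;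
  by apply/funext => y /=; rewrite mulrA [w y * _]mulrC.
Qed.

Lemma drift_bound w A l k a b : LpB p w A -> rtest k -> L1n (pd l k) <= a -> L1n k <= b ->
  LpB p (fun x => - dist_of w (Cpartial l (W l \* at_ k x))) (2 * (a + b) * (c * A)).
Proof.
move=> lw tk ka kb; rewrite (_ : (fun x => _) =
  cv (pd l k) (W l \* w) \- cv k (Cpartial l (W l) \* w)); last first.
  by apply/funext => x; rewrite (drift_at l x lw tk).
rewrite mulrDr mulrDl; apply: LpBB => //.
  by apply: LpB_cv => //; [exact: rtest_pd|exact: LpB_mul].
apply: LpB_cv => //; apply: LpB_mul => //; exact: smooth_Cpartial.
Qed.

Let e (m : nat) : R := 2^-1 ^+ m.
Let e0 (m : nat) : 0 < e m. Proof. by rewrite exprn_gt0. Qed.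
Let e1 (m : nat) : e m <= 1. Proof. by rewrite exprn_ile1// invf_le1// ler1n. Qed.

(* First w is compared with its mollifications: integrating the drift term by
   parts leaves at most one derivative on kappa, hence a gain of 2^-m. *)
Section first_phase.
Variables (w : E -> R[i]) (A : R).
Hypotheses (lw : LpB p w A) (H : drift_eq w).

Let A0 : 0 <= A. Proof. exact: LpB_ge0 lw. Qed.

Definition mollifier_const := d%:R * (4 * C * (c * A)) + 2 * C * G + 1.

Lemma mollifier_const_gt0 : 0 < mollifier_const.
Proof.
have := C0; have := c0 => ? /ltW ?.
by rewrite /mollifier_const ltr_wpDl// addr_ge0// !mulr_ge0.
Qed.

Lemma mollifier_step (m : nat) :
  LpB p (cv (rho m.+1) w \- cv (rho m) w) (mollifier_const * e m.+1).
Proof.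
have tk := k_kap K m.+1; have ta x := test_at x tk.
have -> : cv (rho m.+1) w \- cv (rho m) w =
    \- ((fun x => \sum_(l < d) (- dist_of w (Cpartial l (W l \* at_ (kap m.+1) x))))
        \+ cv (kap m.+1) g).
  apply/funext => x /=; rewrite -opprB; congr (- _).
  rewrite (cv_laplace x p1 lw tk (k_rho K m) (k_rho K m.+1)); last exact: (k_lap K).
  exact: H.
apply: LpBN => //.
have k0 : L1n (kap m.+1) <= C * e m.+1.
  rewrite (le_trans (k_kap0 K _))// ler_wpM2l ?(ltW C0)// expr2.
  by rewrite -[leRHS]mulr1 ler_wpM2l ?(ltW (e0 _)).
have Hl l : LpB p (fun x => - dist_of w (Cpartial l (W l \* at_ (kap m.+1) x)))
    (4 * C * (c * A) * e m.+1).
  apply: (LpBW (drift_bound lw tk (k_kap1 K m.+1 l) k0)).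
  rewrite le_eqVlt; apply/orP; left; apply/eqP; rewrite /e; ring.
apply: (LpBW (LpBD p1 (LpB_sum (index_enum _) p1 Hl) (LpB_cv p1 tk k0 lg))).
rewrite sumr_const card_ord -mulr_natl /mollifier_const.
have := e0 m.+1; nra.
Qed.

(** The limit v of the w * rho_m equals w as a distribution; working with v
    instead of w spares the proof that they agree almost everywhere. *)
Lemma mollifier_rate : exists v B,
  [/\ LpB p v B, forall m, LpB p (v \- cv (rho m) w) (mollifier_const * e m) &
      forall phi, test_function phi -> dist_of v phi = dist_of w phi].
Proof.
have [mw nw] := lw.
have P0 := mollifier_const_gt0.
pose a := 2 * C * A + 1.
have a0 : 0 < a by rewrite ltr_wpDl// !mulr_ge0// ltW.
pose b (n : nat) := if n is k.+1 then mollifier_const * 2^-1 ^+ k.+1 else a.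
have [|||||v [mv nv rv cv_]] := @Lp_limit R d p (fun m => cv (rho m) w) b (a + mollifier_const) p1.
- by move=> n; apply: measurable_cv => //; apply: rtest_cont; exact: (k_rho K).
- by case=> [//|n]; rewrite mulr_gt0// exprn_gt0.
- by move=> n; exact: geo_sum_le (ltW a0) (ltW P0).
- apply: CnrmW (LpB_cv p1 (k_rho K 0) (k_rho0 K 0) lw).2.
  by rewrite /b /a lerDl.
- by move=> n; exact: (mollifier_step n).2.
exists v, (a + mollifier_const); split; first by split.
  move=> m; split.
    by apply: CmeasurableB => //; apply: measurable_cv => //; apply: rtest_cont; exact: (k_rho K).
  apply: CnrmW (rv m); rewrite geo_sum /e le_eqVlt; apply/orP; left; apply/eqP; ring.
move=> phi tphi.
exact: (Cwlim_unique (cv_ phi tphi) (cv_limit p1 mw nw K tphi)).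
Qed.

End first_phase.

(* Then the gradients of the mollifications are compared.  Writing
   v = z + v * rho_m with || z || = O(2^-m), both derivatives in the drift term
   fall on kappa for z, without loss, and the second part is controlled by the
   gradient of v * rho_m itself. *)
Section second_phase.
Variables (v : E -> R[i]) (B D : R).
Hypotheses (lv : LpB p v B) (H : drift_eq v) (D0 : 0 < D).
Hypothesis (rate : forall m, LpB p (v \- cv (rho m) v) (D * e m)).

Let B0 : 0 <= B. Proof. exact: LpB_ge0 lv. Qed.

Definition gradient_const := d%:R * (8 * C * (c * D) + 2 * C * c) + 2 * C * G + 1.

Lemma gradient_const_gt0 : 0 < gradient_const.
Proof.
have := C0; have := c0; have := D0 => /ltW ? ? /ltW ?.
by rewrite /gradient_const ltr_wpDl// addr_ge0// !mulr_ge0// addr_ge0// !mulr_ge0.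
Qed.

Lemma gradient_step (m : nat) a j :
  (forall l, LpB p (cv (pd l (rho m)) v) a) ->
  LpB p (cv (pd j (rho m.+1)) v \- cv (pd j (rho m)) v) (gradient_const * e m.+1 * (a + 1)).
Proof.
move=> la; have tk := k_kap K m.+1; have tkj := rtest_pd j tk; have ta x := test_at x tkj.
have [mv nv] := lv.
set kj := pd j (kap m.+1) in tkj ta *.
pose z := v \- cv (rho m) v; pose vm := cv (rho m) v.
have lz : LpB p z (D * e m) := rate m.
have [Bm lvm] : exists Bm, LpB p vm Bm.
  by exists (2 * C * B); apply: LpB_cv => //; [exact: (k_rho K)|exact: (k_rho0 K)].
have split_v psi : test_function psi -> dist_of v psi = dist_of z psi + dist_of vm psi.
  move=> tpsi; rewrite /dist_of -CintegralD.
  - by congr Cintegral; apply/funext => x; rewrite /= /z /vm /= mulrBl subrK.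
  - exact: (Cint_test p1 lz).
  - exact: (Cint_test p1 lvm).
have a0 : 0 <= a by exact: LpB_ge0 (la j).
have step l x : - dist_of v (Cpartial l (W l \* at_ kj x)) =
    - dist_of z (Cpartial l (W l \* at_ kj x)) + cv kj (W l \* cv (pd l (rho m)) v) x.
  rewrite split_v; last by apply: test_Cpartial; exact: test_mul.
  rewrite opprD; congr (_ + _).
  rewrite -(cv_ibp l p1 mv nv (k_rho K m)); last exact: test_mul.
  rewrite /cv [LHS]/dist_of [RHS]/dist_of; congr Cintegral.
  by apply/funext => y /=; rewrite mulrA [_ * W l y]mulrC.
have -> : cv (pd j (rho m.+1)) v \- cv (pd j (rho m)) v =
    \- ((fun x => \sum_(l < d) (- dist_of z (Cpartial l (W l \* at_ kj x)) +
          cv kj (W l \* cv (pd l (rho m)) v) x)) \+ cv kj g).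
  apply/funext => x /=; rewrite -opprB; congr (- _).
  rewrite (cv_laplace x p1 lv tkj (rtest_pd j (k_rho K m)) (rtest_pd j (k_rho K m.+1))).
    rewrite H; last exact: ta.
    by congr (_ + _); apply: eq_bigr => l _; exact: step.
  by apply: laplace_pd => //; [exact: (k_rho K)|exact: (k_rho K)|exact: (k_lap K)].
apply: LpBN => //.
have k1 : L1n kj <= C * e m.+1 by exact: (k_kap1 K).
have k1' : L1n kj <= C.
  by rewrite (le_trans k1)// -[leRHS]mulr1 ler_wpM2l ?(ltW C0).
have Hl l : LpB p (fun x => - dist_of z (Cpartial l (W l \* at_ kj x)) +
    cv kj (W l \* cv (pd l (rho m)) v) x)
    (8 * C * (c * D) * e m.+1 + 2 * C * c * e m.+1 * a).
  apply: LpBW (LpBD p1 (drift_bound lz tkj (k_kap2 K m.+1 l j) k1')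
     (LpB_cv p1 tkj k1 (LpB_mul p1 (sW l) c0 (Wc l) (la l)))) _.
  rewrite le_eqVlt; apply/orP; left; apply/eqP; rewrite /e exprS; by field.
apply: (LpBW (LpBD p1 (LpB_sum (index_enum _) p1 Hl) (LpB_cv p1 tkj k1 lg))).
rewrite sumr_const card_ord -[X in X + _ <= _]mulr_natl /gradient_const.
have E0 := e0 m.+1.
have X0 : 0 <= d%:R * (8 * C * (c * D)) by rewrite !mulr_ge0// ltW.
have Y0 : 0 <= d%:R * (2 * C * c) by rewrite !mulr_ge0// ltW.
have Z0 : 0 <= 2 * C * G by rewrite !mulr_ge0// ltW.
rewrite [leLHS](_ : _ = (d%:R * (8 * C * (c * D)) + d%:R * (2 * C * c) * a + 2 * C * G) * e m.+1); last by ring.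
rewrite [leRHS](_ : _ = ((d%:R * (8 * C * (c * D)) + d%:R * (2 * C * c) + 2 * C * G + 1) * (a + 1)) * e m.+1); last by ring.
rewrite ler_wpM2r ?(ltW E0)//.
move: X0 Y0 Z0; set X := d%:R * _; set Y := d%:R * _; set Z := 2 * C * G; nra.
Qed.

(** Summing gradient_step: 1 + x <= exp x turns the recursion for a_m into the
    bound (a_0 + 1) exp(gradient_const), and then the differences are
    summable. *)
Lemma gradient_from_rate j : exists w' B', LpB p w' B' /\
  forall phi, test_function phi -> dist_of w' phi = - dist_of v (Cpartial j phi).
Proof.
have P0 := gradient_const_gt0.
pose a := fix a (m : nat) : R := if m is k.+1 then a k + gradient_const * e k.+1 * (a k + 1) else 2 * (C * 2 ^+ 0) * B + 1.
have a0 m : 0 < a m.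
  elim: m => [|m IHm] /=.
    by rewrite ltr_wpDl// !mulr_ge0// ?exprn_ge0// ltW.
  exact: addr_gt0 IHm (mulr_gt0 (mulr_gt0 P0 (e0 _)) (addr_gt0 IHm ltr01)).
have la m : forall l, LpB p (cv (pd l (rho m)) v) (a m).
  elim: m => [|m IHm] l.
    apply: LpBW (LpB_cv p1 (rtest_pd l (k_rho K 0)) (k_rho1 K 0 l) lv) _.
    by rewrite lerDl.
  rewrite (_ : cv _ _ = cv (pd l (rho m)) v \+ (cv (pd l (rho m.+1)) v \- cv (pd l (rho m)) v)).
    exact: (LpBD p1 (IHm l) (gradient_step l IHm)).
  exact: addBfun.
have aB m : a m + 1 <= (a 0%N + 1) * expR (gradient_const * (1 - e m)).
  elim: m => [|m IHm]; first by rewrite /e expr0 subrr mulr0 expR0 mulr1.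
  rewrite (_ : a m.+1 + 1 = (a m + 1) * (1 + gradient_const * e m.+1)); last by rewrite /=; ring.
  rewrite (_ : 1 - e m.+1 = (1 - e m) + e m.+1); last by rewrite /e exprS; field.
  rewrite [X in expR X]mulrDr expRD mulrA; apply: ler_pM => //.
  - by rewrite addr_ge0// ltW.
  - by rewrite addr_ge0// ltW// mulr_gt0.
  - exact: expR_ge1Dx.
pose b (n : nat) := if n is k.+1 then gradient_const * e k.+1 * (a k + 1) else a 0%N.
have bS n : \sum_(k < n.+1) b k = a n.
  elim: n => [|n IHn]; first by rewrite big_ord_recl big_ord0 addr0.
  by rewrite big_ord_recr /= IHn.
pose B' := (a 0%N + 1) * expR gradient_const.
have B'0 : 0 <= B' by rewrite mulr_ge0 ?expR_ge0// addr_ge0// ltW.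
have aB' m : a m <= B'.
  apply: (@le_trans _ _ (a m + 1)); first by rewrite lerDl.
  apply: (le_trans (aB m)); rewrite /B'; apply: ler_wpM2l.
    by rewrite addr_ge0// ltW.
  rewrite ler_expR.
  by rewrite ler_piMr ?(ltW P0)// gerBl ltW.
have [| | | |w' [lw' Hw']] := @weak_derivative_limit p C rho kap v B j 0 b B' p1 K lv.
- by case=> [|n]; [exact: a0|exact: (mulr_gt0 (mulr_gt0 P0 (e0 _)) (addr_gt0 (a0 n) ltr01))].
- by case=> [|n]; [rewrite big_ord0|rewrite bS].
- exact: la.
- by move=> m; rewrite add0n; exact: gradient_step.
by exists w', B'.
Qed.

End second_phase.

(** The limit v given by mollifier_rate solves the same equation as w and comes
    with the rate that gradient_from_rate needs. *)
Lemma drift_gradient w A j : LpB p w A -> drift_eq w -> exists w' B', LpB p w' B' /\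
  forall phi, test_function phi -> dist_of w' phi = - dist_of w (Cpartial j phi).
Proof.
move=> lw H; have [v [B [lv rv Ev]]] := mollifier_rate lw H.
have cvE' m : cv (rho m) v = cv (rho m) w.
  by apply/funext => x; rewrite /cv Ev//; apply: test_at; exact: (k_rho K).
have Hv : drift_eq v.
  move=> phi tphi; rewrite (eq_bigr (fun i => dist_of w (Cpartial i (Cpartial i phi)))); last first.
    by move=> i _; rewrite Ev//; do 2 apply: test_Cpartial.
  rewrite H//; congr (_ + _); apply: eq_bigr => l _.
  by rewrite Ev//; apply: test_Cpartial; exact: test_mul.
have [|w' [B' [lw' Hw']]] := gradient_from_rate lv Hv (mollifier_const_gt0 lw) _ j.
  by move=> m; rewrite cvE'.
exists w', B'; split=> // phi tphi; rewrite Hw'// Ev//; exact: test_Cpartial.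
Qed.

End drift.
End Lp_bounded.

(** * The sequence A^n n! / ln(n + e)^n *)

Section numeric.
Context {R : realType}.
Implicit Types (x t A C c : R) (n m k N : nat).
Local Notation e := (@expR R 1).

Definition lg n : R := ln (n%:R + e).

Lemma e_ge2 : 2 <= e.
Proof. by apply: le_trans (expR_ge1Dx 1); lra. Qed.

Lemma lg_ge1 n : 1 <= lg n.
Proof.
rewrite /lg -[leLHS](expRK 1) ler_ln ?posrE ?expR_gt0//; by rewrite lerDr.
Qed.

Lemma lg_gt0 n : 0 < lg n.
Proof. exact: lt_le_trans ltr01 (lg_ge1 n). Qed.

Lemma lg_mono n m : (n <= m)%N -> lg n <= lg m.
Proof.
move=> nm; rewrite /lg ler_ln ?posrE ?lerD2r ?ler_nat//;
  by rewrite ltr_wpDl// expR_gt0.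
Qed.

Lemma lg_succ n : lg n.+1 <= lg n + (n%:R + e)^-1.
Proof.
have e2 := e_ge2; have s0 : 0 < n%:R + e by rewrite ltr_wpDl// expR_gt0.
rewrite /lg (_ : n.+1%:R + e = (n%:R + e) * (1 + (n%:R + e)^-1)); last first.
  by rewrite -natr1 mulrDr mulr1 divff ?gt_eqF//; ring.
have s1 : 0 < (n%:R + e)^-1 by rewrite invr_gt0.
rewrite lnM ?posrE//.
by rewrite lerD2l le_ln1Dx//; lra.
Qed.

(** From exp(x / 2) <= 1 / (1 - x / 2), squared. *)
Lemma expR_le1D3 x : 0 <= x <= 1 -> expR x <= 1 + 3 * x.
Proof.
move=> /andP[x0 x1].
pose h := expR (- (x / 2)).
have h0 : 0 < h by exact: expR_gt0.
have hx : 1 - x / 2 <= h by exact: expR_ge1Dx.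
have E : expR x * h ^+ 2 = 1.
  by rewrite /h expr2 -!expRD (_ : _ + _ = 0) ?expR0//; field.
rewrite -(@ler_pM2r _ (h ^+ 2)) ?exprn_gt0// E.
apply: (@le_trans _ _ ((1 + 3 * x) * (1 - x / 2) ^+ 2)).
  rewrite -subr_ge0 (_ : _ - 1 = x * (1 - x) * (2 - 3 / 4 * x)); last by field.
  by rewrite !mulr_ge0//; lra.
rewrite ler_wpM2l//; first lra.
by apply: lerXn2r; rewrite ?nnegrE//; [lra|exact: ltW].
Qed.

(** ln(n + 1 + e) / ln(n + e) is at most 1 + 1 / ((n + e) ln(n + e)), whose n-th
    power is at most exp(x) with x = n / ((n + e) ln(n + e)) <= 1. *)
Lemma lg_pow_succ n : lg n.+1 ^+ n.+1 <= lg n ^+ n * (lg n.+1 + 3).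
Proof.
have e2 := e_ge2; set y := lg n; set y' := lg n.+1; set s := n%:R + e.
have y1 : 1 <= y := lg_ge1 n; have y'1 : 1 <= y' := lg_ge1 n.+1.
have n0 : 0 <= n%:R :> R by [].
have s0 : 0 < s by rewrite /s ltr_wpDl// expR_gt0.
have yy : y' <= y + s^-1 := lg_succ n.
have y0 : 0 < y by lra.
pose x := n%:R / (s * y).
have sy : 0 < s * y by rewrite mulr_gt0.
have xI : 0 <= x <= 1.
  rewrite /x divr_ge0 ?(ltW sy)//= ler_pdivrMr// mul1r.
  by apply: (@le_trans _ _ s); [rewrite /s lerDl expR_ge0|rewrite ler_peMr// ltW].
have H1 : y' ^+ n <= y ^+ n * expR x.
  have -> : expR x = expR (s * y)^-1 ^+ n by rewrite -expRM_natl /x mulrC.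
  rewrite -exprMn; apply: lerXn2r; rewrite ?nnegrE; [lra|by rewrite mulr_ge0 ?expR_ge0// ltW|].
  apply: (le_trans yy); apply: (@le_trans _ _ (y * (1 + (s * y)^-1))).
    by rewrite mulrDr mulr1 lerD2l invfM mulrCA divff ?mulr1// gt_eqF.
  by rewrite ler_wpM2l ?(ltW y0)// expR_ge1Dx.
have H2 : x * y' <= 1.
  apply: (@le_trans _ _ (x * (y + s^-1))); first by rewrite ler_wpM2l//; case/andP: xI.
  rewrite /x; have -> : n%:R / (s * y) * (y + s^-1) = (n%:R * (s * y + 1)) / (s ^+ 2 * y).
    by field; rewrite !gt_eqF.
  rewrite ler_pdivrMr ?mulr_gt0 ?exprn_gt0// mul1r /s.
  rewrite -subr_ge0 (_ : _ - _ = (n%:R + e) * (y * e - 1) + e); last by ring.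
  have ye : 1 <= y * e by nra.
  rewrite addr_ge0 ?mulr_ge0//; lra.
rewrite exprSr; apply: (@le_trans _ _ (y ^+ n * expR x * y')).
  by rewrite ler_wpM2r//; lra.
rewrite -mulrA ler_wpM2l ?exprn_ge0 ?(ltW y0)//.
apply: (@le_trans _ _ ((1 + 3 * x) * y')); last by nra.
by rewrite ler_wpM2r ?expR_le1D3//; lra.
Qed.

Lemma lg_pow_add k m : lg (k + m) ^+ (k + m) <= lg k ^+ k * (lg (k + m) + 3) ^+ m.
Proof.
elim: m k => [|m IHm] k; first by rewrite addn0 expr0 mulr1.
rewrite addnS -addSn; apply: (le_trans (IHm k.+1)).
rewrite [_ ^+ m.+1]exprS mulrA ler_wpM2r//.
  by rewrite exprn_ge0// addr_ge0// ltW// lg_gt0.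
apply: (le_trans (lg_pow_succ k)); rewrite ler_wpM2l//.
  by rewrite exprn_ge0// ltW// lg_gt0.
by rewrite lerD2r lg_mono// leq_addr.
Qed.

Definition log_bound A n : R := A ^+ n * (n`!%:R / lg n ^+ n).

Lemma log_bound_gt0 A n : 0 < A -> 0 < log_bound A n.
Proof.
by move=> A0; rewrite /log_bound mulr_gt0 ?exprn_gt0// divr_gt0 ?ltr0n ?fact_gt0// exprn_gt0// lg_gt0.
Qed.

(** Passing from order k + m down to order k gains, besides the factorials, the
    factor ((ln(k + m + e) + 3) / A)^m. *)
Lemma log_bound_ratio A k m : 0 < A ->
  log_bound A k <= log_bound A (k + m) * (k`!%:R / (k + m)`!%:R) * ((lg (k + m) + 3) / A) ^+ m.
Proof.
move=> A0; rewrite /log_bound.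
have f0 n : 0 < n`!%:R :> R by rewrite ltr0n fact_gt0.
have l0 n : 0 < lg n ^+ n by rewrite exprn_gt0// lg_gt0.
rewrite [leRHS](_ : _ = A ^+ k * k`!%:R * ((lg (k + m) + 3) ^+ m / lg (k + m) ^+ (k + m))); last first.
  rewrite exprD expr_div_n; field.
  by rewrite !gt_eqF// exprn_gt0.
rewrite [leLHS]mulrA ler_wpM2l ?mulr_ge0 ?exprn_ge0 ?(ltW A0)//.
rewrite ler_pdivlMr// mulrC ler_pdivrMr// mulrC.
exact: lg_pow_add.
Qed.

Lemma exp_partial_sum x N : 0 <= x -> \sum_(i < N) x ^+ i / i`!%:R <= expR x.
Proof.
move=> x0.
have : series (exp_coeff x) N <= expR x.
  apply: nondecreasing_cvgn_le; last exact: is_cvg_series_exp_coeff.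
  apply: nondecreasing_series => i _ _.
  by rewrite /exp_coeff divr_ge0// exprn_ge0.
by rewrite /series /= big_mkord.
Qed.

Lemma exp_partial_sum_rev x N : 0 <= x ->
  \sum_(i < N.+1) x ^+ (N - i) / (N - i)`!%:R <= expR x.
Proof.
move=> x0; apply: le_trans (exp_partial_sum N.+1 x0).
rewrite (reindex_inj rev_ord_inj) /=; apply: ler_sum => i _.
by rewrite subSS subKn// -ltnS.
Qed.

Lemma binfact_le (N i : nat) : (i <= N)%N ->
  'C(N, i)%:R = N`!%:R / (i`!%:R * (N - i)`!%:R) :> R.
Proof.
move=> iN; by rewrite -(bin_fact iN) natrM natrM mulfK.
Qed.

Lemma dyadic_between x : 1 <= x -> exists k : nat, 2 ^+ k <= x < 2 ^+ k.+1.
Proof.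
move=> x1; have x0 : 0 <= x by lra.
have ex : exists n : nat, x < 2 ^+ n.
  exists (Num.bound x); apply: (lt_trans (archi_boundP x0)).
  by rewrite -natrX ltr_nat ltn_expl.
case: (ex_minnP ex) => -[|k] Hk Hmin; first by move: Hk; rewrite expr0; lra.
exists k; rewrite Hk andbT leNgt; apply/negP => /Hmin.
by rewrite ltnn.
Qed.

(** With n = N + 1, the two conditions on the scale r = 2^-m are
    8 C t <= n r, for the term in 2^m, and 8 C (d + 1) r exp(c t) <= 1, for the
    others.  A dyadic r within a factor 2 of 8 C t / n satisfies both as soon as
    128 C^2 (d + 1) t exp(c t) <= n, and K is taken for this to hold. *)
Lemma scale_choice C (d : nat) : 1 <= C -> exists K : R, 1 <= K /\
  forall (c : R) (N : nat), 0 <= c ->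
  let A := c + K in
  exists m : nat, forall X, 0 <= X ->
    C * (2 ^+ m * log_bound A N + 2^-1 ^+ m *
      (d%:R * (\sum_(i < N) 'C(N, i)%:R * c ^+ (N - i) * log_bound A i.+1 + X) +
       \sum_(i < N.+1) 'C(N, i)%:R * c ^+ (N - i) * log_bound A i)) <=
    log_bound A N.+1 / 4 + X / 2.
Proof.
move=> C1; have C0 : 0 < C by lra.
have e2 := e_ge2.
pose b := 128 * C ^+ 2 * (d%:R + 1).
have b1 : 1 <= b.
  have c2 : 1 <= C ^+ 2 by rewrite expr_ge1// ltW.
  have d0 : 0 <= d%:R :> R by [].
  rewrite /b; nra.
have b0 : 0 < b by lra.
pose K := b * expR 3 * (1 + e).
have e3 : 1 <= expR 3 :> R by rewrite -[leLHS]expR0 ler_expR.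
have K1 : 1 <= K by rewrite /K; apply: mulr_ege1; [exact: mulr_ege1|lra].
exists K; split => // c N c0 A.
have K0 : 0 < K by lra.
have A0 : 0 < A by rewrite /A ltr_wpDl.
pose n : R := N.+1%:R; have n1 : 1 <= n by rewrite /n ler1n.
have n0 : 0 < n by lra.
pose t := (lg N.+1 + 3) / A.
have t0 : 0 < t by rewrite divr_gt0// ltr_wpDl// ltW// lg_gt0.
(* exp(c t) = e^3 (n + e) exp(- K t), and t exp(- K t) <= 1 / K *)
have key : b * (t * expR (c * t)) <= n.
  have -> : c * t = lg N.+1 + 3 - K * t.
    by rewrite /t /A; field; rewrite gt_eqF// ltr_wpDl.
  rewrite expRD expRD /lg lnK; last by rewrite posrE ltr_wpDl// expR_gt0.
  have H : t * expR (- (K * t)) <= K^-1.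
    rewrite expRN ler_pdivrMr ?expR_gt0// mulrC ler_pdivlMr//.
    by rewrite mulrC (le_trans _ (expR_ge1Dx _))// lerDr.
  rewrite [leLHS](_ : _ = b * expR 3 * (n + e) * (t * expR (- (K * t)))); last by rewrite /n; ring.
  apply: (@le_trans _ _ (b * expR 3 * (n + e) * K^-1)).
    by rewrite ler_wpM2l// !mulr_ge0 ?expR_ge0// ?addr_ge0 ?expR_ge0// ltW.
  rewrite ler_pdivrMr// [leRHS](_ : _ = b * expR 3 * (n * (1 + e))); last by rewrite /K; ring.
  have be0 : 0 <= b * expR 3 by exact: mulr_ge0 (ltW b0) (expR_ge0 _).
  rewrite ler_wpM2l//.
  by rewrite mulrDr mulr1 lerD2l ler_peMl// ltW// expR_gt0.
have ex1 : 1 <= expR (c * t).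
  by rewrite -[leLHS]expR0 ler_expR mulr_ge0// ltW.
have tn : b * t <= n.
  by apply: le_trans key; rewrite ler_wpM2l ?(ltW b0)// ler_peMr// ltW.
have tn' : t <= n.
  by apply: le_trans tn; rewrite ler_peMl// ltW.
have CC : 8 * C <= b.
  have d0 : 0 <= d%:R :> R by [].
  rewrite /b; nra.
have C8t : 0 < 8 * C * t by rewrite (mulr_gt0 _ t0)// mulr_gt0.
have q1 : 1 <= n / (8 * C * t).
  rewrite ler_pdivlMr// mul1r (le_trans _ tn)//.
  by rewrite ler_wpM2r// ltW.
have [m /andP[m1 m2]] := dyadic_between q1.
exists m => X X0; set B := log_bound A N.+1.
have B0 : 0 < B := log_bound_gt0 N.+1 A0.
have f0 k : 0 < k`!%:R :> R by rewrite ltr0n fact_gt0.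
have fN k : k`!%:R != 0 :> R by rewrite gt_eqF.
have ratio (k j : nat) : (k + j)%N = N.+1 -> log_bound A k <= B * (k`!%:R / N.+1`!%:R) * t ^+ j.
  by rewrite /B /t => <-; exact: log_bound_ratio.
have Ha : log_bound A N <= B * (t / n).
  apply: (le_trans (ratio N 1%N (addn1 N))); rewrite expr1 factS natrM -/n.
  by rewrite le_eqVlt; apply/orP; left; apply/eqP; field; rewrite fN gt_eqF.
have ct0 : 0 <= c * t by rewrite mulr_ge0// ltW.
(* both sums are bounded by the exponential series, with index N - i *)
have Hb : \sum_(i < N) 'C(N, i)%:R * c ^+ (N - i) * log_bound A i.+1 <= B * expR (c * t).
  apply: (@le_trans _ _ (\sum_(i < N) B * ((c * t) ^+ (N - i) / (N - i)`!%:R))).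
    apply: ler_sum => i _; have iN : (i <= N)%N by exact: ltnW.
    have Hi : (i.+1 + (N - i))%N = N.+1 by rewrite addSn subnKC.
    apply: (@le_trans _ _ ('C(N, i)%:R * c ^+ (N - i) * (B * (i.+1`!%:R / N.+1`!%:R) * t ^+ (N - i)))).
      by rewrite ler_wpM2l ?ratio// mulr_ge0// exprn_ge0.
    rewrite binfact_le// [(c * t) ^+ _]exprMn factS [N.+1`!]factS !natrM -/n.
    rewrite [leLHS](_ : _ = B * (c ^+ (N - i) * t ^+ (N - i) / (N - i)`!%:R) * (i.+1%:R / n)); last first.
      by field; rewrite !fN gt_eqF.
    rewrite ler_piMr//.
      by rewrite mulr_ge0 ?(ltW B0)// divr_ge0// mulr_ge0// exprn_ge0// ltW.
    by rewrite ler_pdivrMr// mul1r /n ler_nat ltnS.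
  rewrite -mulr_sumr ler_wpM2l ?(ltW B0)//.
  apply: le_trans (exp_partial_sum_rev N ct0).
  by rewrite big_ord_recr /= lerDl divr_ge0// exprn_ge0.
have Hc : \sum_(i < N.+1) 'C(N, i)%:R * c ^+ (N - i) * log_bound A i <= B * expR (c * t).
  apply: (@le_trans _ _ (\sum_(i < N.+1) B * ((c * t) ^+ (N - i) / (N - i)`!%:R))).
    apply: ler_sum => i _; have iN : (i <= N)%N by rewrite -ltnS.
    have Hi : (i + (N - i).+1)%N = N.+1 by rewrite addnS subnKC.
    apply: (@le_trans _ _ ('C(N, i)%:R * c ^+ (N - i) * (B * (i`!%:R / N.+1`!%:R) * t ^+ (N - i).+1))).
      by rewrite ler_wpM2l ?ratio// mulr_ge0// exprn_ge0.
    rewrite binfact_le// [(c * t) ^+ _]exprMn [N.+1`!]factS !natrM -/n exprS.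
    rewrite [leLHS](_ : _ = B * (c ^+ (N - i) * t ^+ (N - i) / (N - i)`!%:R) * (t / n)); last first.
      by field; rewrite !fN gt_eqF.
    rewrite ler_piMr//.
      by rewrite mulr_ge0 ?(ltW B0)// divr_ge0// mulr_ge0// exprn_ge0// ltW.
    by rewrite ler_pdivrMr// mul1r.
  rewrite -mulr_sumr ler_wpM2l ?(ltW B0)//; exact: exp_partial_sum_rev.
set S1 := \sum_(i < N) _ in Hb *; set S2 := \sum_(i < N.+1) _ in Hc *.
have r0 : 0 < (2^-1 : R) ^+ m by rewrite exprn_gt0.
have Hm1 : 2 ^+ m * (t / n) * C <= 1 / 8.
  rewrite -(@ler_pM2l _ 8)// [leRHS](_ : _ = 1); last by field.
  move: m1; rewrite ler_pdivlMr// => m1.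
  rewrite [leLHS](_ : _ = 2 ^+ m * (8 * C * t) / n); last by field; rewrite gt_eqF.
  by rewrite ler_pdivrMr// mul1r.
have Hm2 : 2^-1 ^+ m * (C * (d%:R + 1) * expR (c * t)) <= 1 / 8.
  have H : 2^-1 ^+ m <= 16 * C * t / n.
    rewrite exprVn ler_pdivlMr// mulrC ler_pdivrMr ?exprn_gt0//.
    move: m2; rewrite ltr_pdivrMr// exprS => /ltW; lra.
  apply: (@le_trans _ _ (16 * C * t / n * (C * (d%:R + 1) * expR (c * t)))).
    by rewrite ler_wpM2r// !mulr_ge0 ?expR_ge0// ltW.
  rewrite [leLHS](_ : _ = b * (t * expR (c * t)) / (8 * n)); last first.
    by rewrite /b; field; rewrite gt_eqF.
  by rewrite ler_pdivrMr ?mulr_gt0//; lra.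
have Hm3 : 2^-1 ^+ m * (C * d%:R) <= 1 / 8.
  apply: le_trans Hm2; rewrite ler_wpM2l ?(ltW r0)// -mulrA ler_wpM2l ?(ltW C0)//.
  have d0 : 0 <= d%:R :> R by [].
  nra.
rewrite [leLHS](_ : _ = 2 ^+ m * C * log_bound A N + 2^-1 ^+ m * C * (d%:R * S1 + S2) + 2^-1 ^+ m * (C * d%:R) * X); last by ring.
apply: lerD; last by nra.
have P1 : 2 ^+ m * C * log_bound A N <= B / 8.
  apply: (@le_trans _ _ (2 ^+ m * C * (B * (t / n)))).
    by rewrite ler_wpM2l// mulr_ge0 ?exprn_ge0// ltW.
  rewrite [leLHS](_ : _ = B * (2 ^+ m * (t / n) * C)); last by ring.
  by rewrite -[X in _ <= B * X]div1r ler_wpM2l// ltW.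
have P2 : 2^-1 ^+ m * C * (d%:R * S1 + S2) <= B / 8.
  apply: (@le_trans _ _ (2^-1 ^+ m * C * ((d%:R + 1) * (B * expR (c * t))))).
    rewrite ler_wpM2l ?mulr_ge0 ?(ltW r0) ?(ltW C0)// mulrDl mul1r lerD// ler_wpM2l//.
  rewrite [leLHS](_ : _ = B * (2^-1 ^+ m * (C * (d%:R + 1) * expR (c * t)))); last by ring.
  by rewrite -[X in _ <= B * X]div1r ler_wpM2l// ltW.
lra.
Qed.

End numeric.

(** * Derivatives of a solution *)

Section functionals.
Context {R : realType} {d : nat}.
Local Notation E := 'rV[R]_d.
Implicit Types (p : \bar R) (f g w phi psi : E -> R[i]) (x y : E) (s t : seq 'I_d).
Implicit Types (T : @functional R d).

(** A [functional] is an arbitrary map; on a distribution the product rule needs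
    its additivity on test functions. *)
Definition test_linear T :=
  (forall phi psi, test_function phi -> test_function psi ->
     T (phi \+ psi) = T phi + T psi) /\
  (forall phi, test_function phi -> T (\- phi) = - T phi).

Definition dist_partials s T : functional := foldr dist_partial T s.

Lemma dist_eq_trans T1 T2 T3 : dist_eq T1 T2 -> dist_eq T2 T3 -> dist_eq T1 T3.
Proof. by move=> a b phi tphi; rewrite a// b. Qed.

Lemma test_linear_dist_of p w B : (1 <= p)%E -> LpB p w B -> test_linear (dist_of w).
Proof.
by move=> p1 lw; split=> [phi psi tphi tpsi|phi tphi];
  [exact: (dist_ofD p1 lw)|exact: (dist_ofN p1 lw)].
Qed.

Lemma test_linear_partial T i : test_linear T -> test_linear (dist_partial i T).
Proof.
move=> [TD TN]; split=> [phi psi tphi tpsi|phi tphi]; rewrite /dist_partial.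
  rewrite CpartialD; [|exact: tphi.1|exact: tpsi.1].
  by rewrite TD ?opprD//; exact: test_Cpartial.
by rewrite CpartialN ?TN//; [exact: test_Cpartial|exact: tphi.1].
Qed.

Lemma test_linear_partials T s : test_linear T -> test_linear (dist_partials s T).
Proof. by move=> lT; elim: s => //= i s; exact: test_linear_partial. Qed.

Lemma dist_partial_eq T T' i : dist_eq T T' -> dist_eq (dist_partial i T) (dist_partial i T').
Proof. by move=> H phi tphi; rewrite /dist_partial H//; exact: test_Cpartial. Qed.

Lemma dist_partials_eq T T' s : dist_eq T T' -> dist_eq (dist_partials s T) (dist_partials s T').
Proof. by move=> H; elim: s => //= i s; exact: dist_partial_eq. Qed.

Lemma dist_partials_rcons T s i : dist_partials (rcons s i) T = dist_partials s (dist_partial i T).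
Proof. by rewrite /dist_partials foldr_rcons. Qed.

Lemma dist_partialC T i j :
  dist_eq (dist_partial i (dist_partial j T)) (dist_partial j (dist_partial i T)).
Proof. by move=> phi tphi; rewrite /dist_partial CpartialC//; exact: tphi.1. Qed.

Lemma dist_partials_partial T s i :
  dist_eq (dist_partials s (dist_partial i T)) (dist_partial i (dist_partials s T)).
Proof.
elim: s => //= j s IHs.
exact: dist_eq_trans (dist_partial_eq j IHs) (@dist_partialC _ j i).
Qed.

Lemma dist_partials_sum (I : Type) (r : seq I) (F : I -> @functional R d) s phi :
  dist_partials s (fun phi => \sum_(i <- r) F i phi) phi = \sum_(i <- r) dist_partials s (F i) phi.
Proof.
elim: s phi => //= i s IHs phi; rewrite {1}/dist_partial IHs -sumrN.
by apply: eq_bigr.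
Qed.

Lemma dist_partialsD T1 T2 s phi :
  dist_partials s (fun phi => T1 phi + T2 phi) phi = dist_partials s T1 phi + dist_partials s T2 phi.
Proof. by elim: s phi => //= i s IHs phi; rewrite {1}/dist_partial IHs opprD. Qed.

Lemma leibniz1 T f i phi : test_linear T -> smooth f -> test_function phi ->
  dist_partial i (dist_mul f T) phi =
  dist_mul (Cpartial i f) T phi + dist_mul f (dist_partial i T) phi.
Proof.
move=> [TD _] sf tphi; rewrite /dist_partial /dist_mul.
have t1 := test_mul (smooth_Cpartial i sf) tphi.
have t2 := test_mul sf (test_Cpartial i tphi).
have := TD _ _ t1 t2.
rewrite -(CpartialM i sf tphi.1) => ->.
by rewrite opprD addrA subrr add0r.
Qed.

Section norms.
Variable p : \bar R.
Hypothesis p1 : (1 <= p)%E.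
Local Notation D T B := (dist_Lnorm_le p T B).

Lemma dist_Lnorm_leP T B : D T B <-> exists v, LpB p v B /\ dist_eq T (dist_of v).
Proof.
split=> [[v [[mv _] Ev nv]]|[v [[mv nv] Ev]]]; first by exists v.
by exists v; split=> //; split=> //; apply: le_lt_trans nv _; rewrite ltry.
Qed.

Lemma dist_Lnorm_le_eq T T' B : dist_eq T T' -> D T' B -> D T B.
Proof. by move=> TT [v [lv Ev nv]]; exists v; split=> //; exact: dist_eq_trans Ev. Qed.

Lemma dist_Lnorm_leW T A B : A <= B -> D T A -> D T B.
Proof.
by move=> AB /dist_Lnorm_leP[v [lv Ev]]; apply/dist_Lnorm_leP; exists v; split=> //; exact: LpBW AB.
Qed.

Lemma dist_Lnorm_le0 : D ((fun=> 0) : @functional R d) 0.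
Proof.
apply/dist_Lnorm_leP; exists (fun=> 0); split; first exact: LpB0.
move=> phi _; rewrite /dist_of /Cintegral.
by apply: complexP => /=; rewrite /Rintegral (@eq_integral _ _ _ _ _ (fun=> 0%E)) ?integral0//
  => x _; rewrite mul0r.
Qed.

Lemma dist_Lnorm_leD T T1 T2 A B :
  (forall phi, test_function phi -> T phi = T1 phi + T2 phi) ->
  D T1 A -> D T2 B -> D T (A + B).
Proof.
move=> H /dist_Lnorm_leP[v1 [l1 E1]] /dist_Lnorm_leP[v2 [l2 E2]]; apply/dist_Lnorm_leP; exists (v1 \+ v2).
split; first exact: LpBD.
move=> phi tphi; rewrite H// E1// E2// /dist_of -CintegralD.
- by congr Cintegral; apply/funext => x; rewrite /= mulrDl.
- exact: (Cint_test p1 l1).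
- exact: (Cint_test p1 l2).
Qed.

Lemma dist_Lnorm_le_sum (I : Type) (r : seq I) (F : I -> @functional R d) (B : I -> R) :
  (forall i, D (F i) (B i)) -> D (fun phi => \sum_(i <- r) F i phi) (\sum_(i <- r) B i).
Proof.
move=> H; elim: r => [|i r IHr].
  rewrite big_nil; apply: dist_Lnorm_le_eq dist_Lnorm_le0 => phi _; exact: big_nil.
rewrite big_cons; apply: (dist_Lnorm_leD _ (H i) IHr) => phi _; exact: big_cons.
Qed.

Lemma dist_Lnorm_le_mul T f c B : smooth f -> 0 <= c -> (forall x, normc (f x) <= c) ->
  D T B -> D (dist_mul f T) (c * B).
Proof.
move=> sf c0 fc /dist_Lnorm_leP[v [lv Ev]]; apply/dist_Lnorm_leP; exists (f \* v).
split; first exact: LpB_mul.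
move=> phi tphi; rewrite /dist_mul Ev; last exact: (test_mul sf tphi).
rewrite /dist_of; congr Cintegral; apply/funext => x /=.
by rewrite mulrA [v x * _]mulrC.
Qed.

(** Pascal's rule. *)
Lemma leibniz_sum (c : R) (M : nat -> R) (n q r : nat) :
  \sum_(k < n.+2) 'C(n.+1, k)%:R * c ^+ (q + (n.+1 - k)) * M (r + k)%N =
  \sum_(k < n.+1) 'C(n, k)%:R * c ^+ (q.+1 + (n - k)) * M (r + k)%N +
  \sum_(k < n.+1) 'C(n, k)%:R * c ^+ (q + (n - k)) * M (r.+1 + k)%N.
Proof.
rewrite big_ord_recl /= (eq_bigr (fun k : 'I_n.+1 =>
   'C(n, k.+1)%:R * c ^+ (q + (n - k)) * M (r + k.+1)%N +
   'C(n, k)%:R * c ^+ (q + (n - k)) * M (r + k.+1)%N)); last first.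
  by move=> k _; rewrite /bump /= add1n binS natrD subSS !mulrDl.
rewrite big_split /= addrA; congr (_ + _); last first.
  by apply: eq_bigr => k _; rewrite addSnnS.
have -> : \sum_(k < n.+1) 'C(n, k)%:R * c ^+ (q.+1 + (n - k)) * M (r + k)%N =
    \sum_(k < n.+2) 'C(n, k)%:R * c ^+ (q + (n.+1 - k)) * M (r + k)%N.
  rewrite [RHS]big_ord_recr /= bin_small// mul0r mul0r addr0.
  by apply: eq_bigr => k _; rewrite subSn ?addSnnS// -ltnS.
rewrite [RHS]big_ord_recl /= !bin0; congr (_ + _).
Qed.

Section leibniz.
Variables (f : E -> R[i]) (c : R) (T : @functional R d) (M : nat -> R) (n : nat).
Hypotheses (sf : smooth f) (c0 : 0 <= c).
Hypothesis fc : forall s x, normc (Cpartials s f x) <= c ^+ size s.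
Hypotheses (lT : test_linear T) (DT : forall t, (size t <= n)%N -> D (dist_partials t T) (M (size t))).

(** Induction on the number of derivatives, the innermost one being applied
    first: it falls either on f or on T, and the bounds add up by Pascal's
    rule. *)
Lemma leibniz_bound s s' t : (size s + size t <= n)%N ->
  D (dist_partials s (dist_mul (Cpartials s' f) (dist_partials t T)))
    (\sum_(k < (size s).+1)
       'C(size s, k)%:R * c ^+ (size s' + (size s - k)) * M (size t + k)%N).
Proof.
elim/last_ind: s s' t => [|s i IHs] s' t /=.
  rewrite add0n => tn; rewrite big_ord_recl big_ord0 addr0 /= bin0 mul1r !addn0.
  apply: dist_Lnorm_le_mul => //; [exact: smooth_Cpartials|exact: exprn_ge0|exact: DT].
rewrite size_rcons => sn.
rewrite leibniz_sum.
apply: (dist_Lnorm_leD _ (IHs (i :: s') t _) (IHs s' (i :: t) _)); last 2 first.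
- by rewrite -ltnS ltnW// ltnS; move: sn; rewrite addSn => /ltnW.
- by rewrite /= addnS -addSn.
move=> phi tphi; rewrite dist_partials_rcons -dist_partialsD; apply: dist_partials_eq => // psi tpsi.
by apply: leibniz1 => //; [exact: test_linear_partials|exact: smooth_Cpartials].
Qed.

(** In d^s (f d^t T) - f d^s d^t T every term has a derivative on f, so only
    derivatives of T of order less than |s| + |t| occur. *)
Lemma commutator_Lp s t s' : (size s + size t <= n.+1)%N ->
  exists B, D (fun phi => dist_partials s (dist_mul (Cpartials s' f) (dist_partials t T)) phi -
                          dist_mul (Cpartials s' f) (dist_partials (s ++ t) T) phi) B.
Proof.
elim/last_ind: s t => [|s i IHs] t.
  by move=> _; exists 0; apply: dist_Lnorm_le_eq dist_Lnorm_le0 => phi _ /=; rewrite subrr.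
rewrite size_rcons => sn.
have [|B HB] := IHs (i :: t); first by rewrite /= addnS -addSn.
have Hl : (size s + size t <= n)%N by move: sn; rewrite addSn ltnS.
exists ((\sum_(k < (size s).+1)
  'C(size s, k)%:R * c ^+ (size (i :: s') + (size s - k)) * M (size t + k)%N) + B).
apply: (dist_Lnorm_leD _ (leibniz_bound (i :: s') Hl) HB) => phi tphi.
rewrite dist_partials_rcons cat_rcons addrA; congr (_ - _).
rewrite -dist_partialsD; apply: dist_partials_eq => // psi tpsi.
by apply: leibniz1 => //; [exact: test_linear_partials|exact: smooth_Cpartials].
Qed.

End leibniz.

Section solution.
Variables (C : R) (rho kap : nat -> E -> R).
Hypothesis K : kernels C rho kap.
Variables (c : R) (W : 'I_d -> E -> R[i]) (V u : E -> R[i]).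
Hypotheses (c0 : 0 <= c) (sW : forall l, smooth (W l)) (sV : smooth V).
Hypothesis Wc : forall l s x, normc (Cpartials s (W l) x) <= c ^+ size s.
Hypothesis Vc : forall s x, normc (Cpartials s V x) <= c ^+ size s.
Local Notation U := (dist_of u).
Hypothesis lu : LpB p u 1.
Hypothesis sol : dist_eq (laplacian U)
  (fun phi => \sum_(l < d) dist_mul (W l) (dist_partial l U) phi + dist_mul V U phi).

Let lU : test_linear U. Proof. exact: test_linear_dist_of lu. Qed.

(** d^s applied to the equation; derivatives commute on test functions. *)
Lemma laplace_dist_partials s phi : test_function phi ->
  \sum_(i < d) dist_partials s U (Cpartial i (Cpartial i phi)) =
  \sum_(l < d) dist_partials s (dist_mul (W l) (dist_partials [:: l] U)) phi + dist_partials s (dist_mul V U) phi.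
Proof.
move=> tphi; rewrite -dist_partials_sum -dist_partialsD.
rewrite -(dist_partials_eq s sol tphi) /laplacian dist_partials_sum; apply: eq_bigr => i _.
rewrite (@dist_partials_partial _ s i phi tphi) (dist_partial_eq i (@dist_partials_partial U s i) tphi).
by rewrite /dist_partial opprK.
Qed.

(** Qualitative regularity, one order at a time: if j :: s has length n + 1,
    then d^s u solves a drift equation with an L^p right-hand side. *)
Lemma derivatives_Lp n : exists M : nat -> R,
  forall t, (size t <= n)%N -> D (dist_partials t U) (M (size t)).
Proof.
elim: n => [|n [M HM]].
  exists (fun=> 1) => -[|//] _; apply/dist_Lnorm_leP; by exists u.
have H (t : n.+1.-tuple 'I_d) : exists B, D (dist_partials t U) B.
  case: t => -[//|j s] /= /eqP[sn].
  have [w [lw Ew]] := (dist_Lnorm_leP _ _).1 (HM s (eq_leq sn)).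
  pose Rm l phi := dist_partials s (dist_mul (W l) (dist_partials [:: l] U)) phi -
    dist_mul (W l) (dist_partials (s ++ [:: l]) U) phi.
  have HR l : exists B, D (Rm l) B.
    apply: (commutator_Lp (sW l) c0 (Wc l) lU HM [::]).
    by rewrite /= addn1 sn.
  have [BR HBR] := choice HR.
  have HV := leibniz_bound sV c0 Vc lU HM (s := s) [::] (t := [::]).
  have {}HV := HV (eq_leq (etrans (addn0 _) sn)).
  have HG := dist_Lnorm_leD (fun phi _ => erefl) (dist_Lnorm_le_sum (index_enum _) HBR) HV.
  have [g [lg Eg]] := (dist_Lnorm_leP _ _).1 HG.
  have comb (a b : R[i]) : a = b + (a - b) by rewrite addrC subrK.
  have Hd : drift_eq W g w.
    move=> phi tphi; have tpp i : test_function (Cpartial i (Cpartial i phi)).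
      by do 2 apply: test_Cpartial.
    rewrite (eq_bigr (fun i => dist_partials s U (Cpartial i (Cpartial i phi)))); last first.
      by move=> i _; rewrite Ew.
    rewrite laplace_dist_partials// -Eg//= addrA -big_split /=; congr (_ + _).
    apply: eq_bigr => l _; have tWp := test_mul (sW l) tphi.
    have El : dist_mul (W l) (dist_partials (s ++ [:: l]) U) phi = - dist_partials s U (Cpartial l (W l \* phi)).
      by rewrite cats1 dist_partials_rcons; exact: (@dist_partials_partial U s l _ tWp).
    rewrite /Rm -Ew; last exact: test_Cpartial.
    rewrite El; exact: comb.
  have c1 : 0 <= 1 + c by rewrite addr_ge0.
  have W1 l x : normc (W l x) <= 1 + c.
    by rewrite (le_trans (Wc l [::] x))// expr0 lerDl.
  have dW1 l x : normc (Cpartial l (W l) x) <= 1 + c.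
    by rewrite (le_trans (Wc l [:: l] x))// expr1 lerDr.
  have [w' [B' [lw' Hw']]] := drift_gradient p1 K sW c1 W1 dW1 lg j lw Hd.
  exists B'; apply/dist_Lnorm_leP; exists w'; split=> // phi tphi.
  rewrite Hw'// /= /dist_partial Ew//; exact: test_Cpartial.
have [B HB] := choice H.
(* the sum over the finitely many sequences of length n + 1 bounds them all *)
exists (fun k => if k == n.+1 then \sum_(t : n.+1.-tuple 'I_d) `|B t| else M k) => t tn.
have [tn'|tn'] := eqVneq (size t) n.+1; last first.
  by apply: HM; rewrite -ltnS ltn_neqAle tn' tn.
have := HB (Tuple (introT eqP tn')); apply: dist_Lnorm_leW.
rewrite (bigD1 (Tuple (introT eqP tn')))//= (le_trans (ler_norm _))// lerDl.
by apply: sumr_ge0.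
Qed.

(** The recursion between the orders up to N + 1, at the scale 2^-m. *)
Lemma derivative_step (N m : nat) (M : nat -> R) j s : (forall k, 0 < M k) ->
  (forall t, (size t <= N.+1)%N -> D (dist_partials t U) (M (size t))) -> size s = N ->
  D (dist_partials (j :: s) U) (2 * C * (2 ^+ m * M N + 2^-1 ^+ m *
     (d%:R * (\sum_(k < N.+1) 'C(N, k)%:R * c ^+ (N - k) * M k.+1) +
      \sum_(k < N.+1) 'C(N, k)%:R * c ^+ (N - k) * M k))).
Proof.
move=> M0 HM sN.
have [w [lw Ew]] := (dist_Lnorm_leP _ _).1 (HM s (leq_trans (eq_leq sN) (leqnSn N))).
rewrite sN in lw.
have HW l : D (dist_partials s (dist_mul (W l) (dist_partials [:: l] U)))
    (\sum_(k < N.+1) 'C(N, k)%:R * c ^+ (N - k) * M k.+1).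
  have := leibniz_bound (sW l) c0 (Wc l) lU HM (s := s) [::] (t := [:: l]).
  rewrite sN /= addn1 => /(_ (leqnn _)); apply: dist_Lnorm_leW.
  by rewrite le_eqVlt; apply/orP; left; apply/eqP; apply: eq_bigr => k _; rewrite add0n add1n.
have HV : D (dist_partials s (dist_mul V U)) (\sum_(k < N.+1) 'C(N, k)%:R * c ^+ (N - k) * M k).
  have := leibniz_bound sV c0 Vc lU HM (s := s) [::] (t := [::]).
  by rewrite sN /= addn0 => /(_ (leqnSn _)).
have HG := dist_Lnorm_leD (fun phi _ => erefl) (dist_Lnorm_le_sum (index_enum _) HW) HV.
have [g [lg Eg]] := (dist_Lnorm_leP _ _).1 HG.
rewrite sumr_const card_ord -mulr_natl in lg.
have G0 : 0 < d%:R * (\sum_(k < N.+1) 'C(N, k)%:R * c ^+ (N - k) * M k.+1) +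
      \sum_(k < N.+1) 'C(N, k)%:R * c ^+ (N - k) * M k.
  rewrite ltr_wpDl//.
    rewrite mulr_ge0// sumr_ge0// => k _; rewrite mulr_ge0 ?(ltW (M0 _))// mulr_ge0// exprn_ge0//.
  rewrite big_ord_recr /= binn subnn expr0 !mul1r ltr_wpDl//.
  by rewrite sumr_ge0// => k _; rewrite mulr_ge0 ?(ltW (M0 _))// mulr_ge0// exprn_ge0.
have Heq phi : test_function phi ->
    \sum_(i < d) dist_of w (Cpartial i (Cpartial i phi)) = dist_of g phi.
  move=> tphi; rewrite -Eg// -laplace_dist_partials//; apply: eq_bigr => i _.
  by rewrite Ew//; do 2 apply: test_Cpartial.
have [v [lv Ev]] := gradient_bound j m p1 K lw lg (M0 N) G0 Heq.
apply/dist_Lnorm_leP; exists v; split=> // phi tphi.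
by rewrite Ev// /= /dist_partial Ew//; exact: test_Cpartial.
Qed.

(** At order N + 1 the recursion turns any bound X into B / 4 + X / 2, where
    B = log_bound A (N + 1).  Since this is at most 3 X / 4 when X >= B,
    iterating from the finite bound of derivatives_Lp reaches B. *)
Lemma derivative_bound (A : R) : 0 < A ->
  (forall N : nat, exists m : nat, forall X, 0 <= X ->
    2 * C * (2 ^+ m * log_bound A N + 2^-1 ^+ m *
      (d%:R * (\sum_(i < N) 'C(N, i)%:R * c ^+ (N - i) * log_bound A i.+1 + X) +
       \sum_(i < N.+1) 'C(N, i)%:R * c ^+ (N - i) * log_bound A i)) <=
    log_bound A N.+1 / 4 + X / 2) ->
  forall t, D (dist_partials t U) (log_bound A (size t)).
Proof.
move=> A0 HA t; move: {2}(size t) (leqnn (size t)) => n.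
elim: n t => [|N IHN] t.
  case: t => // _; apply/dist_Lnorm_leP; exists u; split=> //.
  by apply: LpBW lu _; rewrite /log_bound /= expr0 mul1r fact0 divr1.
rewrite leq_eqVlt ltnS => /orP[/eqP tN|]; last exact: IHN.
have [m Hm] := HA N.
have Bd0 k : 0 < log_bound A k by exact: log_bound_gt0.
have improve (X : R) : 0 < X -> (forall s, size s = N.+1 -> D (dist_partials s U) X) ->
    forall s, size s = N.+1 -> D (dist_partials s U) (log_bound A N.+1 / 4 + X / 2).
  move=> X0 HX [//|j s] [sN].
  pose M (k : nat) : R := if k == N.+1 then X else log_bound A k.
  have M0 k : 0 < M k by rewrite /M; case: ifP.
  have HM s' : (size s' <= N.+1)%N -> D (dist_partials s' U) (M (size s')).
    rewrite /M; case: eqP => [e _|ne s'N]; first exact: HX.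
    by apply: IHN; rewrite -ltnS ltn_neqAle s'N andbT; apply/eqP.
  apply: (dist_Lnorm_leW _ (derivative_step m j M0 HM sN)); apply: le_trans (Hm X (ltW X0)).
  have Mle k : (k <= N)%N -> M k = log_bound A k by move=> kN; rewrite /M ltn_eqF.
  rewrite le_eqVlt; apply/orP; left; apply/eqP.
  rewrite (_ : \sum_(k < N.+1) _ * M k.+1 =
      \sum_(i < N) 'C(N, i)%:R * c ^+ (N - i) * log_bound A i.+1 + X); last first.
    rewrite big_ord_recr /= {2}/M eqxx subnn binn expr0 !mul1r; congr (_ + _).
    by apply: eq_bigr => k _; rewrite Mle.
  rewrite (_ : \sum_(k < N.+1) _ * M k = \sum_(i < N.+1) 'C(N, i)%:R * c ^+ (N - i) * log_bound A i).
    by rewrite Mle.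
  by apply: eq_bigr => k _; rewrite Mle// -ltnS.
have [M HM] := derivatives_Lp N.+1.
pose X0 := `|M N.+1| + 1.
have X00 : 0 < X0 by rewrite ltr_wpDl.
have HX0 s : size s = N.+1 -> D (dist_partials s U) X0.
  move=> sN; have := HM s (eq_leq sN); rewrite sN; apply: dist_Lnorm_leW.
  by rewrite (le_trans (ler_norm _))// lerDl.
have iterate (r : nat) s : size s = N.+1 ->
    D (dist_partials s U) (Num.max (log_bound A N.+1) ((3 / 4) ^+ r * X0)).
  elim: r s => [|r IHr] s sN.
    by apply: (dist_Lnorm_leW _ (HX0 s sN)); rewrite expr0 mul1r le_max lexx orbT.
  pose X := Num.max (log_bound A N.+1) ((3 / 4) ^+ r * X0).
  have X1 : log_bound A N.+1 <= X by rewrite /X le_max lexx.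
  have X2 : 0 < X by exact: lt_le_trans (Bd0 _) X1.
  apply: (dist_Lnorm_leW _ (improve X X2 IHr s sN)).
  apply: (@le_trans _ _ (3 / 4 * X)); first by lra.
  rewrite /X maxr_pMr// exprS -mulrA ge_max; apply/andP; split; last by rewrite le_max lexx orbT.
  by rewrite le_max; apply/orP; left; have := Bd0 N.+1; lra.
have p0 : (fun r : nat => (3 / 4) ^+ r : R) @ \oo --> (0 : R).
  by apply: cvg_expr; rewrite ger0_norm//; lra.
have [r Hr] : exists r : nat, (3 / 4) ^+ r < log_bound A N.+1 / X0.
  near \oo => r; exists r; near: r; apply: (cvgr_lt _ p0).
  exact: divr_gt0.
rewrite tN; apply: (dist_Lnorm_leW _ (iterate r t tN)).
by rewrite ge_max lexx /= -ler_pdivlMr// ltW.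
Unshelve. all: by end_near. Qed.

End solution.
End norms.
End functionals.

(** * Constants depending on the dimension only *)

Section conclusion.
Context {R : realType} {d : nat}.
Local Notation E := 'rV[R]_d.

Lemma Cvnorm_coord (z : 'rV[R[i]]_d) l : normc (z 0 l) <= Cvnorm z.
Proof.
rewrite /Cvnorm -[leLHS]ger0_norm ?normc_ge0// -sqrtr_sqr ler_wsqrtr//.
by rewrite (bigD1 l)//= lerDl sumr_ge0// => j _; exact: sqr_ge0.
Qed.

(** The constant comes from the kernels and from scale_choice, hence depends on
    the dimension only. *)
Lemma solution_bound : exists2 K : R, 1 <= K &
  forall (p : \bar R) (c : R) (W : E -> 'rV[R[i]]_d) (V u : E -> R[i]),
    (1 <= p)%E -> 0 < c -> vsmooth W -> smooth V ->
    (forall (a : 'I_d -> nat) x, Cvnorm (vpartial a W x) <= c ^+ mlen a) ->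
    (forall (a : 'I_d -> nat) x, normc (mpow Cpartial a V x) <= c ^+ mlen a) ->
    Lp_function p u -> solution W V u -> CLnorm p u = 1%E ->
    forall a : 'I_d -> nat,
      dist_Lnorm_le p (mpow dist_partial a (dist_of u)) (log_bound (c + K) (mlen a)).
Proof.
have [C [rho [kap Ker]]] := @kernels_exist R d.
have C1 : 1 <= 2 * C by have := kC Ker; lra.
have [K [K1 HK]] := scale_choice d C1.
exists K => // p c W V u p1 c0 sW sV HW HV [mu_ nu_] sol nu1 a.
have A0 : 0 < c + K by lra.
have lu : LpB p u 1 by split=> //; rewrite CnrmE nu1.
have Wc l s x : normc (Cpartials s (fun x => W x 0 l) x) <= c ^+ size s.
  rewrite Cpartials_mpow; last exact: sW.
  have := HW (fun i => count_mem i s) x; rewrite mlen_count; apply: le_trans.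
  by have := Cvnorm_coord (vpartial (fun i => count_mem i s) W x) l; rewrite /vpartial mxE.
have Vc s x : normc (Cpartials s V x) <= c ^+ size s.
  rewrite Cpartials_mpow//.
  by have := HV (fun i => count_mem i s) x; rewrite mlen_count.
rewrite mpow_nseq -size_mseq.
exact: (derivative_bound p1 Ker (ltW c0) sW sV Wc Vc lu sol A0 (fun N => HK c N (ltW c0))).
Qed.

Lemma log_bound_le_kappa (c K kappa : R) n : 0 < c -> 1 <= K -> 1 < kappa ->
  log_bound (c + K) n <= (kappa * c + K * ((ln kappa)^-1 + 1)) ^+ n *
     (n`!%:R / ln (n%:R + expR 1) ^+ n).
Proof.
move=> c0 K1 k1; rewrite /log_bound -/(lg n) ler_wpM2r//.
  by rewrite divr_ge0// exprn_ge0// ltW// lg_gt0.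
have lk : 0 < (ln kappa)^-1 by rewrite invr_gt0 ln_gt0.
apply: lerXn2r; rewrite ?nnegrE; [by lra| |].
  by rewrite addr_ge0// mulr_ge0//; lra.
by rewrite lerD//; nra.
Qed.

End conclusion.

Theorem theorem1p2 (R : realType) (d : nat) (hd : (2 <= d)%N) :
  (exists K : R, 0 < K /\
    forall (C0 : R) (W : 'rV[R]_d -> 'rV[R[i]]_d) (V u : 'rV[R]_d -> R[i]),
      0 < C0 -> vsmooth W -> smooth V ->
      (forall (a : 'I_d -> nat) (x : 'rV[R]_d),
        Cvnorm (vpartial a W x) <= C0 ^+ mlen a) ->
      (forall (a : 'I_d -> nat) (x : 'rV[R]_d),
        normc (mpow Cpartial a V x) <= C0 ^+ mlen a) ->
      Lp_function 1%E u -> solution W V u -> CLnorm 1%E u = 1%E ->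
      forall kappa : R, 1 < kappa ->
      forall a : 'I_d -> nat,
        dist_Lnorm_le 1%E (mpow dist_partial a (dist_of u))
          (K * (kappa * C0 + K * ((ln kappa)^-1 + 1)) ^+ mlen a *
           ((mlen a)`!%:R / ln ((mlen a)%:R + expR 1) ^+ mlen a)))
  /\
  (forall p : \bar R, (1 < p)%E ->
   exists K : R, 0 < K /\
    forall (C0 : R) (W : 'rV[R]_d -> 'rV[R[i]]_d) (V u : 'rV[R]_d -> R[i]),
      0 < C0 -> vsmooth W -> smooth V ->
      (forall (a : 'I_d -> nat) (x : 'rV[R]_d),
        Cvnorm (vpartial a W x) <= C0 ^+ mlen a) ->
      (forall (a : 'I_d -> nat) (x : 'rV[R]_d),
        normc (mpow Cpartial a V x) <= C0 ^+ mlen a) ->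
      Lp_function p u -> solution W V u -> CLnorm p u = 1%E ->
      forall kappa : R, 1 < kappa ->
      forall a : 'I_d -> nat,
        dist_Lnorm_le p (mpow dist_partial a (dist_of u))
          ((kappa * C0 + K * ((ln kappa)^-1 + 1)) ^+ mlen a *
           ((mlen a)`!%:R / ln ((mlen a)%:R + expR 1) ^+ mlen a))).
Proof.
have [K K1 HK] := @solution_bound R d.
have K0 : 0 < K by lra.
split=> [|p p1]; exists K; split=> // C0 W V u c0 sW sV HW HV Lu sol nu kappa k1 a.
  apply: (dist_Lnorm_leW _ (HK 1%E C0 W V u (lexx _) c0 sW sV HW HV Lu sol nu a)).
  apply: (le_trans (log_bound_le_kappa (mlen a) c0 K1 k1)).
  rewrite -mulrA ler_peMl//; apply: le_trans (log_bound_le_kappa (mlen a) c0 K1 k1).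
  by apply: ltW; apply: log_bound_gt0; lra.
apply: (dist_Lnorm_leW _ (HK p C0 W V u (ltW p1) c0 sW sV HW HV Lu sol nu a)).
exact: log_bound_le_kappa.
Qed.
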